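(* Let $R$ be a $GL_N$ type Hecke symmetry on $V$, $\dim_{\mathbb{C}}V=N$, with $q$ generic, and put $\nu=q-q^{-1}$. Let $\mathcal{L}(R)$ act on $\mathcal{M}(R)$ by the action $\triangleright$ described in the context. Then the Schur polynomials $s_\lambda(M)\in\mathcal{M}(R)$, $\lambda\vdash k$, are eigenvectors of the Casimir operator $\mathrm{Tr}_R L$ with respect to this action, in the sense that $$ \mathrm{Tr}_R L\triangleright s_\lambda(M)=\chi_\lambda(\mathrm{Tr}_R L)\,s_\lambda(M), \qquad \chi_\lambda(\mathrm{Tr}_R L)=\frac{N_q}{q^N}-\frac{\nu}{q^{2N}}\sum_{i=1}^k q^{-2c(i)}, $$ where the sum is taken over all boxes of a standard Young table $(\lambda,a)$ of shape $\lambda$ and $c(i)$ is the content of the box in which the integer $i$ is located (the sum depends only on the diagram $\lambda$).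
   Context: **Hecke symmetries.** $V$ is a complex vector space of dimension $N$. A Hecke symmetry is a linear operator $R:V^{\otimes 2}\to V^{\otimes 2}$ satisfying the braid relation $(R\otimes I)(I\otimes R)(R\otimes I)=(I\otimes R)(R\otimes I)(I\otimes R)$ and the Hecke condition $(qI-R)(q^{-1}I+R)=0$, where $q\in\mathbb{C}\setminus\{0,\pm1\}$ is generic, in particular $q^k\ne 1$ for all integers $k>1$. $I$ denotes an identity operator or unit matrix. Put $n_q=(q^n-q^{-n})/(q-q^{-1})$. $R$ is skew-invertible if there is $\Psi\in\mathrm{End}(V^{\otimes 2})$ with $\mathrm{Tr}_{(2)}R_{12}\Psi_{23}=\mathrm{Tr}_{(2)}\Psi_{12}R_{23}=P_{13}$, where $P$ is the flip and indices indicate the tensor factors. In this case put $C=\mathrm{Tr}_{(2)}\Psi_{12}\in\mathrm{End}(V)$; the $R$-trace of an $N\times N$ matrix $X$ is $\mathrm{Tr}_R X=\mathrm{Tr}(CX)$, and $\mathrm{Tr}_{R(1\dots k)}=\mathrm{Tr}_{R(1)}\cdots\mathrm{Tr}_{R(k)}$ is the $R$-trace taken over all $k$ tensor factors of $V^{\otimes k}$. $R$ is even of rank $m$ if the Poincaré-Hilbert series of the $R$-skew-symmetric algebra $\Lambda_R(V)=T(V)/\langle \mathrm{Im}(q^{-1}I+R)\rangle$ is a monic polynomial of degree $m$. A $GL_m$ type Hecke symmetry is a skew-invertible even Hecke symmetry of rank $m$; here $m=N=\dim V$. **Algebras.** $\mathcal{L}(R)$ and $\mathcal{M}(R)$ are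 the unital associative algebras generated by the entries of $N\times N$ matrices $L=\|l_i^j\|$ and $M=\|m_i^j\|$ subject respectively to $RL_1RL_1=L_1RL_1R$ and $RM_1RM_1=M_1RM_1R$, where $X_1=X\otimes I$. **Copies.** $R_i=I^{\otimes(i-1)}\otimes R\otimes I^{\otimes(k-i-1)}$ acts on $V^{\otimes k}$. For $X=L$ or $M$ put $X_{\overline 1}=X_{\underline 1}=X_1$, $X_{\overline{i+1}}=R_iX_{\overline i}R_i^{-1}$, $X_{\underline{i+1}}=R_i^{-1}X_{\underline i}R_i$. **Hecke algebra and idempotents.** $H_k(q)$ is generated by $1,\tau_1,\dots,\tau_{k-1}$ with $\tau_i\tau_{i+1}\tau_i=\tau_{i+1}\tau_i\tau_{i+1}$, $\tau_i\tau_j=\tau_j\tau_i$ for $|i-j|\ge2$, and $(q1-\tau_i)(q^{-1}1+\tau_i)=0$. Its $R$-matrix representation on $V^{\otimes k}$ is $\tau_i\mapsto R_i$. The Jucys-Murphy elements are $J_1=1$, $J_i=\tau_{i-1}J_{i-1}\tau_{i-1}$, $2\le i\le k$; the same symbols denote their images in the $R$-matrix representation. The content of the box of a Young diagram in row $m$ and column $n$ is $c=n-m$. For a partition $\lambda\vdash k$, the standard Young tables of shape $\lambda$ are denoted $(\lambda,a)$, with $a$ indexing the different tables, and $P_{(\lambda,a)}\in H_k(q)$ is the corresponding primitive idempotent: the (unique) primitive idempotent with $J_iP_{(\lambda,a)}=P_{(\lambda,a)}J_i=q^{2c(i)}P_{(\lambda,a)}$ for $1\le i\le k$, where $c(i)$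 is the content of the box of $(\lambda,a)$ containing $i$. $P_{(\lambda,a)}(R)$ is its image in the $R$-matrix representation on $V^{\otimes k}$. **Schur polynomials.** For $\lambda\vdash k$, $s_\lambda(M)=\mathrm{Tr}_{R(1\dots k)}\big(P_{(\lambda,a)}(R)M_1M_{\overline2}\cdots M_{\overline k}\big)\in\mathcal{M}(R)$; this is independent of the choice of the standard table $(\lambda,a)$ of shape $\lambda$. **Action.** The quantum double $(\mathcal{L}(R),\mathcal{M}(R),\sigma)$ is the algebra generated by both algebras with the permutation relation $RL_1RM_1=M_1RL_1R^{-1}$, i.e. $\sigma:\mathcal{L}(R)\otimes\mathcal{M}(R)\to\mathcal{M}(R)\otimes\mathcal{L}(R)$ is the map, compatible with the algebra structures, induced by $RL_1RM_1\mapsto M_1RL_1R^{-1}$. The counit $\varepsilon:\mathcal{L}(R)\to\mathbb{C}$ is the algebra homomorphism with $\varepsilon(l_i^j)=\delta_i^j$. The action of $\mathcal{L}(R)$ on $\mathcal{M}(R)$ is $a\triangleright b=(\mathrm{Id}\otimes\varepsilon)\sigma(a\otimes b)$. Explicitly, $L_{\underline{k+1}}\triangleright M_1M_{\overline2}\cdots M_{\overline k}=J_{k+1}^{-1}M_1M_{\overline2}\cdots M_{\overline k}$ on $V^{\otimes(k+1)}$, where $\triangleright$ between matrices means that in each entry of the matrix product the element of $\mathcal{L}(R)$ is applied as an operator to the element of $\mathcal{M}(R)$. A Casimir operator is the operator on $\mathcal{M}(R)$ given by the action of a central element of $\mathcal{L}(R)$; $\mathrm{Tr}_RL$ is such a central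 element. *)

(* Defs.v *)
(* V is C^N; an operator on the k-th tensor power is a matrix whose rows and
   columns are indexed by multi-indices {ffun 'I_k -> 'I_N}, through the
   canonical enumeration.  Tensor factors, Hecke generators, Jucys-Murphy
   elements and boxes of Young diagrams are all numbered from 0. *)
From HB Require Import structures.
From mathcomp Require Import all_boot all_order all_algebra.
From mathcomp Require Import finmap generic_quotient ring_quotient.
From mathcomp Require Import boolp classical_sets reals.
From mathcomp Require Import complex.
From mathcomp.multinomials Require Import monalg.

Set Implicit Arguments.
Unset Strict Implicit.
Unset Printing Implicit Defensive.
Import Order.TTheory GRing.Theory Num.Theory.
Local Open Scope ring_scope.

Notation freeAlg F I := {malg F[{fmonom I}]}.

Definition freeGen (F : fieldType) (I : choiceType) (i : I) : freeAlg F I :=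
  mkmalgU (fmu i) 1.

(* Value of a noncommutative polynomial; sc is the structure map F -> A. *)
Definition freeEval (F : fieldType) (I : choiceType) (A : pzRingType)
    (sc : F -> A) (f : I -> A) (p : freeAlg F I) : A :=
  \sum_(m <- msupp p) sc (mcoeff m p) * \prod_(i <- (m : seq I)) f i.

Section Presented.
Variables (F : fieldType) (I : choiceType) (rels : set (freeAlg F I)).
Local Notation FA := (freeAlg F I).

Definition in_ideal (x : FA) : Prop :=
  exists s : seq (FA * FA * FA),
    (forall t, t \in s -> rels t.1.2) /\
    x = \sum_(t <- s) t.1.1 * t.1.2 * t.2.

Definition idealPred : {pred FA} := fun x => `[< in_ideal x >].

Lemma in_ideal0 : in_ideal 0.
Proof. by exists [::]; split => //; rewrite big_nil. Qed.

Lemma in_idealD x y : in_ideal x -> in_ideal y -> in_ideal (x + y).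
Proof.
move=> [s [hs ->]] [t [ht ->]]; exists (s ++ t); rewrite big_cat; split=> //.
by move=> u; rewrite mem_cat => /orP[/hs|/ht].
Qed.

Lemma in_idealMl a x : in_ideal x -> in_ideal (a * x).
Proof.
move=> [s [hs ->]]; exists [seq (a * t.1.1, t.1.2, t.2) | t <- s]; split.
  by move=> u /mapP[t /hs ht ->].
by rewrite big_map mulr_sumr; apply: eq_bigr => t _ /=; rewrite !mulrA.
Qed.

Lemma in_idealMr a x : in_ideal x -> in_ideal (x * a).
Proof.
move=> [s [hs ->]]; exists [seq (t.1.1, t.1.2, t.2 * a) | t <- s]; split.
  by move=> u /mapP[t /hs ht ->].
by rewrite big_map mulr_suml; apply: eq_bigr => t _ /=; rewrite !mulrA.
Qed.

Lemma in_idealN x : in_ideal x -> in_ideal (- x).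
Proof. by move=> hx; rewrite -mulN1r; apply: in_idealMl. Qed.

Lemma ideal_zmod_closed : zmod_closed idealPred.
Proof.
split=> [|x y /asboolP hx /asboolP hy]; apply/asboolP; first exact: in_ideal0.
by apply: in_idealD => //; apply: in_idealN.
Qed.

HB.instance Definition _ := GRing.isZmodClosed.Build FA idealPred
  ideal_zmod_closed.

Local Notation idealC := (idealPred : zmodClosed FA).

Definition palg := Quotient.quot idealC.

HB.instance Definition _ := GRing.Zmodule.on palg.
HB.instance Definition _ : EqQuotient FA (Quotient.equiv idealC) palg :=
  EqQuotient.on palg.

Definition ppi (x : FA) : palg := \pi_(Quotient.quot idealC)%qT x.
Definition prepr (x : palg) : FA := generic_quotient.repr x.

Lemma preprK x : ppi (prepr x) = x.
Proof. exact: reprK. Qed.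

Lemma ppi_eq x y : in_ideal (x - y) -> ppi x = ppi y.
Proof.
move=> h; apply/eqP; rewrite /ppi -Quotient.idealrBE; exact/asboolP.
Qed.

Lemma ppi_eqP x y : ppi x = ppi y <-> in_ideal (x - y).
Proof.
split=> [/eqP|/ppi_eq//]; rewrite /ppi -Quotient.idealrBE => h.
exact/asboolP.
Qed.

Lemma ppiD x y : ppi (x + y) = ppi x + ppi y.
Proof. by rewrite /ppi !piE. Qed.

Definition pone : palg := ppi 1.
Definition pmul (x y : palg) : palg := ppi (prepr x * prepr y).
Definition pscale (c : F) (x : palg) : palg := ppi (c *: prepr x).

Lemma prepr_ppi x : in_ideal (prepr (ppi x) - x).
Proof. by apply/ppi_eqP; rewrite preprK. Qed.

Lemma ppiM x y : pmul (ppi x) (ppi y) = ppi (x * y).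
Proof.
apply: ppi_eq; set a := prepr (ppi x); set b := prepr (ppi y).
have -> : a * b - x * y = (a - x) * b + x * (b - y).
  by rewrite mulrBl mulrBr addrA subrK.
by apply: in_idealD; [apply: in_idealMr | apply: in_idealMl];
  apply: prepr_ppi.
Qed.

Lemma ppiZ c x : pscale c (ppi x) = ppi (c *: x).
Proof.
apply: ppi_eq; rewrite -scalerBr -[_ - x]mul1r scalerAl.
exact/in_idealMl/prepr_ppi.
Qed.

Lemma pmulA : associative pmul.
Proof.
by move=> x y z; rewrite -[x]preprK -[y]preprK -[z]preprK !ppiM mulrA.
Qed.
Lemma pmul1 : left_id pone pmul.
Proof. by move=> x; rewrite -[x]preprK ppiM mul1r. Qed.
Lemma pmulr1 : right_id pone pmul.
Proof. by move=> x; rewrite -[x]preprK ppiM mulr1. Qed.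
Lemma pmulDl : left_distributive pmul +%R.
Proof.
move=> x y z; rewrite -[x]preprK -[y]preprK -[z]preprK.
by rewrite -ppiD !ppiM mulrDl ppiD.
Qed.
Lemma pmulDr : right_distributive pmul +%R.
Proof.
move=> x y z; rewrite -[x]preprK -[y]preprK -[z]preprK.
by rewrite -ppiD !ppiM mulrDr ppiD.
Qed.

HB.instance Definition _ :=
  GRing.Zmodule_isPzRing.Build palg pmulA pmul1 pmulr1 pmulDl pmulDr.

Lemma pscaleA a b x : pscale a (pscale b x) = pscale (a * b) x.
Proof. by rewrite -[x]preprK !ppiZ scalerA. Qed.
Lemma pscale1 : left_id 1 pscale.
Proof. by move=> x; rewrite -[x]preprK ppiZ scale1r. Qed.
Lemma pscaleDr : right_distributive pscale +%R.
Proof.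
by move=> a x y; rewrite -[x]preprK -[y]preprK -ppiD !ppiZ scalerDr ppiD.
Qed.
Lemma pscaleDl x : {morph pscale^~ x : a b / a + b}.
Proof. by move=> a b; rewrite -[x]preprK !ppiZ scalerDl ppiD. Qed.

HB.instance Definition _ :=
  GRing.Zmodule_isLmodule.Build F palg pscaleA pscale1 pscaleDr pscaleDl.

Definition pcst (c : F) : palg := c *: pone.
Definition pgen (i : I) : palg := ppi (freeGen F i).

(* The homomorphism palg -> A sending pgen i to f i, provided that f
   satisfies the relations and sc is a central structure map. *)
Definition plift (A : pzRingType) (sc : F -> A) (f : I -> A) (x : palg) : A :=
  freeEval sc f (prepr x).

End Presented.

Arguments pcst {F I} rels c.
Arguments pgen {F I} rels i.
Arguments plift {F I} rels {A} sc f x.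

Definition mindex (N k : nat) := {ffun 'I_k -> 'I_N}.
Notation tensOp A N k := 'M[A]_#|{ffun 'I_k -> 'I_N}|.

Section TensOp.
Variables (A : pzRingType) (N : nat).

Definition mkop k (f : mindex N k -> mindex N k -> A) : tensOp A N k :=
  \matrix_(i, j) f (enum_val i) (enum_val j).

Definition opE k (X : tensOp A N k) (a b : mindex N k) : A :=
  X (enum_rank a) (enum_rank b).

Definition pair2 (u v : 'I_N) : mindex N 2 :=
  [ffun j => if j == ord0 then u else v].

(* X acting in tensor factor x, resp. in tensor factors x and y (in this
   order), and trivially in the others. *)
Definition leg1 k (x : 'I_k) (X : 'M[A]_N) : tensOp A N k :=
  mkop (fun a b => if [forall j, (j != x) ==> (a j == b j)]
                   then X (a x) (b x) else 0).

Definition leg2 k (x y : 'I_k) (X : tensOp A N 2) : tensOp A N k :=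
  mkop (fun a b => if [forall j, (j != x) && (j != y) ==> (a j == b j)]
                   then opE X (pair2 (a x) (a y)) (pair2 (b x) (b y)) else 0).

(* The same with natural-number positions, factor i resp. factors i, i+1;
   out of range the value is a dummy. *)
Definition leg_at k (i : nat) (X : 'M[A]_N) : tensOp A N k :=
  if insub i is Some x then leg1 (x : 'I_k) X else 1%:M.

Definition leg_adj k (i : nat) (X : tensOp A N 2) : tensOp A N k :=
  match insub i, insub i.+1 with
  | Some x, Some y => leg2 (x : 'I_k) (y : 'I_k) X
  | _, _ => 1%:M
  end.

Definition flip_op : tensOp A N 2 :=
  mkop (fun a b : mindex N 2 =>
    ((a ord0 == b ord_max) && (a ord_max == b ord0))%:R).

(* Partial trace over factor y; the remaining factors keep their order. *)
Definition insidx k (y : 'I_k.+1) (c : 'I_N) (a : mindex N k) : mindex N k.+1 :=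
  [ffun j => if unlift y j is Some j' then a j' else c].

Definition ptrace k (y : 'I_k.+1) (X : tensOp A N k.+1) : tensOp A N k :=
  mkop (fun a b => \sum_(c : 'I_N) opE X (insidx y c a) (insidx y c b)).

End TensOp.

Section HeckeSymmetry.
Variables (F : fieldType) (N : nat) (q : F).
Implicit Types R Psi : tensOp F N 2.

Definition generic : Prop :=
  [/\ q != 0, q != 1, q != -1 & forall k : nat, (1 < k)%N -> q ^+ k != 1].

Definition braid_relation R : Prop :=
  leg_adj 3 0 R *m leg_adj 3 1 R *m leg_adj 3 0 R = leg_adj 3 1 R *m leg_adj 3 0 R *m leg_adj 3 1 R.

Definition hecke_condition R : Prop :=
  (q%:M - R) *m ((q^-1)%:M + R) = 0.

Definition hecke_symmetry R : Prop := braid_relation R /\ hecke_condition R.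

Definition skew_inverse R Psi : Prop :=
  ptrace (inord 1 : 'I_3) (leg_adj 3 0 R *m leg_adj 3 1 Psi) = flip_op F N /\
  ptrace (inord 1 : 'I_3) (leg_adj 3 0 Psi *m leg_adj 3 1 R) = flip_op F N.

Definition skew_invertible R : Prop := exists Psi, skew_inverse R Psi.

(* C = Tr_(2) Psi_12, as an N x N matrix *)
Definition Cmat Psi : 'M[F]_N :=
  \matrix_(u, v) \sum_(c : 'I_N) opE Psi (pair2 u c) (pair2 v c).

(* The identification of V (x) V with the degree 2 part of T(V), the latter
   being the free algebra on the basis vectors. *)
Definition tensor2 (v : 'cV[F]_#|{ffun 'I_2 -> 'I_N}|) : freeAlg F 'I_N :=
  \sum_(a : mindex N 2)
     v (enum_rank a) 0 *: (freeGen F (a ord0) * freeGen F (a ord_max)).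

Definition skew_rels R : set (freeAlg F 'I_N) :=
  [set x | exists v, x = tensor2 (((q^-1)%:M + R) *m v)].

Definition Lambda R := palg (skew_rels R).

Definition Lambda_deg R (j : nat) : set (Lambda R) :=
  [set x | exists c : mindex N j -> F,
     x = \sum_(a : mindex N j) c a *: \prod_(i < j) pgen (skew_rels R) (a i)].

Arguments Lambda_deg R j : clear implicits.

Definition has_dim (U : lmodType F) (S : set U) (d : nat) : Prop :=
  exists f : {linear 'rV[F]_d -> U},
    injective f /\ (forall x, S x <-> exists v, x = f v).

Definition even_of_rank R (m : nat) : Prop :=
  exists p : {poly int}, [/\ p \is monic, size p = m.+1 &
    forall j : nat, exists2 d : nat, has_dim (Lambda_deg R j) d & p`_j = d%:R].

Definition GL_type R (m : nat) : Prop :=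
  [/\ hecke_symmetry R, skew_invertible R & even_of_rank R m].

End HeckeSymmetry.

Section REalgebra.
Variables (F : fieldType) (N : nat).
Implicit Types (R Psi : tensOp F N 2).

Section Generic.
Variables (A : pzRingType) (sc : F -> A).

Definition RE_defect R (X : 'M[A]_N) : tensOp A N 2 :=
  let Rm := map_mx sc R in let X1 := leg_at 2 0 X in
  Rm *m X1 *m Rm *m X1 - X1 *m Rm *m X1 *m Rm.

Definition perm_defect R (X Y : 'M[A]_N) : tensOp A N 2 :=
  let Rm := map_mx sc R in let Ri := map_mx sc (invmx R) in
  let X1 := leg_at 2 0 X in let Y1 := leg_at 2 0 Y in
  Rm *m X1 *m Rm *m Y1 - Y1 *m Rm *m X1 *m Ri.

Definition entries (Y : tensOp A N 2) : set A := [set x | exists a b, x = Y a b].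

Fixpoint barcopy R k (X : 'M[A]_N) (i : nat) : tensOp A N k :=
  if i is j.+1 then
    map_mx sc (leg_adj k j R) *m barcopy R k X j *m map_mx sc (invmx (leg_adj k j R))
  else leg_at k 0 X.

Definition trR Psi (X : 'M[A]_N) : A := \tr (map_mx sc (Cmat Psi) *m X).

(* R-trace over all k factors: the iterated R-trace is the ordinary trace
   against C_1 C_2 .. C_k. *)
Definition trRall Psi k (Y : tensOp A N k) : A :=
  \tr (map_mx sc (\prod_(i < k) leg1 i (Cmat Psi)) *m Y).

End Generic.

Definition RE_rels R : set (freeAlg F ('I_N * 'I_N)%type) :=
  entries (RE_defect (fun c => c *: 1) R (\matrix_(i, j) freeGen F (i, j))).

(* L(R) and M(R) are two copies of the same presented algebra. *)
Definition REalg R := palg (RE_rels R).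
Notation LR R := (REalg R) (only parsing).
Notation MR R := (REalg R) (only parsing).

Definition generator_mx R : 'M[REalg R]_N := \matrix_(i, j) pgen (RE_rels R) (i, j).

Definition double_rels R :
    set (freeAlg F ('I_N * 'I_N + 'I_N * 'I_N)%type) :=
  let L := \matrix_(i, j) freeGen F (inl (i, j)) in
  let M := \matrix_(i, j) freeGen F (inr (i, j)) in
  let sc := fun c => c *: 1 in
  (entries (RE_defect sc R L) `|` entries (RE_defect sc R M)
     `|` entries (perm_defect sc R L M))%classic.

Definition qdouble R := palg (double_rels R).

Definition iotaL R : LR R -> qdouble R :=
  plift (RE_rels R) (pcst (double_rels R)) (fun p => pgen (double_rels R) (inl p)).

Definition iotaM R : MR R -> qdouble R :=
  plift (RE_rels R) (pcst (double_rels R)) (fun p => pgen (double_rels R) (inr p)).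

Definition counit R : LR R -> F :=
  plift (RE_rels R) idfun (fun p => (p.1 == p.2)%:R).

(* Elements of M(R) (x) L(R) are written as finite sums of pure tensors
   t.1 (x) t.2.  The map sigma moves elements of M(R) to the left of elements
   of L(R) by means of the permutation relation: sigma (a (x) b) is the tensor
   s whose ordered product in the quantum double equals the product a b.  (For
   a skew-invertible Hecke symmetry multiplication M(R) (x) L(R) -> qdouble R
   is bijective, so s is determined up to equality of tensors.) *)
Definition is_sigma R (a : LR R) (b : MR R) (s : seq (MR R * LR R)) : Prop :=
  iotaL a * iotaM b = \sum_(t <- s) iotaM t.1 * iotaL t.2.

(* a |> b = (Id (x) counit) sigma (a (x) b) *)
Definition is_action R (a : LR R) (b c : MR R) : Prop :=
  exists2 s, is_sigma a b s & c = \sum_(t <- s) counit t.2 *: t.1.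

Definition REaction R (a : LR R) (b : MR R) : MR R :=
  xget 0 [set c | is_action a b c].

End REalgebra.

Section HeckeAlgebra.
Variables (F : fieldType) (q : F) (k : nat).

Definition hecke_rels : set (freeAlg F 'I_k.-1) :=
  let t (i : 'I_k.-1) := freeGen F i in
  [set x : freeAlg F 'I_k.-1 | [\/ exists i j : 'I_k.-1, j = i.+1 :> nat /\
                 x = t i * t j * t i - t j * t i * t j,
               exists i j : 'I_k.-1, ((i.+1 < j)%N \/ (j.+1 < i)%N) /\
                 x = t i * t j - t j * t i
             | exists i : 'I_k.-1, x = (q *: 1 - t i) * (q^-1 *: 1 + t i)]].

Definition heckeAlg := palg hecke_rels.

(* Out of range (i >= k - 1) the value is a dummy. *)
Definition tau (i : nat) : heckeAlg :=
  if insub i is Some j then pgen hecke_rels j else 1.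

Fixpoint jucys_murphy (i : nat) : heckeAlg :=
  if i is j.+1 then tau j * jucys_murphy j * tau j else 1.

Definition rho N (R : tensOp F N 2) : heckeAlg -> tensOp F N k :=
  plift hecke_rels scalar_mx (fun j : 'I_k.-1 => leg_adj k j R).

Definition primitive_idempotent (e : heckeAlg) : Prop :=
  [/\ e != 0, e * e = e &
      forall f g : heckeAlg, f * f = f -> g * g = g -> f * g = 0 -> g * f = 0 ->
        e = f + g -> f = 0 \/ g = 0].

Definition is_partition_of (lam : seq nat) : bool :=
  [&& sorted geq lam, 0%N \notin lam & sumn lam == k].

(* T i is the box, given as (row, column), that contains the integer i + 1. *)
Definition standard_tableau (lam : seq nat) (T : 'I_k -> nat * nat) : Prop :=
  [/\ injective T,
      forall b : nat * nat, (b.2 < nth 0 lam b.1)%N <-> exists i, T i = b,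
      forall i j, (T i).1 = (T j).1 -> ((T i).2 < (T j).2)%N -> (i < j)%N &
      forall i j, (T i).2 = (T j).2 -> ((T i).1 < (T j).1)%N -> (i < j)%N].

Definition content (b : nat * nat) : int := b.2%:Z - b.1%:Z.

Definition young_idempotent (T : 'I_k -> nat * nat) (P : heckeAlg) : Prop :=
  primitive_idempotent P /\
  forall i : 'I_k,
    jucys_murphy i * P = q ^ (2 * content (T i)) *: P /\
    P * jucys_murphy i = q ^ (2 * content (T i)) *: P.

(* The Schur polynomial s_lambda(M), for P the idempotent of a standard
   tableau of shape lambda. *)
Definition schur N (R Psi : tensOp F N 2) (P : heckeAlg) : REalg R :=
  let sc := pcst (RE_rels R) in
  trRall sc Psi (map_mx sc (rho R P) *m
                 \prod_(i < k) barcopy sc R k (generator_mx R) i).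

Definition qnum (n : nat) : F := (q ^+ n - q ^- n) / (q - q^-1).

Definition chi (N : nat) (T : 'I_k -> nat * nat) : F :=
  qnum N / q ^+ N
    - (q - q^-1) / q ^+ (2 * N) * \sum_(i < k) q ^ (- 2 * content (T i)).

End HeckeAlgebra.

Arguments schur {F q k N} R Psi P.

(* Main.v *)
(* The explicit formula for the action rests on the identity
   L_{under k+1} M_1 .. M_{bar k} = J_{k+1}^-1 M_1 .. M_{bar k} L_{bar k+1}
   in the quantum double, proved by induction on k from the permutation
   relation.  Taking the R-trace over factor k+1 gives Tr_R L on the left, and
   the counit turns L_{bar k+1} into 1, so that Tr_R L acts on
   M_1 .. M_{bar k} by the R-trace of J_{k+1}^-1 over factor k+1, which is
   Tr C - nu (1 - nu Tr C) \sum_(i <= k) J_i^-1; next to P_(lambda, a) the J_i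
   become the numbers q^(2 c(i)).

   That the result does not depend on the tensor chosen to represent
   sigma (a (x) b) follows from a representation of the quantum double on
   M(R): a tensor acts on 1 as its image under Id (x) counit.  Here M acts by
   left multiplication, while the action of L on the free algebra is obtained
   by solving the permutation relation for L M by means of Psi.  It preserves
   the relations of M(R), and it satisfies those of L(R), because each relation
   matrix passes through the other generating matrix.

   Tr C = N_q / q^N: the R-trace over the last factor maps the unnormalized
   q-antisymmetrizer A_{k+1} to (Tr C - q^-k k_q) A_k; A_{N+1} = 0 and A_N <> 0
   because the components of Lambda_R(V) of degrees N+1 and N have dimensions
   0 and 1. *)
From HB Require Import structures.
Require Import Defs.
From mathcomp Require Import all_boot all_order all_algebra.
From mathcomp Require Import finmap generic_quotient ring_quotient.
From mathcomp Require Import boolp classical_sets reals complex.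
From mathcomp Require Import ring.
From mathcomp.multinomials Require Import monalg.
Set Implicit Arguments.
Unset Strict Implicit.
Unset Printing Implicit Defensive.
Import Order.TTheory GRing.Theory Num.Theory.
Local Open Scope ring_scope.

(** * Operators on tensor powers *)

(** The entries of L and M do not commute, and the same matrix identities are needed over several
    rings: the field, the quantum double, M(R), and the endomorphisms of the free algebra and of
    M(R). They are therefore stated over an arbitrary ring [A] with a central structure map [sc] and
    carried from ring to ring by functoriality. The action is defined by a choice among representing
    tensors, so its value has to be both exhibited and shown to be unique. Uniqueness needs a map
    out of the quantum double, whose construction is delicate because the relations cannot all be
    imposed at once. L first acts on free words, where only the permutation relation holds; then the
    relations of M(R) are divided out; only on the quotient are the relations of L(R) verified, by
    induction on words starting from 1, where L acts as the identity matrix. The matrix identities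
    control only R-multiples of the wanted products; the skew inverse Psi recovers the single
    entries. *)

Section OpE.
Variables (A : pzRingType) (N k : nat).
Implicit Types (X Y : tensOp A N k) (a b c : mindex N k).

Lemma opE_mkop (f : mindex N k -> mindex N k -> A) a b :
  opE (mkop f) a b = f a b.
Proof. by rewrite /opE mxE !enum_rankK. Qed.

Lemma opEP X Y : (forall a b, opE X a b = opE Y a b) -> X = Y.
Proof.
move=> h; apply/matrixP => i j.
by have := h (enum_val i) (enum_val j); rewrite /opE !enum_valK.
Qed.

Lemma opE_mul X Y a b : opE (X *m Y) a b = \sum_c opE X a c * opE Y c b.
Proof.
rewrite /opE mxE (reindex (@enum_rank (mindex N k))) //=.
by apply: onW_bij; apply: enum_rank_bij.
Qed.

Lemma opE_add X Y a b : opE (X + Y) a b = opE X a b + opE Y a b.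
Proof. by rewrite /opE mxE. Qed.

Lemma opE_opp X a b : opE (- X) a b = - opE X a b.
Proof. by rewrite /opE mxE. Qed.

Lemma opE_sub X Y a b : opE (X - Y) a b = opE X a b - opE Y a b.
Proof. by rewrite opE_add opE_opp. Qed.

Lemma opE0 a b : opE (0 : tensOp A N k) a b = 0.
Proof. by rewrite /opE mxE. Qed.

Lemma opE_scalar x a b : opE (x%:M : tensOp A N k) a b = x *+ (a == b).
Proof. by rewrite /opE mxE (inj_eq enum_rank_inj). Qed.

Lemma opE1 a b : opE (1%:M : tensOp A N k) a b = (a == b)%:R.
Proof. exact: opE_scalar. Qed.

Lemma opE_map (B : pzRingType) (f : B -> A) (X : tensOp B N k) a b :
  opE (map_mx f X) a b = f (opE X a b).
Proof. by rewrite /opE mxE. Qed.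

End OpE.

Section Emb.
Variables (N n K : nat) (e : 'I_n -> 'I_K).
Hypothesis e_inj : injective e.
Implicit Types (a b : mindex N K) (c : mindex N n).

Definition idx_pull (a : mindex N K) : mindex N n := [ffun i => a (e i)].

Definition idx_upd (a : mindex N K) (c : mindex N n) : mindex N K :=
  [ffun j => if [pick i | e i == j] is Some i then c i else a j].

Definition agree_off (a b : mindex N K) : bool :=
  [forall j, (j \notin codom e) ==> (a j == b j)].

Lemma agree_offP a b :
  reflect (forall j, j \notin codom e -> a j = b j) (agree_off a b).
Proof.
apply: (iffP forallP) => h j; first by move=> hj; apply/eqP; move: (h j); rewrite hj.
by apply/implyP => /h ->.
Qed.

Lemma idx_upd_in a c i : idx_upd a c (e i) = c i.
Proof.
rewrite ffunE; case: pickP => [i' /eqP/e_inj -> //|/(_ i)].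
by rewrite eqxx.
Qed.

Lemma idx_upd_out a c j : j \notin codom e -> idx_upd a c j = a j.
Proof.
move=> hj; rewrite ffunE; case: pickP => // i /eqP eij.
by rewrite -eij codom_f in hj.
Qed.

Lemma idx_pull_upd a c : idx_pull (idx_upd a c) = c.
Proof. by apply/ffunP => i; rewrite ffunE idx_upd_in. Qed.

Lemma agree_upd a c : agree_off a (idx_upd a c).
Proof. by apply/agree_offP => j hj; rewrite idx_upd_out. Qed.

Lemma agree_sym a b : agree_off a b = agree_off b a.
Proof. by apply: eq_forallb => j; rewrite eq_sym. Qed.

Lemma agree_updE a b : agree_off a b -> idx_upd a (idx_pull b) = b.
Proof.
move=> /agree_offP h; apply/ffunP => j.
have [/codomP[i ->]|hj] := boolP (j \in codom e).
  by rewrite idx_upd_in ffunE.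
by rewrite idx_upd_out // h.
Qed.

Lemma agree_pull_eq a b : agree_off a b -> (idx_pull a == idx_pull b) = (a == b).
Proof.
move=> h; apply/eqP/eqP => [E|-> //].
rewrite -(agree_updE h) -E agree_updE //; exact/agree_offP.
Qed.

Variable A : pzRingType.
Implicit Types (X Y : tensOp A N n) (Z : tensOp A N K).

(** X placed in the factors e 0, e 1, ... and trivial elsewhere. [leg_at], [leg_adj] and [widen_op]
    are instances, so multiplicativity, change of scalars and commutation are proved once, for an
    arbitrary injection of factors. *)
Definition emb (X : tensOp A N n) : tensOp A N K :=
  mkop (fun a b => if agree_off a b then opE X (idx_pull a) (idx_pull b) else 0).

Lemma sum_agree (f : mindex N K -> A) a :
  \sum_(c | agree_off a c) f c = \sum_c f (idx_upd a c).
Proof.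
rewrite (reindex_onto (idx_upd a) idx_pull) => [|c hc]; last exact: agree_updE.
by apply: eq_bigl => c; rewrite agree_upd idx_pull_upd eqxx.
Qed.

Lemma opE_emb X a b : opE (emb X) a b =
  if agree_off a b then opE X (idx_pull a) (idx_pull b) else 0.
Proof. exact: opE_mkop. Qed.

Lemma opE_emb_mull X Z a b : opE (emb X *m Z) a b =
  \sum_c opE X (idx_pull a) c * opE Z (idx_upd a c) b.
Proof.
rewrite opE_mul (bigID (agree_off a)) /= [X in _ + X]big1 ?addr0; last first.
  by move=> c /negbTE hc; rewrite opE_emb hc mul0r.
rewrite sum_agree; apply: eq_bigr => c _.
by rewrite opE_emb agree_upd idx_pull_upd.
Qed.

Lemma opE_emb_mulr X Z a b : opE (Z *m emb X) a b =
  \sum_c opE Z a (idx_upd b c) * opE X c (idx_pull b).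
Proof.
rewrite opE_mul (bigID (agree_off b)) /= [X in _ + X]big1 ?addr0; last first.
  by move=> c /negbTE hc; rewrite opE_emb agree_sym hc mulr0.
rewrite sum_agree; apply: eq_bigr => c _.
by rewrite opE_emb agree_sym agree_upd idx_pull_upd.
Qed.

Lemma idx_agree_updl a b c : agree_off (idx_upd a c) b = agree_off a b.
Proof.
apply: eq_forallb => j; case: (boolP (j \in codom e)) => //= hj.
by rewrite idx_upd_out.
Qed.

Lemma embM X Y : emb (X *m Y) = emb X *m emb Y.
Proof.
apply: opEP => a b; rewrite opE_emb_mull opE_emb; case: ifP => hab.
  by rewrite opE_mul; apply: eq_bigr => c _; rewrite opE_emb idx_agree_updl hab idx_pull_upd.
by rewrite big1 // => c _; rewrite opE_emb idx_agree_updl hab mulr0.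
Qed.

Lemma embD X Y : emb (X + Y) = emb X + emb Y.
Proof.
by apply: opEP => a b; rewrite opE_add !opE_emb opE_add; case: ifP; rewrite ?addr0.
Qed.

Lemma embN X : emb (- X) = - emb X.
Proof.
by apply: opEP => a b; rewrite opE_opp !opE_emb opE_opp; case: ifP; rewrite ?oppr0.
Qed.

Lemma embB X Y : emb (X - Y) = emb X - emb Y.
Proof. by rewrite embD embN. Qed.

Lemma emb_scalar x : emb x%:M = x%:M.
Proof.
apply: opEP => a b; rewrite opE_emb !opE_scalar; case: ifP => hab.
  by rewrite agree_pull_eq.
by case: eqP hab => // ->; rewrite (introT (agree_offP _ _)).
Qed.

Lemma emb0 : emb 0 = 0.
Proof. by rewrite -[0 in LHS](subrr 0) embB subrr. Qed.

End Emb.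

Lemma emb_map (N n K : nat) (e : 'I_n -> 'I_K) (A B : pzRingType)
    (f : {additive A -> B}) (X : tensOp A N n) :
  emb e (map_mx f X) = map_mx f (emb e X).
Proof.
apply: opEP => a b; rewrite opE_map !opE_emb.
by case: ifP; rewrite ?opE_map ?raddf0.
Qed.

Lemma emb_comp (N n K K' : nat) (e : 'I_n -> 'I_K) (e' : 'I_K -> 'I_K')
    (A : pzRingType) (X : tensOp A N n) : injective e' ->
  emb e' (emb e X) = emb (e' \o e) X.
Proof.
move=> e'_inj; apply: opEP => a b; rewrite !opE_emb.
have -> : agree_off (e' \o e) a b =
          agree_off e' a b && agree_off e (idx_pull e' a) (idx_pull e' b).
  apply/agree_offP/andP => [h|[/agree_offP h1 /agree_offP h2] j hj].
    split; apply/agree_offP => j hj.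
      by apply: h; apply: contra hj => /codomP[i ->]; exact: (codom_f e' (e i)).
    rewrite !ffunE; apply: h; apply: contra hj => /codomP[i /e'_inj ->].
    exact: codom_f.
  have [/codomP[i ij]|hj'] := boolP (j \in codom e'); last exact: h1.
  have := h2 i; rewrite !ffunE ij; apply; apply: contra hj => /codomP[i' ii'].
  by rewrite ij ii'; exact: (codom_f (e' \o e) i').
case: (agree_off e' a b) => //=; case: ifP => // _.
by congr (opE X _ _); apply/ffunP => i; rewrite !ffunE.
Qed.

Lemma emb_ext (N n K : nat) (e e' : 'I_n -> 'I_K) (A : pzRingType)
    (X : tensOp A N n) : e =1 e' -> emb e X = emb e' X.
Proof.
move=> ee'; apply: opEP => a b; rewrite !opE_emb.
have -> : agree_off e a b = agree_off e' a b.
  by apply: eq_forallb => j; rewrite (eq_codom ee').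
by congr (if _ then opE X _ _ else _); apply/ffunP => i; rewrite !ffunE ee'.
Qed.

(** With disjoint factors each entry of either product has at most one nonzero term, since X fixes
    the indices in the image of e' and Y those in the image of e. Commutation of the entries is a
    hypothesis because A need not be commutative; in use one of the two operators has central scalar
    entries. *)
Lemma emb_commute (N n n' K : nat) (e : 'I_n -> 'I_K) (e' : 'I_n' -> 'I_K)
    (A : pzRingType) (X : tensOp A N n) (Y : tensOp A N n') :
  injective e -> injective e' ->
  (forall i i', e i != e' i') ->
  (forall a b c d, opE X a b * opE Y c d = opE Y c d * opE X a b) ->
  emb e X *m emb e' Y = emb e' Y *m emb e X.
Proof.
move=> e_inj e'_inj dis XY.
have out i : e i \notin codom e'.
  by apply/negP => /codomP[i' E]; have := dis i i'; rewrite E eqxx.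
have out' i : e' i \notin codom e.
  by apply/negP => /codomP[i' E]; have := dis i' i; rewrite E eqxx.
apply: opEP => a b; rewrite opE_emb_mull // opE_emb_mulr //.
set u := idx_pull e b.
rewrite (bigD1 u) //= [X in _ + X]big1 ?addr0; last first.
  move=> c cu; rewrite opE_emb; case: ifP; rewrite ?mulr0 // => /agree_offP h.
  case/eqP: cu; apply/ffunP => i; rewrite [RHS]ffunE -h //.
  by rewrite idx_upd_in.
rewrite (bigD1 (idx_pull e a)) //= [X in _ = _ + X]big1 ?addr0; last first.
  move=> c cu; rewrite opE_emb; case: ifP; rewrite ?mul0r // => /agree_offP h.
  case/eqP: cu; apply/ffunP => i; rewrite [RHS]ffunE h //.
  by rewrite idx_upd_in.
rewrite !opE_emb.
have -> : agree_off e' (idx_upd e a u) b = agree_off e' a (idx_upd e b (idx_pull e a)).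
  apply/agree_offP/agree_offP => h j hj.
    have [/codomP[i ->]|hj'] := boolP (j \in codom e).
      by rewrite idx_upd_in // ffunE.
    by have := h j hj; rewrite !idx_upd_out.
  have [/codomP[i ->]|hj'] := boolP (j \in codom e).
    by rewrite idx_upd_in // ffunE.
  by have := h j hj; rewrite !idx_upd_out.
case: ifP => _; rewrite ?mulr0 ?mul0r // XY.
by congr (opE Y _ _ * _); apply/ffunP => i; rewrite !ffunE //;
   case: pickP => // i' /eqP E; have := dis i' i; rewrite E eqxx.
Qed.

Lemma block_ord_proof (n K j : nat) (h : (j + n <= K)%N) (i : 'I_n) : (j + i < K)%N.
Proof. by apply: leq_trans h; rewrite ltn_add2l. Qed.

Definition block_ord (n K j : nat) (h : (j + n <= K)%N) (i : 'I_n) : 'I_K :=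
  Ordinal (block_ord_proof h i).

Lemma block_ord_inj (n K j : nat) (h : (j + n <= K)%N) : injective (block_ord h).
Proof. by move=> i i' [] /addnI/val_inj. Qed.

Section Legs.
Variables (A : pzRingType) (N : nat).
Implicit Types (X : 'M[A]_N) (Y : tensOp A N 2).

Definition op1 X : tensOp A N 1 := mkop (fun a b => X (a ord0) (b ord0)).

Lemma leg_atE K i (h : (i + 1 <= K)%N) X : leg_at K i X = emb (block_ord h) (op1 X).
Proof.
rewrite /leg_at; have hi : (i < K)%N by rewrite -addn1.
rewrite (insubT (fun i => (i < K)%N) hi); apply: opEP => a b.
rewrite opE_mkop opE_emb opE_mkop !ffunE.
have -> : block_ord h ord0 = Ordinal hi by apply: val_inj; rewrite /= addn0.
congr (if _ then _ else _); apply: eq_forallb => j; congr (~~ _ ==> _).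
apply/eqP/codomP => [->|[i' ->]]; first by exists ord0; apply: val_inj; rewrite /= addn0.
by apply: val_inj; rewrite /= ord1 addn0.
Qed.

Lemma leg_adjE K i (h : (i + 2 <= K)%N) Y : leg_adj K i Y = emb (block_ord h) Y.
Proof.
rewrite /leg_adj; have hi1 : (i.+1 < K)%N by rewrite addn2 in h.
have hi : (i < K)%N by apply: ltnW.
rewrite (insubT (fun i => (i < K)%N) hi) (insubT (fun i => (i < K)%N) hi1).
apply: opEP => a b.
rewrite opE_mkop opE_emb.
have E0 : block_ord h ord0 = Ordinal hi by apply: val_inj; rewrite /= addn0.
have E1 : block_ord h ord_max = Ordinal hi1 by apply: val_inj; rewrite /= addn1.
have pairE (c : mindex N K) : pair2 (c (Ordinal hi)) (c (Ordinal hi1)) = idx_pull (block_ord h) c.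
  apply/ffunP => j; rewrite !ffunE; case: eqP => [->|j0]; first by rewrite E0.
  have -> : j = ord_max; last by rewrite E1.
  by apply: val_inj; case: j j0 => [[|[|//]] //= hj] []; apply: val_inj.
rewrite /= !pairE; congr (if _ then _ else _); apply: eq_forallb => j; congr (_ ==> _).
rewrite -negb_or; congr (~~ _); apply/orP/codomP => [[/eqP->|/eqP->]|[[[|[|//]] hj] ->]].
- by exists ord0; rewrite E0.
- by exists ord_max; rewrite E1.
- by left; apply/eqP/val_inj; rewrite /= addn0.
- by right; apply/eqP/val_inj; rewrite /= addn1.
Qed.

(** The dummy value 1 lets products and inverses of legs be computed without bounds on i. [RinvE],
    by contrast, needs the bound, because the inverse of the dummy is not 1 - nu. *)
Lemma leg_adj_out K i Y : (K <= i.+1)%N -> leg_adj K i Y = 1%:M.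
Proof.
by move=> h; rewrite /leg_adj; case: insubP => // u _ _; rewrite insubF // ltnNge h.
Qed.

Lemma leg_adj_block n K j (h : (j + n <= K)%N) i Y : (i.+1 < n)%N ->
  emb (block_ord h) (leg_adj n i Y) = leg_adj K (j + i) Y.
Proof.
move=> hi; have h1 : (i + 2 <= n)%N by rewrite addn2.
have h2 : (j + i + 2 <= K)%N by apply: leq_trans h; rewrite -addnA leq_add2l.
rewrite (leg_adjE h1) (leg_adjE h2) emb_comp; last exact: block_ord_inj.
by apply: emb_ext => u; apply: val_inj; rewrite /= addnA.
Qed.

Lemma leg_at_block n K j (h : (j + n <= K)%N) i X : (i < n)%N ->
  emb (block_ord h) (leg_at n i X) = leg_at K (j + i) X.
Proof.
move=> hi; have h1 : (i + 1 <= n)%N by rewrite addn1.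
have h2 : (j + i + 1 <= K)%N by apply: leq_trans h; rewrite -addnA leq_add2l.
rewrite (leg_atE h1) (leg_atE h2) emb_comp; last exact: block_ord_inj.
by apply: emb_ext => u; apply: val_inj; rewrite /= addnA.
Qed.

Lemma leg_adjM K i Y Y' : leg_adj K i (Y *m Y') = leg_adj K i Y *m leg_adj K i Y'.
Proof.
have [h|h] := leqP (i + 2) K; first by rewrite !(leg_adjE h) embM //; apply: block_ord_inj.
by rewrite !leg_adj_out ?mulmx1 // -ltnS -addn2.
Qed.

Lemma leg_adj1 K i : leg_adj K i (1%:M : tensOp A N 2) = 1%:M.
Proof.
have [h|h] := leqP (i + 2) K; first by rewrite (leg_adjE h) emb_scalar //; apply: block_ord_inj.
by rewrite leg_adj_out // -ltnS -addn2.
Qed.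

Lemma leg_adj_far K i j Y Y' : (i.+1 < j)%N -> (j.+1 < K)%N ->
  (forall a b c d, opE Y a b * opE Y' c d = opE Y' c d * opE Y a b) ->
  leg_adj K i Y *m leg_adj K j Y' = leg_adj K j Y' *m leg_adj K i Y.
Proof.
move=> hij hj YY'; have h1 : (i + 2 <= K)%N by rewrite addn2; apply: leq_trans hij (ltnW (ltnW hj)).
have h2 : (j + 2 <= K)%N by rewrite addn2.
rewrite (leg_adjE h1) (leg_adjE h2); apply: emb_commute => //; try exact: block_ord_inj.
move=> u v; rewrite -val_eqE /= neq_ltn; apply/orP; left.
by apply: (leq_trans _ (leq_addr _ _)); apply: leq_trans hij; rewrite -[X in (_ < X)%N]addn2 ltn_add2l.
Qed.

Lemma leg_at_adj_commute K j X Y : (0 < j)%N -> (j.+1 < K)%N ->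
  (forall a b c d, X a b * opE Y c d = opE Y c d * X a b) ->
  leg_at K 0 X *m leg_adj K j Y = leg_adj K j Y *m leg_at K 0 X.
Proof.
move=> j0 hj XY; have h1 : (0 + 1 <= K)%N by apply: leq_trans hj.
have h2 : (j + 2 <= K)%N by rewrite addn2.
rewrite (leg_atE h1) (leg_adjE h2); apply: emb_commute => //; try exact: block_ord_inj.
  by move=> u v; rewrite -val_eqE /= ord1 add0n neq_ltn addn_gt0 j0.
by move=> a b c d; rewrite opE_mkop.
Qed.

End Legs.

Lemma leg_adj_map (A B : pzRingType) N (f : {rmorphism A -> B}) K i (Y : tensOp A N 2) :
  leg_adj K i (map_mx f Y) = map_mx f (leg_adj K i Y).
Proof.
have [h|h] := leqP (i + 2) K; first by rewrite !(leg_adjE h) emb_map.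
by rewrite !leg_adj_out ?map_mx1 // -ltnS -addn2.
Qed.

Lemma leg_at_map (A B : pzRingType) N (f : {rmorphism A -> B}) K i (X : 'M[A]_N) :
  leg_at K i (map_mx f X) = map_mx f (leg_at K i X).
Proof.
have [h|h] := leqP (i + 1) K.
  rewrite !(leg_atE h) -emb_map; congr (emb _ _).
  by apply: opEP => a b; rewrite opE_map !opE_mkop mxE.
have hi : (i < K)%N = false by rewrite ltnNge -ltnS -[i.+1]addn1 h.
by rewrite /leg_at !insubF ?map_mx1.
Qed.

Lemma leg_at1 (A : pzRingType) N K : leg_at K 0 (1%:M : 'M[A]_N) = 1%:M.
Proof.
have [h|h] := leqP 1 K; last by rewrite /leg_at insubF // ltnNge -ltnS (leq_trans h).
rewrite (@leg_atE _ _ K 0 h).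
have -> : op1 1%:M = 1%:M :> tensOp A N 1.
  apply: opEP => a b; rewrite opE_mkop opE1 mxE; congr (_%:R : A); congr nat_of_bool.
  by apply/eqP/eqP => [E|-> //]; apply/ffunP => i; rewrite (ord1 i).
by rewrite emb_scalar //; apply: block_ord_inj.
Qed.

Lemma subrV_neq0 (F : fieldType) (q : F) : q != 0 -> q ^+ 2 != 1 -> q - q^-1 != 0.
Proof.
move=> q0; apply: contra => /eqP h.
by rewrite -subr_eq0 -[X in _ - X](mulfV q0) expr2 -mulrBr h mulr0.
Qed.

(** * Braid generators and their inverses *)

Section Hecke.
Variables (F : fieldType) (N : nat) (q : F) (R : tensOp F N 2).
Hypothesis q0 : q != 0.
Hypothesis hR : hecke_symmetry q R.

Let nu := q - q^-1.

Lemma hecke_mulV : R *m (R - nu%:M) = 1%:M /\ (R - nu%:M) *m R = 1%:M.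
Proof.
have [_ h] := hR.
have h2 : R *m R = nu *: R + 1%:M.
  move: h; rewrite /hecke_condition mulmxDr !mulmxBl -scalar_mxM mulfV //.
  rewrite mul_scalar_mx mul_mx_scalar addrA => /subr0_eq <-.
  by rewrite scalerBl addrC addrA addrAC.
rewrite mulmxBr mulmxBl mul_mx_scalar mul_scalar_mx h2.
by rewrite addrAC subrr add0r.
Qed.

Lemma invmx_hecke : invmx R = R - nu%:M.
Proof.
have [h1 h2] := hecke_mulV; have u := mulmx1_unit h1.
by rewrite -[LHS]mulmx1 -h1 mulmxA mulVmx ?mul1mx //; case: u.
Qed.

Lemma hecke_invR : R *m invmx R = 1%:M.
Proof. by rewrite invmx_hecke; case: hecke_mulV. Qed.

Lemma hecke_invL : invmx R *m R = 1%:M.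
Proof. by rewrite invmx_hecke; case: hecke_mulV. Qed.

Lemma invmx_leg_adj K i : invmx (leg_adj K i R) = leg_adj K i (invmx R).
Proof.
have h1 : leg_adj K i R *m leg_adj K i (invmx R) = 1%:M.
  by rewrite -leg_adjM hecke_invR leg_adj1.
have [u _] := mulmx1_unit h1.
by rewrite -[LHS]mulmx1 -h1 mulmxA mulVmx ?mul1mx.
Qed.

Variables (A : pzRingType) (sc : {rmorphism F -> A}).
Hypothesis sc_central : forall c x, sc c * x = x * sc c.

Definition Rleg K i : tensOp A N K := map_mx sc (leg_adj K i R).
Definition Rinv K i : tensOp A N K := map_mx sc (leg_adj K i (invmx R)).

Lemma RlegK K i : Rleg K i * Rinv K i = 1.
Proof. by rewrite /Rleg /Rinv -mulmxE -map_mxM -leg_adjM hecke_invR leg_adj1 map_mx1. Qed.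

Lemma RinvK K i : Rinv K i * Rleg K i = 1.
Proof. by rewrite /Rleg /Rinv -mulmxE -map_mxM -leg_adjM hecke_invL leg_adj1 map_mx1. Qed.

Lemma Rleg_braid K i : (i.+2 < K)%N ->
  Rleg K i * Rleg K i.+1 * Rleg K i = Rleg K i.+1 * Rleg K i * Rleg K i.+1.
Proof.
move=> hi; have h : (i + 3 <= K)%N by rewrite addn3.
have [b _] := hR.
have := congr1 (fun X => emb (block_ord h) X) b.
rewrite !embM; try exact: block_ord_inj.
rewrite !leg_adj_block // addn0 addn1 => E.
by rewrite /Rleg -!mulmxE -!map_mxM E.
Qed.

Lemma Rleg_far K i j : (i.+1 < j)%N -> (j.+1 < K)%N ->
  Rleg K i * Rleg K j = Rleg K j * Rleg K i.
Proof.
move=> hij hj; rewrite /Rleg -!mulmxE -!map_mxM leg_adj_far //.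
by move=> *; rewrite mulrC.
Qed.

Lemma Rleg_at_commute K j X : (0 < j)%N -> (j.+1 < K)%N ->
  leg_at K 0 X * Rleg K j = Rleg K j * leg_at K 0 X.
Proof.
move=> j0 hj; rewrite /Rleg -leg_adj_map -!mulmxE leg_at_adj_commute //.
by move=> *; rewrite opE_map sc_central.
Qed.

Lemma RinvE K i : (i.+1 < K)%N -> Rinv K i = Rleg K i - (sc nu)%:M.
Proof.
move=> hi; have h : (i + 2 <= K)%N by rewrite addn2.
rewrite /Rinv /Rleg invmx_hecke !(leg_adjE h) embB emb_scalar; last exact: block_ord_inj.
by rewrite map_mxB map_scalar_mx.
Qed.

End Hecke.

(** * Copies of a matrix and Jucys-Murphy elements in an abstract ring *)

Section Copies.
Variables (B : pzRingType) (r s : nat -> B).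

(** Overlined and underlined copies, inverse Jucys-Murphy elements and Jucys-Murphy elements, for
    elements r_i with inverses s_i of any ring. Moving L through the copies of M uses only the braid
    and permutation relations and commutation with distant generators. *)
Fixpoint upcopy (X : B) i := if i is j.+1 then r j * upcopy X j * s j else X.
Fixpoint downcopy (X : B) i := if i is j.+1 then s j * downcopy X j * r j else X.
Fixpoint jminv i := if i is j.+1 then s j * jminv j * s j else 1.
Fixpoint jm i := if i is j.+1 then r j * jm j * r j else 1.

Hypothesis rK : forall i, r i * s i = 1.
Hypothesis sK : forall i, s i * r i = 1.

Lemma jmK i : jm i * jminv i = 1.
Proof.
elim: i => [|i IH]; first by rewrite /= mulr1.
by rewrite /= !mulrA -[_ * r i * s i]mulrA rK mulr1 -[_ * jm i * _]mulrA IH mulr1 rK.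
Qed.

Lemma commute_inv x i : x * r i = r i * x -> x * s i = s i * x.
Proof.
by move=> h; rewrite -[LHS]mul1r -(sK i) -mulrA [_ * (x * _)]mulrA -h -!mulrA rK mulr1.
Qed.

Variable m : nat.
Hypothesis braid : forall i, (i.+1 < m)%N ->
  r i * r i.+1 * r i = r i.+1 * r i * r i.+1.
Hypothesis far : forall i j, (i.+1 < j)%N -> (j < m)%N -> r i * r j = r j * r i.

(** The abstract form of acting in factor 0 only: the generators r_j with j > 0 avoid that
    factor. *)
Definition commutes_tail X := forall j, (0 < j < m)%N -> X * r j = r j * X.

Lemma upcopy_tail X i j : commutes_tail X -> (i < j < m)%N ->
  upcopy X i * r j = r j * upcopy X i.
Proof.
move=> hX; elim: i => [|i IH] /= /andP[hi hj]; first by apply: hX; rewrite hi.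
have E := far hi hj.
rewrite -mulrA -(commute_inv (esym E)) mulrA -[r i * _ * r j]mulrA IH ?hj ?andbT //.
  by rewrite !mulrA E.
exact: ltnW.
Qed.

Variables L M : B.
Hypothesis Lt : commutes_tail L.
Hypothesis Mt : commutes_tail M.

Lemma braid_conj a b a' b' : a * a' = 1 -> a' * a = 1 -> b * b' = 1 -> b' * b = 1 ->
  a * b * a = b * a * b :> B -> a' * b * a = b * a * b'.
Proof.
move=> h1 h2 h3 h4 E.
transitivity (a' * (b * a * b) * b').
  by rewrite -[LHS]mulr1 -h3 !mulrA.
by rewrite -E !mulrA h2 mul1r.
Qed.

(** The permutation relation climbs one factor at a time. With a = r_i, b = r_(i+1) and X, Y the
    i-th copies, b commutes with X and Y, and the braid relation brings the left-hand side to a b (a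
    X a Y) b' a', where the relation for i applies. The premise is guarded by [0 < m] since with a
    single tensor factor r_0 is only a dummy. *)
Lemma perm_upcopy i : ((0 < m)%N -> r 0 * L * r 0 * M = M * r 0 * L * s 0) -> (i < m)%N ->
  r i * upcopy L i * r i * upcopy M i = upcopy M i * r i * upcopy L i * s i.
Proof.
move=> h0; elim: i => [|i IH] hi; first exact: h0.
have {}IH := IH (ltnW hi).
set a := r i; set b := r i.+1; set a' := s i; set b' := s i.+1.
set X := upcopy L i; set Y := upcopy M i.
have bX : X * b = b * X by apply: upcopy_tail; rewrite // ltnSn.
have bY : Y * b = b * Y by apply: upcopy_tail; rewrite // ltnSn.
have b'X : X * b' = b' * X by apply: commute_inv.
have b'Y : Y * b' = b' * Y by apply: commute_inv.
have E : a * b * a = b * a * b by apply: braid.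
have E1 : a' * b * a = b * a * b' by apply: (braid_conj (rK i) (sK i) (rK i.+1) (sK i.+1)).
have E2 : b' * a' * b' = a' * b' * a'.
  have h x : x = x * (a * b * a) * (a' * b' * a').
    by rewrite !mulrA -[_ * a * a']mulrA rK mulr1 -[_ * b * b']mulrA rK mulr1 -mulrA rK mulr1.
  rewrite (h (b' * a' * b')) E !mulrA -[_ * b' * b]mulrA sK mulr1 -[_ * a' * a]mulrA sK mulr1.
  by rewrite sK mul1r.
rewrite /= -/a -/a' -/X -/Y.
transitivity (b * a * X * (a' * b * a) * Y * a'); first by rewrite !mulrA.
transitivity (b * a * (X * b) * a * (b' * Y) * a'); first by rewrite E1 !mulrA.
rewrite bX -b'Y.
transitivity (b * a * b * (X * a * Y) * b' * a'); first by rewrite !mulrA.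
rewrite -E.
transitivity (a * b * (a * X * a * Y) * b' * a'); first by rewrite !mulrA.
rewrite IH.
transitivity (a * (b * Y) * a * X * (a' * b' * a')); first by rewrite !mulrA.
rewrite -bY -E2.
transitivity (a * Y * (b * a) * (X * b') * a' * b'); first by rewrite !mulrA.
rewrite b'X.
transitivity (a * Y * (b * a * b') * X * a' * b'); first by rewrite !mulrA.
by rewrite -E1 !mulrA.
Qed.

Lemma upcopies_tail k j : (k <= j < m)%N ->
  (\prod_(i < k) upcopy M i) * r j = r j * \prod_(i < k) upcopy M i.
Proof.
elim: k => [|k IH] /andP[hk hj]; first by rewrite big_ord0 mulr1 mul1r.
rewrite big_ord_recr /= -mulrA upcopy_tail ?hk // mulrA IH ?mulrA //.
by rewrite hj ltnW.
Qed.

Lemma downcopy_upcopies k : ((0 < m)%N -> r 0 * L * r 0 * M = M * r 0 * L * s 0) -> (k <= m)%N ->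
  downcopy L k * \prod_(i < k) upcopy M i =
  jminv k * (\prod_(i < k) upcopy M i) * upcopy L k.
Proof.
move=> h0; elim: k => [|k IH] hk; first by rewrite big_ord0 /= !mulr1 mul1r.
rewrite big_ord_recr /=; set MM := \prod_(i < k) _ in IH *.
have rM : MM * r k = r k * MM by apply: upcopies_tail; rewrite leqnn hk.
have sM := commute_inv rM.
transitivity (s k * downcopy L k * (r k * MM) * upcopy M k); first by rewrite !mulrA.
rewrite -rM; transitivity (s k * (downcopy L k * MM) * r k * upcopy M k); first by rewrite !mulrA.
rewrite IH; last exact: ltnW.
(* Insert s_k r_k = 1, so that the left-hand side of the permutation relation for the k-th copies
   appears. *)
transitivity (s k * jminv k * MM * (s k * r k) * upcopy L k * r k * upcopy M k).
  by rewrite sK mulr1 !mulrA.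
transitivity (s k * jminv k * MM * s k * (r k * upcopy L k * r k * upcopy M k)); first by rewrite !mulrA.
rewrite (perm_upcopy h0 hk).
transitivity (s k * jminv k * (MM * s k) * upcopy M k * r k * upcopy L k * s k); first by rewrite !mulrA.
by rewrite sM !mulrA.
Qed.

End Copies.

Lemma sum_deltar (A : pzSemiRingType) (I : finType) (f : I -> A) (a : I) :
  \sum_x f x * (x == a)%:R = f a.
Proof.
rewrite (bigD1 a) //= eqxx mulr1 big1 ?addr0 // => x /negbTE ->.
by rewrite mulr0.
Qed.

Lemma sum_deltal (A : pzSemiRingType) (I : finType) (f : I -> A) (a : I) :
  \sum_x (x == a)%:R * f x = f a.
Proof.
rewrite (bigD1 a) //= eqxx mul1r big1 ?addr0 // => x /negbTE ->.
by rewrite mul0r.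
Qed.

(** * Coordinates on two and three tensor factors *)

Section Coordinates.
Variable N : nat.

Definition idx3 (x y z : 'I_N) : mindex N 3 := [ffun j : 'I_3 => nth x [:: x; y; z] j].

Lemma pair2_0 (x y : 'I_N) : pair2 x y ord0 = x.
Proof. by rewrite ffunE. Qed.

Lemma pair2_1 (x y : 'I_N) : pair2 x y ord_max = y.
Proof. by rewrite ffunE. Qed.

Lemma pair2E (a : mindex N 2) : a = pair2 (a ord0) (a ord_max).
Proof.
apply/ffunP => j; rewrite ffunE; case: eqP => [-> //|j0].
congr (a _); apply: val_inj; case: j j0 => [[|[|//]] //= hj] []; exact: val_inj.
Qed.

Lemma pair2_inj (x y x' y' : 'I_N) :
  (pair2 x y == pair2 x' y') = (x == x') && (y == y').
Proof.
apply/eqP/andP => [E|[/eqP-> /eqP-> //]].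
have h j : pair2 x y j = pair2 x' y' j by rewrite E.
by have := h ord0; have := h ord_max; rewrite !pair2_0 !pair2_1 => -> ->.
Qed.

Lemma big_pair2 (A : nmodType) (f : mindex N 2 -> A) :
  \sum_c f c = \sum_x \sum_y f (pair2 x y).
Proof.
rewrite pair_bigA /= (reindex_onto (fun p => pair2 p.1 p.2) (fun c => (c ord0, c ord_max))).
  by apply: eq_bigl => -[x y] /=; rewrite pair2_0 pair2_1 eqxx.
by move=> c _; rewrite -pair2E.
Qed.

Lemma idx3E (a : mindex N 3) : a = idx3 (a ord0) (a (inord 1)) (a ord_max).
Proof.
apply/ffunP => j; rewrite ffunE.
by case: j => [[|[|[|//]]] hj] /=; congr (a _); apply: val_inj; rewrite //= inordK.
Qed.

Lemma pull3_0 (h : (0 + 2 <= 3)%N) x y z : idx_pull (block_ord h) (idx3 x y z) = pair2 x y.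
Proof. by apply/ffunP => -[[|[|//]] hj]; rewrite !ffunE. Qed.

Lemma pull3_1 (h : (1 + 2 <= 3)%N) x y z : idx_pull (block_ord h) (idx3 x y z) = pair2 y z.
Proof. by apply/ffunP => -[[|[|//]] hj]; rewrite !ffunE. Qed.

Lemma agree3_0 (h : (0 + 2 <= 3)%N) (x y z x' y' z' : 'I_N) :
  agree_off (block_ord h) (idx3 x y z) (idx3 x' y' z') = (z == z').
Proof.
apply/agree_offP/eqP => [H|-> j hj].
  have := H ord_max; rewrite !ffunE; apply; apply/negP => /codomP[[[|[|//]] hi]] /(congr1 val) //.
rewrite !ffunE; case: j hj => [[|[|[|//]]] hj] //= /negP[]; apply/codomP.
  by exists ord0; apply: val_inj.
by exists ord_max; apply: val_inj.
Qed.

Lemma agree3_1 (h : (1 + 2 <= 3)%N) (x y z x' y' z' : 'I_N) :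
  agree_off (block_ord h) (idx3 x y z) (idx3 x' y' z') = (x == x').
Proof.
apply/agree_offP/eqP => [H|-> j hj].
  have := H ord0; rewrite !ffunE; apply; apply/negP => /codomP[[[|[|//]] hi]] /(congr1 val) //.
rewrite !ffunE; case: j hj => [[|[|[|//]]] hj] //= /negP[]; apply/codomP.
  by exists ord0; apply: val_inj.
by exists ord_max; apply: val_inj.
Qed.

Lemma upd3_0 (h : (0 + 2 <= 3)%N) (x y z p q : 'I_N) :
  idx_upd (block_ord h) (idx3 x y z) (pair2 p q) = idx3 p q z.
Proof. by rewrite -(pull3_0 h p q z) agree_updE ?agree3_0 //; apply: block_ord_inj. Qed.

Lemma upd3_1 (h : (1 + 2 <= 3)%N) (x y z p q : 'I_N) :
  idx_upd (block_ord h) (idx3 x y z) (pair2 p q) = idx3 x p q.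
Proof. by rewrite -(pull3_1 h x p q) agree_updE ?agree3_1 //; apply: block_ord_inj. Qed.

Variable A : pzRingType.

Lemma opE2_mull (X Z : tensOp A N 2) x y b : opE (X *m Z) (pair2 x y) b =
  \sum_p \sum_q opE X (pair2 x y) (pair2 p q) * opE Z (pair2 p q) b.
Proof. by rewrite opE_mul big_pair2. Qed.

Lemma opE3_0 (X : tensOp A N 2) x y z x' y' z' :
  opE (leg_adj 3 0 X) (idx3 x y z) (idx3 x' y' z') =
  opE X (pair2 x y) (pair2 x' y') * (z == z')%:R.
Proof.
rewrite (@leg_adjE _ _ 3 0 isT) opE_emb agree3_0 !pull3_0.
by case: eqP; rewrite ?mulr1 ?mulr0.
Qed.

Lemma opE3_1 (X : tensOp A N 2) x y z x' y' z' :
  opE (leg_adj 3 1 X) (idx3 x y z) (idx3 x' y' z') =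
  opE X (pair2 y z) (pair2 y' z') * (x == x')%:R.
Proof.
rewrite (@leg_adjE _ _ 3 1 isT) opE_emb agree3_1 !pull3_1.
by case: eqP; rewrite ?mulr1 ?mulr0.
Qed.

Lemma opE3_0_mull (X : tensOp A N 2) Z x y z b :
  opE (leg_adj 3 0 X *m Z) (idx3 x y z) b =
  \sum_p \sum_q opE X (pair2 x y) (pair2 p q) * opE Z (idx3 p q z) b.
Proof.
rewrite (@leg_adjE _ _ 3 0 isT) opE_emb_mull; last exact: block_ord_inj.
rewrite big_pair2; apply: eq_bigr => p _; apply: eq_bigr => r _.
by rewrite pull3_0 upd3_0.
Qed.

Lemma opE3_1_mull (X : tensOp A N 2) Z x y z b :
  opE (leg_adj 3 1 X *m Z) (idx3 x y z) b =
  \sum_p \sum_q opE X (pair2 y z) (pair2 p q) * opE Z (idx3 x p q) b.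
Proof.
rewrite (@leg_adjE _ _ 3 1 isT) opE_emb_mull; last exact: block_ord_inj.
rewrite big_pair2; apply: eq_bigr => p _; apply: eq_bigr => r _.
by rewrite pull3_1 upd3_1.
Qed.

Lemma pull_leg2 (h : (0 + 1 <= 2)%N) (x y : 'I_N) :
  idx_pull (block_ord h) (pair2 x y) = [ffun=> x].
Proof. by apply/ffunP => j; rewrite !ffunE ord1. Qed.

Lemma agree_leg2 (h : (0 + 1 <= 2)%N) (x y x' y' : 'I_N) :
  agree_off (block_ord h) (pair2 x y) (pair2 x' y') = (y == y').
Proof.
apply/agree_offP/eqP => [H|-> j hj].
  have := H ord_max; rewrite !pair2_1; apply; apply/negP => /codomP[] i /(congr1 val).
  by rewrite /= ord1.
rewrite !ffunE; case: eqP => // j0; case/negP: hj; apply/codomP; exists ord0.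
by rewrite j0; apply: val_inj.
Qed.

Lemma opE_leg2 (X : 'M[A]_N) x y x' y' :
  opE (leg_at 2 0 X) (pair2 x y) (pair2 x' y') = X x x' * (y == y')%:R.
Proof.
rewrite (@leg_atE _ _ 2 0 isT) opE_emb agree_leg2 !pull_leg2 opE_mkop !ffunE.
by case: eqP; rewrite ?mulr1 ?mulr0.
Qed.

Lemma big_idx1 (f : mindex N 1 -> A) : \sum_c f c = \sum_x f [ffun=> x].
Proof.
rewrite (reindex_onto (fun x => [ffun=> x]) (fun c : mindex N 1 => c ord0)).
  by apply: eq_bigl => x /=; rewrite ffunE eqxx.
by move=> c _; apply/ffunP => j; rewrite ffunE (ord1 j).
Qed.

Lemma opE_leg2_mull (X : 'M[A]_N) Z x y b :
  opE (leg_at 2 0 X *m Z) (pair2 x y) b = \sum_p X x p * opE Z (pair2 p y) b.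
Proof.
rewrite opE2_mull; apply: eq_bigr => p _.
rewrite (bigD1 y) //= opE_leg2 eqxx mulr1 big1 ?addr0 // => q /negbTE qy.
by rewrite opE_leg2 eq_sym qy mulr0 mul0r.
Qed.

Lemma opE_leg2_mulr (X : 'M[A]_N) Z x y b :
  opE (Z *m leg_at 2 0 X) b (pair2 x y) = \sum_p opE Z b (pair2 p y) * X p x.
Proof.
rewrite opE_mul big_pair2; apply: eq_bigr => p _.
rewrite (bigD1 y) //= opE_leg2 eqxx mulr1 big1 ?addr0 // => q /negbTE qy.
by rewrite opE_leg2 qy !mulr0.
Qed.

Lemma agree_leg3 (h : (0 + 1 <= 3)%N) (x y z x' y' z' : 'I_N) :
  agree_off (block_ord h) (idx3 x y z) (idx3 x' y' z') = (y == y') && (z == z').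
Proof.
apply/agree_offP/andP => [H|[/eqP-> /eqP-> j hj]].
  split; apply/eqP; [have := H (inord 1)|have := H ord_max]; rewrite !ffunE ?inordK //=;
  apply; apply/negP => /codomP[] i /(congr1 val); rewrite /= ord1 //.
  by rewrite inordK.
rewrite !ffunE; case: j hj => [[|[|[|//]]] hj] //= /negP[]; apply/codomP.
by exists ord0; apply: val_inj.
Qed.

Lemma pull_leg3 (h : (0 + 1 <= 3)%N) (x y z : 'I_N) :
  idx_pull (block_ord h) (idx3 x y z) = [ffun=> x].
Proof. by apply/ffunP => j; rewrite !ffunE ord1. Qed.

Lemma opE_leg3_mull (X : 'M[A]_N) Z x y z b :
  opE (leg_at 3 0 X *m Z) (idx3 x y z) b = \sum_p X x p * opE Z (idx3 p y z) b.
Proof.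
rewrite (@leg_atE _ _ 3 0 isT) opE_emb_mull; last exact: block_ord_inj.
rewrite big_idx1; apply: eq_bigr => p _.
rewrite pull_leg3 opE_mkop !ffunE; congr (_ * opE _ _ _).
rewrite -(pull_leg3 isT p y z) agree_updE ?agree_leg3 ?eqxx //; exact: block_ord_inj.
Qed.

Lemma opE_leg3 (X : 'M[A]_N) x y z x' y' z' :
  opE (leg_at 3 0 X) (idx3 x y z) (idx3 x' y' z') = X x x' * ((y == y') && (z == z'))%:R.
Proof.
rewrite (@leg_atE _ _ 3 0 isT) opE_emb agree_leg3 !pull_leg3 opE_mkop !ffunE.
by case: (_ && _); rewrite ?mulr1 ?mulr0.
Qed.

Lemma insidx_mid (x y c : 'I_N) : insidx (inord 1 : 'I_3) c (pair2 x y) = idx3 x c y.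
Proof.
apply/ffunP => j; rewrite ffunE; case: unliftP => [j' ->|->].
  rewrite !ffunE /= /bump inordK //; by case: j' => [[|[|//]] hj].
by rewrite ffunE inordK.
Qed.

End Coordinates.

Lemma exchange_2_3 (V : nmodType) (I J : finType) (f : J -> J -> J -> I -> I -> V) :
  \sum_i \sum_j \sum_x \sum_y \sum_z f x y z i j =
  \sum_x \sum_y \sum_z \sum_i \sum_j f x y z i j.
Proof.
transitivity (\sum_(p : I * I) \sum_(t : J * (J * J)) f t.1 t.2.1 t.2.2 p.1 p.2).
  rewrite pair_bigA; apply: eq_bigr => p _ /=.
  rewrite -(pair_bigA _ (fun x u => f x u.1 u.2 p.1 p.2)) /=.
  by apply: eq_bigr => x _; rewrite pair_bigA.
rewrite exchange_big /= -(pair_bigA _ (fun x u => \sum_p f x u.1 u.2 p.1 p.2)) /=.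
apply: eq_bigr => x _; rewrite -(pair_bigA _ (fun y z => \sum_p f x y z p.1 p.2)) /=.
by apply: eq_bigr => y _; apply: eq_bigr => z _; rewrite pair_bigA.
Qed.

Section Contract.
Variables (F : comPzRingType) (I : finType).

Lemma contract_2_3 (g : I -> I -> F) (h : I -> I -> I -> F) (k : I -> I -> I -> I -> I -> F) :
  \sum_i \sum_j g i j * (\sum_x \sum_y \sum_z h x y z * k x y z i j) =
  \sum_x \sum_y \sum_z h x y z * (\sum_i \sum_j g i j * k x y z i j).
Proof.
transitivity (\sum_i \sum_j \sum_x \sum_y \sum_z h x y z * (g i j * k x y z i j)).
  apply: eq_bigr => i _; apply: eq_bigr => j _; rewrite mulr_sumr; apply: eq_bigr => x _.
  rewrite mulr_sumr; apply: eq_bigr => y _; rewrite mulr_sumr; apply: eq_bigr => z _.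
  by rewrite mulrCA.
rewrite exchange_2_3; apply: eq_bigr => x _; apply: eq_bigr => y _; apply: eq_bigr => z _.
by rewrite mulr_sumr; apply: eq_bigr => i _; rewrite mulr_sumr.
Qed.

End Contract.

(** * The R-trace *)

Section Skew.
Variables (F : fieldType) (N : nat) (q : F) (R Psi : tensOp F N 2).
Hypothesis q0 : q != 0.
Hypothesis hR : hecke_symmetry q R.
Hypothesis hPsi : skew_inverse R Psi.

Local Notation r a b c d := (opE R (pair2 a b) (pair2 c d)).
Local Notation ri a b c d := (opE (invmx R) (pair2 a b) (pair2 c d)).
Local Notation psi a b c d := (opE Psi (pair2 a b) (pair2 c d)).
Local Notation C := (Cmat Psi).

Lemma ptrace_overlap (X Y : tensOp F N 2) a1 a3 b1 b3 :
  opE (ptrace (inord 1 : 'I_3) (leg_adj 3 0 X *m leg_adj 3 1 Y))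
      (pair2 a1 a3) (pair2 b1 b3) =
  \sum_c \sum_d opE X (pair2 a1 c) (pair2 b1 d) * opE Y (pair2 d a3) (pair2 c b3).
Proof.
rewrite opE_mkop; apply: eq_bigr => c _; rewrite !insidx_mid opE3_0_mull.
rewrite exchange_big /=; apply: eq_bigr => d _.
under eq_bigr => p _ do rewrite opE3_1 mulrA.
exact: sum_deltar.
Qed.

(** In coordinates, Psi inverts R regarded as a matrix whose rows and columns are pairs formed of
    one row index and one column index of R. This is what later removes R from a contraction. *)
Lemma skewR a1 a3 b1 b3 : \sum_c \sum_d r a1 c b1 d * psi d a3 c b3 =
  (a1 == b3)%:R * (a3 == b1)%:R.
Proof.
have [h _] := hPsi; rewrite -ptrace_overlap h opE_mkop !pair2_0 !pair2_1.
by rewrite -natrM mulnb.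
Qed.

Lemma skewL a1 a3 b1 b3 : \sum_c \sum_d psi a1 c b1 d * r d a3 c b3 =
  (a1 == b3)%:R * (a3 == b1)%:R.
Proof.
have [_ h] := hPsi; rewrite -ptrace_overlap h opE_mkop !pair2_0 !pair2_1.
by rewrite -natrM mulnb.
Qed.

Lemma r_ri a b c d : \sum_x \sum_y r a b x y * ri x y c d = (a == c)%:R * (b == d)%:R.
Proof.
by rewrite -opE2_mull (hecke_invR q0 hR) opE1 pair2_inj -natrM mulnb.
Qed.

Lemma CmatE u v : C u v = \sum_c psi u c v c.
Proof. by rewrite mxE. Qed.

(** Tracing Tr_(2) R_12 Psi_23 = P_13 over factor 3 turns Psi into C and the flip into the
    identity. *)
Lemma Rtrace_R y z : \sum_c \sum_d C c d * r y d z c = (y == z)%:R.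
Proof.
transitivity (\sum_e (y == e)%:R * (e == z)%:R : F); last exact: (sum_deltar (fun e => (y == e)%:R)).
under [RHS]eq_bigr => e _ do rewrite -skewR.
rewrite [RHS]exchange_big [LHS]exchange_big /=.
apply: eq_bigr => d _; rewrite [RHS]exchange_big /=; apply: eq_bigr => c _.
by rewrite CmatE mulr_suml; apply: eq_bigr => e _; rewrite mulrC.
Qed.

Lemma braid_coord i1 i2 i3 j1 j2 j3 :
  \sum_x \sum_y \sum_z r i1 i2 x y * r y i3 z j3 * ri x z j1 j2 =
  \sum_y \sum_z \sum_x ri i2 i3 y z * r i1 y j1 x * r x z j2 j3.
Proof.
set a := leg_adj 3 0 R; set b := leg_adj 3 1 R.
set a' := leg_adj 3 0 (invmx R); set b' := leg_adj 3 1 (invmx R).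
have E : a *m (b *m a') = b' *m (a *m b).
  have [br _] := hR; rewrite /braid_relation -/a -/b in br.
  have aa' : a *m a' = 1%:M by rewrite -leg_adjM (hecke_invR q0 hR) leg_adj1.
  have b'b : b' *m b = 1%:M by rewrite -leg_adjM (hecke_invL q0 hR) leg_adj1.
  by rewrite -[LHS]mul1mx -b'b -!mulmxA [b *m (a *m _)]mulmxA [b *m a *m _]mulmxA -br -!mulmxA aa' mulmx1.
have := congr1 (fun X => opE X (idx3 i1 i2 i3) (idx3 j1 j2 j3)) E.
rewrite opE3_0_mull opE3_1_mull => {}E.
transitivity (\sum_x \sum_y r i1 i2 x y * opE (b *m a') (idx3 x y i3) (idx3 j1 j2 j3)).
  apply: eq_bigr => x _; apply: eq_bigr => y _; rewrite opE3_1_mull.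
  rewrite mulr_sumr; apply: eq_bigr => z _.
  under eq_bigr => w _ do rewrite opE3_0 mulrA.
  by rewrite sum_deltar mulrA.
rewrite E; apply: eq_bigr => y _; apply: eq_bigr => z _.
rewrite opE3_0_mull exchange_big mulr_sumr; apply: eq_bigr => x _.
under eq_bigr => w _ do rewrite opE3_1 mulrA.
by rewrite sum_deltar mulrA.
Qed.

(* Contract the outer two legs of R12 R23 R12^-1 = R23^-1 R12 R23 with Psi
   and C respectively. *)
Lemma Rtrace_conj a b i j :
  \sum_c \sum_d \sum_e C c d * (ri i d b e * r a e j c) = C a b * (i == j)%:R.
Proof.
pose T1 i3 j3 := \sum_i1 \sum_j1 psi a j1 b i1 *
  (\sum_y \sum_z \sum_x (ri i i3 y z * r x z j j3) * r i1 y j1 x).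
have T1E i3 j3 : T1 i3 j3 = \sum_z ri i i3 b z * r a z j j3.
  rewrite /T1 contract_2_3 (bigD1 b) //= [X in _ + X]big1 ?addr0; last first.
    move=> y yb; rewrite big1 // => z _; rewrite big1 // => x _.
    by rewrite exchange_big skewL (negbTE yb) !mulr0.
  apply: eq_bigr => z _; rewrite (bigD1 a) //= [X in _ + X]big1 ?addr0; last first.
    by move=> x xa; rewrite exchange_big skewL eq_sym (negbTE xa) mul0r mulr0.
  by rewrite exchange_big skewL !eqxx !mulr1.
pose T2 i1 j1 := \sum_c \sum_d C c d *
  (\sum_x \sum_y \sum_z (r i1 i x y * ri x z j1 j) * r y d z c).
have T2E i1 j1 : T2 i1 j1 = (i1 == j1)%:R * (i == j)%:R.
  rewrite /T2 contract_2_3 -r_ri; apply: eq_bigr => x _; apply: eq_bigr => y _.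
  under eq_bigr => z _ do rewrite Rtrace_R eq_sym.
  exact: sum_deltar.
transitivity (\sum_c \sum_d C c d * T1 d c).
  apply: eq_bigr => c _; apply: eq_bigr => d _; rewrite T1E mulr_sumr.
  exact: eq_bigr.
transitivity (\sum_i1 \sum_j1 psi a j1 b i1 * T2 i1 j1); last first.
  under eq_bigr => i1 _ do under eq_bigr => j1 _ do rewrite T2E mulrA eq_sym.
  under eq_bigr => i1 _ do rewrite -mulr_suml sum_deltar.
  by rewrite -mulr_suml CmatE.
transitivity (\sum_c \sum_d \sum_i1 \sum_j1 C c d * (psi a j1 b i1 *
  (\sum_x \sum_y \sum_z (r i1 i x y * ri x z j1 j) * r y d z c))).
  apply: eq_bigr => c _; apply: eq_bigr => d _; rewrite mulr_sumr.
  apply: eq_bigr => i1 _; rewrite mulr_sumr; apply: eq_bigr => j1 _.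
  congr (_ * (_ * _)); rewrite [RHS](_ : _ = \sum_x \sum_y \sum_z r i1 i x y * r y d z c * ri x z j1 j); last first.
    by do 3 (apply: eq_bigr => ? _); rewrite mulrAC.
  by rewrite braid_coord; do 3 (apply: eq_bigr => ? _); rewrite mulrAC.
transitivity (\sum_i1 \sum_j1 \sum_c \sum_d C c d * (psi a j1 b i1 *
  (\sum_x \sum_y \sum_z (r i1 i x y * ri x z j1 j) * r y d z c))).
  rewrite pair_bigA /=; under eq_bigr => p _ do rewrite pair_bigA /=.
  rewrite exchange_big /=.
  rewrite -(pair_bigA _ (fun i1 j1 => \sum_p C p.1 p.2 * (psi a j1 b i1 *
    (\sum_x \sum_y \sum_z (r i1 i x y * ri x z j1 j) * r y p.2 z p.1)))) /=.
  by do 2 (apply: eq_bigr => ? _); rewrite pair_bigA.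
apply: eq_bigr => i1 _; apply: eq_bigr => j1 _; rewrite mulr_sumr; apply: eq_bigr => c _.
by rewrite mulr_sumr; apply: eq_bigr => d _; rewrite mulrCA.
Qed.

End Skew.

(** * Splitting off the last tensor factor *)

Section LastLeg.
Variable N : nat.

Definition idx_snoc k (a : mindex N k) (d : 'I_N) : mindex N k.+1 := insidx ord_max d a.

Lemma idx_snoc_last k (a : mindex N k) d : idx_snoc a d ord_max = d.
Proof. by rewrite ffunE unlift_none. Qed.

Lemma idx_snoc_lift k (a : mindex N k) d j : idx_snoc a d (lift ord_max j) = a j.
Proof. by rewrite ffunE liftK. Qed.

Lemma idx_snoc_lt k (a : mindex N k) d (j : 'I_k.+1) (h : (j < k)%N) :
  idx_snoc a d j = a (Ordinal h).
Proof.
by rewrite -(idx_snoc_lift a d); congr (idx_snoc _ _ _); apply: val_inj; rewrite /= /bump leqNgt h.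
Qed.

Lemma idx_snocE k (b : mindex N k.+1) : {a : mindex N k & {d | b = idx_snoc a d}}.
Proof.
exists [ffun j => b (lift ord_max j)], (b ord_max).
by apply/ffunP => j; rewrite ffunE; case: unliftP => [j'|] -> //; rewrite ffunE.
Qed.

Lemma idx_snoc_inj k (a b : mindex N k) c d :
  (idx_snoc a c == idx_snoc b d) = (a == b) && (c == d).
Proof.
apply/eqP/andP => [E|[/eqP-> /eqP->] //]; split; apply/eqP.
  by apply/ffunP => j; rewrite -(idx_snoc_lift a c) E idx_snoc_lift.
by rewrite -(idx_snoc_last a c) E idx_snoc_last.
Qed.

Definition widen_op (A : pzRingType) k (X : tensOp A N k) : tensOp A N k.+1 :=
  emb (block_ord (leqnSn k : (0 + k <= k.+1)%N)) X.

Lemma pull_snoc k (a : mindex N k) d :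
  idx_pull (block_ord (leqnSn k : (0 + k <= k.+1)%N)) (idx_snoc a d) = a.
Proof.
apply/ffunP => j; have h : (block_ord (leqnSn k : (0 + k <= k.+1)%N) j < k)%N by rewrite /= add0n; case: (j).
by rewrite ffunE (idx_snoc_lt a d h); congr (a _); apply: val_inj.
Qed.

Lemma agree_snoc k (a b : mindex N k) c d :
  agree_off (block_ord (leqnSn k : (0 + k <= k.+1)%N)) (idx_snoc a c) (idx_snoc b d) = (c == d).
Proof.
apply/agree_offP/eqP => [H|-> j hj].
  rewrite -(idx_snoc_last a c) -(idx_snoc_last b d); apply: H.
  by apply/negP => /codomP[] i /(congr1 val) /= ik; rewrite add0n in ik; have := ltn_ord i; rewrite -ik ltnn.
have [hjk|hjk] := ltnP j k.
  by case/negP: hj; apply/codomP; exists (Ordinal hjk); apply: val_inj.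
have -> : j = ord_max; last by rewrite !idx_snoc_last.
by apply: val_inj; apply/eqP; rewrite eqn_leq hjk -ltnS ltn_ord.
Qed.

Lemma upd_snoc k (a b : mindex N k) c :
  idx_upd (block_ord (leqnSn k : (0 + k <= k.+1)%N)) (idx_snoc a c) b = idx_snoc b c.
Proof. by rewrite -(pull_snoc b c) agree_updE ?agree_snoc ?pull_snoc //; apply: block_ord_inj. Qed.

Lemma block2_proof k : (k + 2 <= k.+2)%N. Proof. by rewrite addn2. Qed.

Lemma pull_snoc2 k (a : mindex N k) c d :
  idx_pull (block_ord (block2_proof k)) (idx_snoc (idx_snoc a c) d) = pair2 c d.
Proof.
rewrite [LHS]pair2E ![idx_pull _ _ _]ffunE.
have -> : block_ord (block2_proof k) ord0 = lift ord_max ord_max.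
  by apply: val_inj; rewrite /= /bump ltnn addn0.
have -> : block_ord (block2_proof k) ord_max = ord_max by apply: val_inj; rewrite /= addn1.
by rewrite idx_snoc_lift !idx_snoc_last.
Qed.

Lemma agree_snoc2 k (a b : mindex N k) c d c' d' :
  agree_off (block_ord (block2_proof k)) (idx_snoc (idx_snoc a c) d)
    (idx_snoc (idx_snoc b c') d') = (a == b).
Proof.
apply/agree_offP/eqP => [H|-> j hj].
  apply/ffunP => j; have := H (lift ord_max (lift ord_max j)); rewrite !idx_snoc_lift; apply.
  have v : lift ord_max (lift ord_max j) = j :> nat.
    by rewrite /= /bump (leqNgt k j) ltn_ord !add0n leqNgt ltnS (ltnW (ltn_ord j)).
  apply/negP => /codomP[] i /(congr1 val); rewrite [LHS]v /= => E.
  by have := ltn_ord j; rewrite E ltnNge leq_addr.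
have [hjk|hjk] := ltnP j k.
  have h1 : (j < k.+1)%N by apply: ltnW.
  by rewrite !(idx_snoc_lt _ _ h1) !idx_snoc_lt.
case/negP: hj; apply/codomP.
have hj2 : (j - k < 2)%N by rewrite ltn_subLR // addn2 ltn_ord.
by exists (Ordinal hj2); apply: val_inj; rewrite /= subnKC.
Qed.

Lemma upd_snoc2 k (a : mindex N k) c d c' d' :
  idx_upd (block_ord (block2_proof k)) (idx_snoc (idx_snoc a c) d) (pair2 c' d') =
  idx_snoc (idx_snoc a c') d'.
Proof.
by rewrite -(pull_snoc2 a c' d') agree_updE ?agree_snoc2 //; apply: block_ord_inj.
Qed.

End LastLeg.

Section CTrace.
Variables (F : fieldType) (N : nat) (q : F) (R Psi : tensOp F N 2).
Hypothesis q0 : q != 0.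
Hypothesis hR : hecke_symmetry q R.
Hypothesis hPsi : skew_inverse R Psi.
Variables (A : pzRingType) (sc : {rmorphism F -> A}).
Hypothesis sc_central : forall c x, sc c * x = x * sc c.

Local Notation C := (Cmat Psi).

(** The R-trace over the last factor. Operators on the first k factors can be taken out of it on
    either side, so products are computed by peeling off such operators. *)
Definition ptC k (Z : tensOp A N k.+1) : tensOp A N k :=
  mkop (fun a b => \sum_c \sum_d sc (C c d) * opE Z (idx_snoc a d) (idx_snoc b c)).

Lemma ptCD k (X Y : tensOp A N k.+1) : ptC (X + Y) = ptC X + ptC Y.
Proof.
apply: opEP => a b; rewrite opE_add !opE_mkop -big_split; apply: eq_bigr => c _.
by rewrite -big_split; apply: eq_bigr => d _; rewrite opE_add mulrDr.
Qed.

Lemma ptCN k (X : tensOp A N k.+1) : ptC (- X) = - ptC X.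
Proof.
apply: opEP => a b; rewrite opE_opp !opE_mkop -sumrN; apply: eq_bigr => c _.
by rewrite -sumrN; apply: eq_bigr => d _; rewrite opE_opp mulrN.
Qed.

Lemma ptCB k (X Y : tensOp A N k.+1) : ptC (X - Y) = ptC X - ptC Y.
Proof. by rewrite ptCD ptCN. Qed.

Lemma ptC_mull k (X : tensOp A N k) (Z : tensOp A N k.+1) :
  ptC (widen_op X * Z) = X * ptC Z.
Proof.
apply: opEP => a b; rewrite -[in RHS]mulmxE opE_mul opE_mkop.
under [RHS]eq_bigr => e _ do rewrite opE_mkop mulr_sumr.
rewrite [RHS]exchange_big /=; apply: eq_bigr => c _.
under [RHS]eq_bigr => e _ do rewrite mulr_sumr.
rewrite [RHS]exchange_big /=; apply: eq_bigr => d _.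
rewrite -mulmxE opE_emb_mull; last exact: block_ord_inj.
rewrite mulr_sumr; apply: eq_bigr => e _.
by rewrite pull_snoc upd_snoc !mulrA sc_central.
Qed.

Lemma ptC_mulr k (X : tensOp A N k) (Z : tensOp A N k.+1) :
  ptC (Z * widen_op X) = ptC Z * X.
Proof.
apply: opEP => a b; rewrite -[in RHS]mulmxE opE_mul opE_mkop.
under [RHS]eq_bigr => e _ do rewrite opE_mkop mulr_suml.
rewrite [RHS]exchange_big /=; apply: eq_bigr => c _.
under [RHS]eq_bigr => e _ do rewrite mulr_suml.
rewrite [RHS]exchange_big /=; apply: eq_bigr => d _.
rewrite -mulmxE opE_emb_mulr; last exact: block_ord_inj.
rewrite mulr_sumr; apply: eq_bigr => e _.
by rewrite pull_snoc upd_snoc !mulrA.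
Qed.

Lemma ptC_scalar k x : ptC (x%:M : tensOp A N k.+1) = (sc (\tr C) * x)%:M.
Proof.
apply: opEP => a b; rewrite opE_mkop opE_scalar /mxtrace rmorph_sum mulr_suml.
rewrite -sumrMnl; apply: eq_bigr => c _.
rewrite (bigD1 c) //= big1 ?addr0 => [|d dc]; last first.
  by rewrite opE_scalar idx_snoc_inj (negbTE dc) andbF mulr0.
by rewrite opE_scalar idx_snoc_inj eqxx andbT mulrnAr.
Qed.

Lemma ptC_1 k : ptC (1 : tensOp A N k.+1) = (sc (\tr C))%:M.
Proof. by rewrite -[1]/(1%:M) ptC_scalar mulr1. Qed.

Local Notation Rl k := (Rleg R sc k.+2 k).
Local Notation Ri k := (Rinv R sc k.+2 k).

(** On k+2 factors numbered from 0, [Rl k] acts in the last two, so this is [Rtrace_R] next to k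
    untouched factors. *)
Lemma ptC_Rleg k : ptC (Rl k) = 1.
Proof.
apply: opEP => a b; have [a' [x ->]] := idx_snocE a; have [b' [y ->]] := idx_snocE b.
rewrite opE_mkop -[1]/(1%:M) opE1 idx_snoc_inj.
rewrite /Rleg (leg_adjE (block2_proof k)).
under eq_bigr => c _ do under eq_bigr => d _ do
  rewrite opE_map opE_emb agree_snoc2 !pull_snoc2.
case: (a' == b') => /=; last by rewrite rmorph0 big1 // => c _; rewrite big1 // => d _; rewrite mulr0.
rewrite -(rmorph_nat sc) -(Rtrace_R hPsi) rmorph_sum; apply: eq_bigr => c _.
by rewrite rmorph_sum; apply: eq_bigr => d _; rewrite rmorphM.
Qed.

(** The R-trace over a new last factor undoes conjugation by the generator that joins it to its
    predecessor. The entries of X stand between those of R^-1 and R, but the latter are central;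
    collected, they form the contraction computed in [Rtrace_conj]. *)
Lemma ptC_conj k (X : tensOp A N k.+1) :
  ptC (Ri k * widen_op X * Rl k) = widen_op (ptC X).
Proof.
apply: opEP => a b; have [a' [x ->]] := idx_snocE a; have [b' [y ->]] := idx_snocE b.
rewrite opE_emb agree_snoc !pull_snoc !opE_mkop.
have E d c : opE (Ri k * widen_op X * Rl k) (idx_snoc (idx_snoc a' x) d) (idx_snoc (idx_snoc b' y) c) =
  \sum_p \sum_p' \sum_e sc (opE (invmx R) (pair2 x d) (pair2 p e) * opE R (pair2 p' e) (pair2 y c)) *
    opE X (idx_snoc a' p) (idx_snoc b' p').
  rewrite -mulrA -!mulmxE /Rinv /Rleg !(leg_adjE (block2_proof k)) -!emb_map.
  rewrite opE_emb_mull; last exact: block_ord_inj.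
  rewrite big_pair2 pull_snoc2; apply: eq_bigr => p _.
  rewrite [RHS]exchange_big; apply: eq_bigr => e _ /=.
  rewrite upd_snoc2 opE_emb_mulr; last exact: block_ord_inj.
  rewrite big_pair2 mulr_sumr pull_snoc2; apply: eq_bigr => p' _.
  rewrite (bigD1 e) //= big1 ?addr0 => [|e' e'e]; last first.
    by rewrite upd_snoc2 opE_emb agree_snoc eq_sym (negbTE e'e) mul0r.
  rewrite upd_snoc2 opE_emb agree_snoc eqxx !pull_snoc !opE_map rmorphM.
  by rewrite -!mulrA; congr (_ * _); rewrite sc_central.
under eq_bigr => c _ do under eq_bigr => d _ do rewrite E.
transitivity (\sum_p \sum_p' sc (\sum_c \sum_d \sum_e C c d *
   (opE (invmx R) (pair2 x d) (pair2 p e) * opE R (pair2 p' e) (pair2 y c))) *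
   opE X (idx_snoc a' p) (idx_snoc b' p')).
  transitivity (\sum_c \sum_d \sum_p \sum_p' sc (\sum_e C c d *
   (opE (invmx R) (pair2 x d) (pair2 p e) * opE R (pair2 p' e) (pair2 y c))) *
   opE X (idx_snoc a' p) (idx_snoc b' p')).
    do 2 (apply: eq_bigr => ? _); rewrite mulr_sumr; apply: eq_bigr => p _.
    rewrite mulr_sumr; apply: eq_bigr => p' _; rewrite -mulr_suml mulrA.
    by rewrite -mulr_sumr rmorphM rmorph_sum.
  rewrite pair_bigA /=; under eq_bigr => u _ do rewrite pair_bigA /=.
  rewrite exchange_big /=.
  rewrite [RHS]pair_bigA /=; apply: eq_bigr => v _ /=.
  by rewrite pair_bigA /= rmorph_sum mulr_suml.
under eq_bigr => p _ do under eq_bigr => p' _ do rewrite (Rtrace_conj q0 hR hPsi).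
case: (x == y) => /=; last by rewrite big1 // => p _; rewrite big1 // => p' _; rewrite mulr0 rmorph0 mul0r.
rewrite exchange_big /=; apply: eq_bigr => c _; apply: eq_bigr => d _.
by rewrite mulr1.
Qed.

Lemma widen_Rleg k i : (i.+1 < k)%N -> widen_op (Rleg R sc k i) = Rleg R sc k.+1 i.
Proof. by move=> h; rewrite /widen_op /Rleg emb_map leg_adj_block. Qed.

Lemma widen_Rinv k i : (i.+1 < k)%N -> widen_op (Rinv R sc k i) = Rinv R sc k.+1 i.
Proof. by move=> h; rewrite /widen_op /Rinv emb_map leg_adj_block. Qed.

Lemma widen_leg_at k (X : 'M[A]_N) : (0 < k)%N -> widen_op (leg_at k 0 X) = leg_at k.+1 0 X.
Proof. by move=> h; rewrite /widen_op leg_at_block. Qed.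

Lemma widenM (k : nat) (X Y : tensOp A N k) : widen_op (X * Y) = widen_op X * widen_op Y.
Proof. by rewrite -!mulmxE /widen_op embM //; apply: block_ord_inj. Qed.

Lemma widen_scalar k x : widen_op (x%:M : tensOp A N k) = x%:M.
Proof. by rewrite /widen_op emb_scalar //; apply: block_ord_inj. Qed.

Lemma widen1 k : widen_op (1 : tensOp A N k) = 1.
Proof. exact: widen_scalar. Qed.

End CTrace.

Section CTraceCopies.
Variables (F : fieldType) (N : nat) (q : F) (R Psi : tensOp F N 2).
Hypothesis q0 : q != 0.
Hypothesis hR : hecke_symmetry q R.
Hypothesis hPsi : skew_inverse R Psi.
Variables (A : pzRingType) (sc : {rmorphism F -> A}).
Hypothesis sc_central : forall c x, sc c * x = x * sc c.

Local Notation C := (Cmat Psi).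
Local Notation nu := (q - q^-1).
Local Notation r K := (Rleg R sc K).
Local Notation s K := (Rinv R sc K).

Lemma barcopyE k (X : 'M[A]_N) i : barcopy sc R k X i = upcopy (r k) (s k) (leg_at k 0 X) i.
Proof. by elim: i => //= i ->; rewrite (invmx_leg_adj q0 hR). Qed.

Lemma widen_upcopy k (X : 'M[A]_N) i : (i < k)%N ->
  widen_op (upcopy (r k) (s k) (leg_at k 0 X) i) = upcopy (r k.+1) (s k.+1) (leg_at k.+1 0 X) i.
Proof.
elim: i => [|i IH] hi /=; first by rewrite widen_leg_at.
by rewrite !widenM widen_Rleg // widen_Rinv // IH // ltnW.
Qed.

Lemma widen_upcopies k (X : 'M[A]_N) :
  widen_op (\prod_(i < k) upcopy (r k) (s k) (leg_at k 0 X) i) =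
  \prod_(i < k) upcopy (r k.+1) (s k.+1) (leg_at k.+1 0 X) i.
Proof.
rewrite (big_morph (@widen_op N A k) (@widenM N A k) (@widen1 N A k)).
by apply: eq_bigr => i _; rewrite widen_upcopy.
Qed.

Lemma widen_downcopy k (X : 'M[A]_N) i : (i < k)%N ->
  widen_op (downcopy (r k) (s k) (leg_at k 0 X) i) = downcopy (r k.+1) (s k.+1) (leg_at k.+1 0 X) i.
Proof.
elim: i => [|i IH] hi /=; first by rewrite widen_leg_at.
by rewrite !widenM widen_Rleg // widen_Rinv // IH // ltnW.
Qed.

Lemma widen_jminv k i : (i < k)%N -> widen_op (jminv (s k) i) = jminv (s k.+1) i.
Proof.
elim: i => [|i IH] hi /=; first by rewrite widen1.
by rewrite !widenM widen_Rinv // IH // ltnW.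
Qed.

(** An underlined copy arises by conjugations that [ptC_conj] undoes one by one, so its R-trace is
    that of the matrix itself. This is how Tr_R L is brought onto k+1 factors. *)
Lemma ptC_downcopy k (X : 'M[A]_N) :
  ptC Psi sc (downcopy (r k.+1) (s k.+1) (leg_at k.+1 0 X) k) = (trR sc Psi X)%:M.
Proof.
elim: k => [|k IH] /=; last first.
  by rewrite -widen_downcopy // (ptC_conj q0 hR hPsi sc_central) IH widen_scalar.
apply: opEP => a b; rewrite opE_mkop opE_scalar.
have -> : a == b by apply/eqP/ffunP => -[].
rewrite /trR /mxtrace mulr1n; apply: eq_bigr => c _; rewrite mxE; apply: eq_bigr => d _.
rewrite [map_mx _ _ _ _]mxE (@leg_atE _ _ 1 0 isT) opE_emb.
case: ifP => [_|/agree_offP[] j]; last by rewrite (ord1 j) => /negP[]; apply/codomP; exists ord0; apply: val_inj.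
rewrite opE_mkop ![idx_pull _ _ _]ffunE.
have E (h : (0 + 1 <= 1)%N) : block_ord h ord0 = ord_max by apply: val_inj.
by rewrite !E !idx_snoc_last.
Qed.

Lemma ptC_Rinv k : ptC Psi sc (s k.+2 k) = (sc (1 - nu * \tr C))%:M.
Proof.
rewrite (RinvE q0 hR) // ptCB (ptC_Rleg hPsi) ptC_scalar -[1]/(1%:M) -raddfB /= -rmorphM.
by rewrite [sc (1 - _)]rmorphB rmorph1 [nu * _]mulrC.
Qed.

Lemma sc_scalar_central k c (X : tensOp A N k) : X * (sc c)%:M = (sc c)%:M * X.
Proof.
rewrite -!mulmxE; apply/matrixP => i j; rewrite mul_scalar_mx mxE (bigD1 j) //= big1 ?addr0.
  by rewrite !mxE eqxx mulr1n sc_central.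
by move=> l lj; rewrite mxE (negbTE lj) mulr0.
Qed.

Lemma widen_opD k (X Y : tensOp A N k) : widen_op (X + Y) = widen_op X + widen_op Y.
Proof. exact: embD. Qed.

Lemma widen_opB k (X Y : tensOp A N k) : widen_op (X - Y) = widen_op X - widen_op Y.
Proof. exact: embB. Qed.

Lemma widen_op0 k : widen_op (0 : tensOp A N k) = 0.
Proof. exact: emb0. Qed.

Lemma ptC_jminv k : ptC Psi sc (jminv (s k.+1) k) =
  (sc (\tr C))%:M - (sc (nu * (1 - nu * \tr C)))%:M * \sum_(i < k) jminv (s k) i.
Proof.
elim: k => [|k IH] /=; first by rewrite big_ord0 mulr0 subr0 ptC_1.
rewrite big_ord_recr /= -(@widen_jminv k.+1 k) //; set Y := jminv _ k.
(* Replace the right factor R^-1 by R - nu. The first term is a conjugation, which the R-trace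
   undoes; in the second, the remaining R^-1 has R-trace 1 - nu Tr C. Each step thus adds one
   inverse Jucys-Murphy element to the sum. *)
have -> : s k.+2 k * widen_op Y * s k.+2 k =
    s k.+2 k * widen_op Y * r k.+2 k - widen_op (sc nu)%:M * s k.+2 k * widen_op Y.
  rewrite [X in _ * X = _](RinvE q0 hR) // mulrBr widen_scalar; congr (_ - _).
  by rewrite sc_scalar_central mulrA.
rewrite ptCB (ptC_conj q0 hR hPsi sc_central) IH ptC_mulr ptC_mull // ptC_Rinv.
rewrite widen_opB widen_scalar widenM widen_scalar.
rewrite (big_morph (@widen_op N A k) (@widen_opD k) (widen_op0 k)).
under eq_bigr => i _ do rewrite widen_jminv //.
by rewrite -mulmxE -scalar_mxM mulmxE -rmorphM -addrA -opprD -mulrDr.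
Qed.

End CTraceCopies.

Section LegRelations.
Variables (F : fieldType) (N : nat) (q : F) (R : tensOp F N 2).
Hypothesis q0 : q != 0.
Hypothesis hR : hecke_symmetry q R.
Variables (A : pzRingType) (sc : {rmorphism F -> A}).
Hypothesis sc_central : forall c x, sc c * x = x * sc c.
Implicit Types X Y : 'M[A]_N.

Local Notation r K := (Rleg R sc K).
Local Notation s K := (Rinv R sc K).

Lemma perm_legs K X Y : (1 < K)%N -> perm_defect sc R X Y = 0 ->
  r K 0 * leg_at K 0 X * r K 0 * leg_at K 0 Y =
  leg_at K 0 Y * r K 0 * leg_at K 0 X * s K 0.
Proof.
move=> hK /subr0_eq /(congr1 (fun Z => emb (block_ord (hK : (0 + 2 <= K)%N)) Z)).
have inj := @block_ord_inj 2 K 0 hK.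
rewrite !(embM inj) !leg_at_block // !emb_map.
by rewrite -!(leg_adjE (hK : (0 + 2 <= K)%N)).
Qed.

Lemma downcopy_upcopies_legs k X Y : perm_defect sc R X Y = 0 ->
  downcopy (r k.+1) (s k.+1) (leg_at k.+1 0 X) k *
    \prod_(i < k) upcopy (r k.+1) (s k.+1) (leg_at k.+1 0 Y) i =
  jminv (s k.+1) k * (\prod_(i < k) upcopy (r k.+1) (s k.+1) (leg_at k.+1 0 Y) i) *
    upcopy (r k.+1) (s k.+1) (leg_at k.+1 0 X) k.
Proof.
move=> h; apply: (@downcopy_upcopies _ _ _ _ _ k) => //.
- exact: (RlegK q0 hR).
- exact: (RinvK q0 hR).
- by move=> i hi; apply: (Rleg_braid hR).
- by move=> i j hij hj; apply: Rleg_far.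
- by move=> j /andP[j0 hj]; apply: Rleg_at_commute.
- by move=> j /andP[j0 hj]; apply: Rleg_at_commute.
- by move=> k0; apply: perm_legs.
Qed.

End LegRelations.

(** [freeEval] and [plift] are morphisms only under hypotheses on the target, so they carry no
    global instance; a bundled morphism with the same values is produced wherever one is needed. *)
Lemma rmorphism_of (S T : pzRingType) (g : S -> T) :
  {morph g : x y / x - y} -> g 1 = 1 -> {morph g : x y / x * y} ->
  {G : {rmorphism S -> T} | G =1 g}.
Proof.
move=> gB g1 gM.
pose gA := GRing.isZmodMorphism.Build _ _ g gB.
pose gR := GRing.isMonoidMorphism.Build _ _ g (g1, gM).
pose G : {rmorphism S -> T} := HB.pack g gA gR.
by exists G.
Qed.

(** * Presented algebras *)

Section FreeEval.
Variables (F : fieldType) (I : choiceType).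
Local Notation FA := (freeAlg F I).

Lemma freeMon (m : {fmonom I}) :
  mkmalgU m (1 : F) = \prod_(i <- (m : seq I)) freeGen F i.
Proof.
case: m => s; elim: s => [|i s IH] /=.
  rewrite big_nil; congr (mkmalgU _ _); apply: val_inj; exact: (esym fm1).
rewrite big_cons -IH /freeGen malgM_def fgmulUU mulr1; congr (mkmalgU _ _).
by apply: val_inj; rewrite /= fmM fmU.
Qed.

(** Words grow by left multiplication with generators, the direction in which the action on words is
    recursive. *)
Lemma free_ind (P : FA -> Prop) :
  P 1 -> (forall x y, P x -> P y -> P (x + y)) -> (forall c x, P x -> P (c *: x)) ->
  (forall i x, P x -> P (freeGen F i * x)) -> forall x, P x.
Proof.
move=> P1 PD PZ Pg x; rewrite (monalgE x).
apply: (big_ind P) => //; first by rewrite -(scale0r (1 : FA)); apply: PZ.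
move=> m _; have -> : mkmalgU m (mcoeff m x) = mcoeff m x *: mkmalgU m 1.
  by rewrite -mul_malgC malgM_def fgmulUU mulr1 mul1m.
apply: PZ; rewrite freeMon; elim: (fmonom_val m) => [|i s IH]; first by rewrite big_nil.
by rewrite big_cons; apply: Pg.
Qed.

Lemma free_scaleE c (x : FA) : c%:A * x = c *: x.
Proof. by rewrite -scalerAl mul1r. Qed.

Lemma free_scale_central c (x : FA) : c%:A * x = x * c%:A.
Proof.
rewrite free_scaleE -[c%:A]mul_malgC mulr1 malgM_def malgZ_def fgmulgU.
by apply: eq_bigr => m _; rewrite mulm1 mulrC.
Qed.

Lemma free_scalerAr c (x y : FA) : x * (c *: y) = c *: (x * y).
Proof. by rewrite -[c *: y]free_scaleE mulrA -free_scale_central free_scaleE scalerAl. Qed.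

Variables (A : pzRingType) (sc : {rmorphism F -> A}) (f : I -> A).
Hypothesis sc_central : forall c x, sc c * x = x * sc c.
Local Notation ev := (freeEval sc f).
Local Notation word m := (\prod_(i <- (fmonom_val m)) f i).

Lemma freeEvalEw (d : {fset {fmonom I}}) (g : FA) : (msupp g `<=` d)%fset ->
  ev g = \sum_(m <- d) sc (mcoeff m g) * word m.
Proof.
move=> le; rewrite /freeEval (big_fset_incl _ le) // => m _ /mcoeff_outdom ->.
by rewrite rmorph0 mul0r.
Qed.

Lemma freeEvalD (x y : FA) : ev (x + y) = ev x + ev y.
Proof.
pose d := (msupp x `|` msupp y)%fset.
rewrite !(@freeEvalEw d) ?fsubsetUl ?fsubsetUr ?msuppD_le //.
by rewrite -big_split; apply: eq_bigr => m _; rewrite mcoeffD rmorphD mulrDl.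
Qed.

Lemma freeEval0 : ev 0 = 0.
Proof. by rewrite /freeEval msupp0 big_seq_fset0. Qed.

Lemma freeEvalU c m : ev (mkmalgU m c) = sc c * word m.
Proof. by rewrite (freeEvalEw (msuppU_le)) big_seq_fset1 mcoeffUU. Qed.

Lemma freeEval_sum (J : Type) (s : seq J) (g : J -> FA) :
  ev (\sum_(j <- s) g j) = \sum_(j <- s) ev (g j).
Proof. exact: (big_morph _ freeEvalD freeEval0). Qed.

Lemma freeEvalM (x y : FA) : ev (x * y) = ev x * ev y.
Proof.
etransitivity; first by rewrite malgME; exact: freeEval_sum.
rewrite /freeEval mulr_suml; apply: eq_bigr => m _.
etransitivity; first exact: freeEval_sum.
rewrite mulr_sumr; apply: eq_bigr => m' _.
rewrite freeEvalU rmorphM fmM big_cat /= -!mulrA; congr (_ * _).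
by rewrite !mulrA sc_central.
Qed.

Lemma freeEval1 : ev 1 = 1.
Proof. by rewrite freeEvalU rmorph1 mul1r fm1 big_nil. Qed.

Lemma freeEval_gen i : ev (freeGen F i) = f i.
Proof. by rewrite freeEvalU rmorph1 mul1r fmU big_seq1. Qed.

Lemma freeEvalZ c x : ev (c *: x) = sc c * ev x.
Proof.
rewrite (freeEvalEw (msuppZ_le c x)) /freeEval mulr_sumr; apply: eq_bigr => m _.
by rewrite mcoeffZ rmorphM mulrA.
Qed.

Lemma freeEval_rmorphism : {g : {rmorphism FA -> A} | g =1 ev}.
Proof.
apply: rmorphism_of; [|exact: freeEval1|exact: freeEvalM].
move=> x y /=; apply/(addIr (ev y)); rewrite subrK -freeEvalD subrK //.
Qed.

End FreeEval.

Section PresentedLift.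
Variables (F : fieldType) (I : choiceType) (rels : set (freeAlg F I)).
Local Notation PA := (palg rels).
Local Notation ppi := (@ppi F I rels).

Lemma ppi_is_zmod_morphism : {morph ppi : x y / x - y}.
Proof. by move=> x y; apply/(addIr (ppi y)); rewrite subrK -ppiD subrK. Qed.

HB.instance Definition _ := GRing.isZmodMorphism.Build _ _ ppi ppi_is_zmod_morphism.
HB.instance Definition _ := GRing.isMonoidMorphism.Build _ _ ppi
  (erefl, fun x y => esym (ppiM _ x y)).

Lemma ppiZE c x : ppi (c *: x) = c *: ppi x.
Proof. by rewrite -ppiZ. Qed.

Lemma pcstE c (x : PA) : pcst rels c * x = c *: x.
Proof.
rewrite /pcst -[x]preprK -[pone rels]/(ppi 1) -!ppiZE -rmorphM /=.
by rewrite -scalerAl mul1r.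
Qed.

Lemma pcst_central c (x : PA) : pcst rels c * x = x * pcst rels c.
Proof.
rewrite pcstE /pcst -[x]preprK -[pone rels]/(ppi 1) -!ppiZE -rmorphM /=.
by rewrite free_scalerAr mulr1.
Qed.

Lemma pcst_is_zmod_morphism : {morph pcst rels : x y / x - y}.
Proof. by move=> x y; rewrite /pcst scalerBl. Qed.

Lemma pcst1 : pcst rels 1 = 1.
Proof. by rewrite /pcst scale1r. Qed.

Lemma pcstM : {morph pcst rels : x y / x * y}.
Proof. by move=> x y; rewrite pcstE /pcst scalerA. Qed.

HB.instance Definition _ := GRing.isZmodMorphism.Build _ _ (pcst rels) pcst_is_zmod_morphism.
HB.instance Definition _ := GRing.isMonoidMorphism.Build _ _ (pcst rels) (pcst1, pcstM).

Lemma palg_ind (P : PA -> Prop) :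
  P 1 -> (forall x y, P x -> P y -> P (x + y)) -> (forall c x, P x -> P (c *: x)) ->
  (forall i x, P x -> P (pgen rels i * x)) -> forall x, P x.
Proof.
move=> P1 PD PZ Pg x; rewrite -[x]preprK; move: (prepr x).
apply: free_ind => //= [y z hy hz|c y hy|i y hy].
- by rewrite rmorphD; apply: PD.
- by rewrite ppiZE; apply: PZ.
- by rewrite rmorphM; apply: Pg.
Qed.

Variables (A : pzRingType) (sc : {rmorphism F -> A}) (f : I -> A).
Hypothesis sc_central : forall c x, sc c * x = x * sc c.
Hypothesis hrels : forall x, rels x -> freeEval sc f x = 0.

(** [plift] evaluates a chosen representative. Two representatives differ by an element of the
    ideal, each term of which contains a factor that evaluates to 0. *)
Lemma plift_ppi x : plift rels sc f (ppi x) = freeEval sc f x.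
Proof.
have [g gE] := freeEval_rmorphism f sc_central.
have [s [hs E]] := @prepr_ppi _ _ rels x.
apply/eqP; rewrite /plift -!gE -subr_eq0 -rmorphB E rmorph_sum big_seq big1 //= => t ht.
by rewrite !rmorphM /= [g t.1.2]gE hrels ?mulr0 ?mul0r //; apply: hs.
Qed.

Lemma plift_gen i : plift rels sc f (pgen rels i) = f i.
Proof. by rewrite plift_ppi freeEval_gen. Qed.

Lemma pliftZ c x : plift rels sc f (c *: x) = sc c * plift rels sc f x.
Proof. by rewrite -[x]preprK -ppiZE !plift_ppi freeEvalZ. Qed.

Lemma plift_rmorphism : {g : {rmorphism PA -> A} | g =1 plift rels sc f}.
Proof.
have [g gE] := freeEval_rmorphism f sc_central.
apply: rmorphism_of => [x y||x y].
- by rewrite -[x]preprK -[y]preprK -rmorphB !plift_ppi -!gE rmorphB.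
- by rewrite -[1]/(ppi 1) plift_ppi freeEval1.
- by rewrite -[x]preprK -[y]preprK -rmorphM !plift_ppi -!gE rmorphM.
Qed.

End PresentedLift.

Section DefectMap.
Variables (F : fieldType) (N : nat) (R : tensOp F N 2).
Variables (A B : pzRingType) (sc : F -> A) (sc' : F -> B) (f : {rmorphism A -> B}).
Hypothesis scE : f \o sc =1 sc'.

Lemma map_sc m n (X : 'M[F]_(m, n)) : map_mx f (map_mx sc X) = map_mx sc' X.
Proof. by apply/matrixP => i j; rewrite !mxE -scE. Qed.

Lemma RE_defect_map X :
  map_mx f (RE_defect sc R X) = RE_defect sc' R (map_mx f X).
Proof. by rewrite /RE_defect map_mxB !map_mxM map_sc leg_at_map. Qed.

Lemma perm_defect_map X Y :
  map_mx f (perm_defect sc R X Y) = perm_defect sc' R (map_mx f X) (map_mx f Y).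
Proof. by rewrite /perm_defect map_mxB !map_mxM !map_sc !leg_at_map. Qed.

End DefectMap.

(** * The quantum double acts on M(R) *)

Section Braids.
Variables (B : pzRingType) (a b a' b' : B).
Hypotheses (aK : a * a' = 1) (a'K : a' * a = 1) (bK : b * b' = 1) (b'K : b' * b = 1).
Hypothesis braid : a * b * a = b * a * b.

Lemma braid_slide : b * a' * b' = a' * b' * a.
Proof.
transitivity (a' * b' * (b * a * b) * a' * b').
  by rewrite !mulrA -[_ * b' * b]mulrA b'K mulr1 a'K mul1r.
by rewrite -braid !mulrA -[_ * a * a']mulrA aK mulr1 -mulrA bK mulr1.
Qed.

Lemma braid_slide' : a * b' * a' = b' * a' * b.
Proof.
transitivity (b' * a' * (a * b * a) * b' * a').
  by rewrite !mulrA -[_ * a' * a]mulrA a'K mulr1 b'K mul1r.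
by rewrite braid !mulrA -[_ * b * b']mulrA bK mulr1 -mulrA aK mulr1.
Qed.

Variables L M : B.
Hypotheses (bL : L * b = b * L) (bM : M * b = b * M).
Let Q := L * a * L.

Lemma b'comm X : X * b = b * X -> X * b' = b' * X.
Proof. by move=> h; rewrite -[LHS]mul1r -b'K -mulrA [b * (X * _)]mulrA -h -!mulrA bK mulr1. Qed.

(* With a = R_12, b = R_23: the relation matrix of M passes through L. *)
Lemma RE_pass_right (E := a * M * a * M - M * a * M * a) :
  b' * a' * L * a * b * (M * (a * M * a')) =
    b' * a' * a' * b' * (M * (a * M * a')) * (b * a * L * a' * b') ->
  L * a * b * E = a * b * (b' * a' * a' * b') * E * (a' * (b * a * L * a' * b') * a).
Proof.
set U := b' * a' * L * a * b; set MM := M * (a * M * a'); set J := b' * a' * a' * b'.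
set V := b * a * L * a' * b' => h.
have Ua : U * a = a * U.
  transitivity (b' * a' * L * (a * b * a)); first by rewrite /U !mulrA.
  rewrite braid; transitivity (b' * a' * (L * b) * a * b); first by rewrite !mulrA.
  rewrite bL; transitivity (b' * a' * b * L * a * b); first by rewrite !mulrA.
  by rewrite -braid_slide' /U !mulrA.
have Va : V * a = a * V.
  transitivity (b * a * L * (a' * b' * a)); first by rewrite /V !mulrA.
  rewrite -braid_slide; transitivity (b * a * (L * b) * a' * b'); first by rewrite !mulrA.
  rewrite bL; transitivity (b * a * b * L * a' * b'); first by rewrite !mulrA.
  by rewrite -braid /V !mulrA.
have Ja : a * J = J * a.
  transitivity (a * b' * a' * a' * b'); first by rewrite /J !mulrA.
  rewrite braid_slide'; transitivity (b' * a' * (b * a' * b')); first by rewrite !mulrA.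
  by rewrite braid_slide /J !mulrA.
(* Up to the right factor a, the relation matrix is the commutator of a with MM, the product of two
   copies of M. As U, J and V commute with a, the hypothesis U MM = J MM V passes to this
   commutator. *)
have EE : E = (a * MM - MM * a) * a.
  rewrite /E /MM mulrBl !mulrA -[_ * a' * a]mulrA a'K mulr1; congr (_ - _).
  by rewrite -[_ * a' * a]mulrA a'K mulr1.
have -> : L * a * b = a * b * U.
  by rewrite /U !mulrA -[_ * b * b']mulrA bK mulr1 aK mul1r.
have -> : a * b * J * E * (a' * V * a) = a * b * (J * (a * MM - MM * a) * V * a).
  by rewrite EE !mulrA -[_ * a * a']mulrA aK mulr1.
have UJ : U * (a * MM - MM * a) = J * (a * MM - MM * a) * V.
  clear EE; clearbody U V J MM; rewrite !mulrBr !mulrBl; congr (_ - _).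
    by rewrite mulrA Ua -mulrA h !mulrA Ja.
  by rewrite mulrA h -!mulrA Va.
transitivity (a * b * (U * (a * MM - MM * a)) * a); first by rewrite EE; clearbody U MM; rewrite !mulrA.
by rewrite UJ; clearbody V J MM; rewrite !mulrA.
Qed.

(* With a = R_12, b = R_23: the relation matrix of L passes through M. *)
Lemma RE_pass_left (E := a * Q - Q * a) :
  a * L * a * M = M * a * L * a' ->
  E * (b * a * M) = b' * a' * M * a * b * E * (b' * a').
Proof.
move=> h.
have b'L := b'comm bL; have b'M := b'comm bM.
(* Q passes through b a M on its own. A factor a on either side of Q is then carried across by the
   braid relation, so that a Q - Q a passes as well. *)
have key : Q * (b * a * M) = b' * a' * M * a * b * Q * (b' * a').
  have LaM : L * a * M = a' * M * a * L * a'.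
    by rewrite -[LHS]mul1r -a'K -!mulrA [a * (L * _)]mulrA -!mulrA; congr (_ * _); rewrite !mulrA h.
  transitivity (L * a * (L * b) * a * M); first by rewrite /Q !mulrA.
  rewrite bL; transitivity (L * a * b * (L * a * M)); first by rewrite !mulrA.
  rewrite LaM; transitivity (L * (a * b * a') * M * a * L * a'); first by rewrite !mulrA.
  have -> : a * b * a' = b' * a * b.
    transitivity (b' * (b * a * b) * a'); first by rewrite !mulrA b'K mul1r.
    by rewrite -braid !mulrA -[_ * a * a']mulrA aK mulr1.
  transitivity ((L * b') * a * (b * M) * a * L * a'); first by rewrite !mulrA.
  rewrite b'L -bM; transitivity (b' * (L * a * M) * b * a * L * a'); first by rewrite !mulrA.
  rewrite LaM; transitivity (b' * a' * M * a * L * (a' * b * a) * L * a'); first by rewrite !mulrA.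
  have -> : a' * b * a = b * a * b'.
    transitivity (a' * (b * a * b) * b'); first by rewrite !mulrA -[_ * b * b']mulrA bK mulr1.
    by rewrite -braid !mulrA a'K mul1r.
  transitivity (b' * a' * M * a * (L * b) * a * (b' * L) * a'); first by rewrite !mulrA.
  by rewrite bL -b'L /Q !mulrA.
have E1 : a * b' * a' = b' * a' * b := braid_slide'.
rewrite /E mulrBl -mulrA key.
have -> : Q * a * (b * a * M) = Q * (b * a * M) * b.
  transitivity (Q * (a * b * a) * M); first by rewrite !mulrA.
  rewrite braid; transitivity (Q * b * a * (b * M)); first by rewrite !mulrA.
  by rewrite -bM !mulrA.
rewrite key mulrBr mulrBl; congr (_ - _); last first.
  transitivity (b' * a' * M * a * b * Q * (b' * a' * b)); first by rewrite !mulrA.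
  by rewrite -E1 !mulrA.
transitivity ((a * b' * a') * M * a * b * Q * b' * a'); first by rewrite !mulrA.
rewrite E1; transitivity (b' * a' * (b * M) * a * b * Q * b' * a'); first by rewrite !mulrA.
rewrite -bM; transitivity (b' * a' * M * (b * a * b) * Q * b' * a'); first by rewrite !mulrA.
by rewrite -braid !mulrA.
Qed.

End Braids.

Lemma exchange_2_2 (V : nmodType) (I J : finType) (f : I -> I -> J -> J -> V) :
  \sum_i \sum_j \sum_x \sum_y f i j x y = \sum_x \sum_y \sum_i \sum_j f i j x y.
Proof.
rewrite pair_bigA /=; under eq_bigr => p _ do rewrite pair_bigA /=.
rewrite exchange_big /= [RHS]pair_bigA /=; apply: eq_bigr => p _.
by rewrite [in RHS]pair_bigA.
Qed.

(** * Removing R from a contraction *)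

Section Strip.
Variables (F : fieldType) (N : nat) (q : F) (R Psi : tensOp F N 2).
Hypothesis q0 : q != 0.
Hypothesis hR : hecke_symmetry q R.
Hypothesis hPsi : skew_inverse R Psi.
Variables (A : pzRingType) (sc : {rmorphism F -> A}).
Hypothesis sc_central : forall c x, sc c * x = x * sc c.

Local Notation r a b c d := (opE R (pair2 a b) (pair2 c d)).
Local Notation ri a b c d := (opE (invmx R) (pair2 a b) (pair2 c d)).
Local Notation psi a b c d := (opE Psi (pair2 a b) (pair2 c d)).
Local Notation Rm := (map_mx sc R).
Local Notation Rim := (map_mx sc (invmx R)).

Definition sc_closed (S : A -> Prop) :=
  [/\ S 0, forall x y, S x -> S y -> S (x + y) & forall c x, S x -> S (sc c * x)].

Lemma sc_closed_sum S (I : Type) (s : seq I) (P : pred I) f : sc_closed S ->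
  (forall i, P i -> S (f i)) -> S (\sum_(i <- s | P i) f i).
Proof. by case=> S0 SD _ h; apply: (big_ind S). Qed.

(** By [skewR], Psi recovers each single value of f as a scalar combination of the contractions of f
    with R. *)
Lemma skew_strip S (f : 'I_N -> 'I_N -> A) : sc_closed S ->
  (forall b d, S (\sum_x \sum_y sc (r x b y d) * f x y)) -> forall x y, S (f x y).
Proof.
move=> cS h v u; have [_ _ SZ] := cS.
suff -> : f v u = \sum_b \sum_d sc (psi d u b v) * \sum_x \sum_y sc (r x b y d) * f x y.
  by apply: sc_closed_sum => // b _; apply: sc_closed_sum => // d _; apply: SZ.
transitivity (\sum_x \sum_y sc (\sum_b \sum_d r x b y d * psi d u b v) * f x y).
  under eq_bigr => x _ do under eq_bigr => y _ do rewrite (skewR hPsi).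
  rewrite (bigD1 v) //= [X in _ + X]big1 ?addr0; last first.
    by move=> x /negbTE xv; rewrite big1 // => y _; rewrite xv mul0r rmorph0 mul0r.
  rewrite (bigD1 u) //= [X in _ + X]big1 ?addr0 ?eqxx ?mulr1 ?rmorph1 ?mul1r //.
  by move=> y /negbTE yu; rewrite eq_sym yu mulr0 rmorph0 mul0r.
transitivity (\sum_x \sum_y \sum_b \sum_d sc (psi d u b v) * (sc (r x b y d) * f x y)).
  do 2 (apply: eq_bigr => ? _); rewrite rmorph_sum mulr_suml; apply: eq_bigr => b _.
  by rewrite rmorph_sum mulr_suml; apply: eq_bigr => d _; rewrite mulrA -rmorphM mulrC.
rewrite exchange_2_2; do 2 (apply: eq_bigr => ? _); rewrite mulr_sumr.
by apply: eq_bigr => ? _; rewrite mulr_sumr.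
Qed.

Variables L M : 'M[A]_N.
Let L1 := leg_at 2 0 L.
Let M1 := leg_at 2 0 M.
Let W := Rim *m M1 *m Rm *m L1 *m Rim.

Lemma opE_LRM a b c d : opE (L1 *m Rm *m M1) (pair2 a b) (pair2 c d) =
  \sum_x \sum_y sc (r x b y d) * (L a x * M y c).
Proof.
rewrite opE_leg2_mulr exchange_big /=; apply: eq_bigr => y _.
rewrite opE_leg2_mull mulr_suml; apply: eq_bigr => x _.
by rewrite opE_map -sc_central -!mulrA.
Qed.

(** The permutation relation reads L_1 R M_1 = R^-1 M_1 R L_1 R^-1. The premise is this equation
    solved by Psi for the single products of an entry of L with an entry of M, and [skewL] leads
    back. *)
Lemma perm_of_skew :
  (forall a v u c, L a v * M u c =
     \sum_b \sum_d sc (psi d u b v) * opE W (pair2 a b) (pair2 c d)) ->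
  perm_defect sc R L M = 0.
Proof.
move=> h; suff E : L1 *m Rm *m M1 = W.
  apply/eqP; rewrite subr_eq0; apply/eqP.
  transitivity (Rm *m (L1 *m Rm *m M1)); first by rewrite !mulmxA.
  by rewrite E /W !mulmxA -map_mxM (hecke_invR q0 hR) map_mx1 mul1mx.
apply: opEP => i j; rewrite (pair2E i) (pair2E j); move: (i ord0) (i ord_max) (j ord0) (j ord_max) => a b c d.
rewrite opE_LRM.
transitivity (\sum_b' \sum_d' sc (\sum_x \sum_y psi d' y b' x * r x b y d) * opE W (pair2 a b') (pair2 c d')).
  transitivity (\sum_x \sum_y \sum_b' \sum_d' sc (psi d' y b' x * r x b y d) * opE W (pair2 a b') (pair2 c d')).
    do 2 (apply: eq_bigr => ? _); rewrite h mulr_sumr; apply: eq_bigr => b' _.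
    by rewrite mulr_sumr; apply: eq_bigr => d' _; rewrite mulrA -rmorphM mulrC.
  rewrite exchange_2_2; do 2 (apply: eq_bigr => ? _); rewrite rmorph_sum mulr_suml.
  by apply: eq_bigr => ? _; rewrite rmorph_sum mulr_suml.
under eq_bigr => b' _ do under eq_bigr => d' _ do rewrite exchange_big (skewL hPsi).
rewrite (bigD1 b) //= [X in _ + X]big1 ?addr0; last first.
  by move=> b' /negbTE bb'; rewrite big1 // => d' _; rewrite [b == _]eq_sym bb' mulr0 rmorph0 mul0r.
rewrite (bigD1 d) //= [X in _ + X]big1 ?addr0 ?eqxx ?mulr1 ?rmorph1 ?mul1r //.
by move=> d' /negbTE dd'; rewrite dd' mul0r rmorph0 mul0r.
Qed.

End Strip.
Arguments sc_closed_sum {F A sc S I s P f} _ _.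

(** * Rings of linear endomorphisms *)

Section LinearEndo.
Variables (F : fieldType) (V : lmodType F).

(** With composition as product, operators on the free algebra and on M(R) become entries of
    matrices, to which the identities over a ring with central scalars apply. *)
Record lend := Lend { lend_fun :> V -> V; lend_linear : linear lend_fun }.

Lemma lend_eq (f g : lend) : lend_fun f =1 lend_fun g -> f = g.
Proof.
case: f g => [f hf] [g hg] /= /funext E; case: _ / E hg => hg.
by congr Lend; apply: Prop_irrelevance.
Qed.

HB.instance Definition _ := gen_eqMixin lend.
HB.instance Definition _ := gen_choiceMixin lend.

Lemma lend0_linear : linear (fun _ : V => 0 : V).
Proof. by move=> c x y; rewrite scaler0 addr0. Qed.
Lemma lend1_linear : linear (@id V).
Proof. by []. Qed.
Lemma lendD_linear (f g : lend) : linear (fun x => f x + g x).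
Proof. by move=> c x y; rewrite !lend_linear scalerDr addrACA. Qed.
Lemma lendN_linear (f : lend) : linear (fun x => - f x).
Proof. by move=> c x y; rewrite lend_linear opprD scalerN. Qed.
Lemma lendM_linear (f g : lend) : linear (fun x => f (g x)).
Proof. by move=> c x y; rewrite !lend_linear. Qed.
Lemma lend_sc_linear (c : F) : linear (fun x : V => c *: x).
Proof. by move=> d x y; rewrite scalerDr !scalerA mulrC. Qed.

Definition lend0 := Lend lend0_linear.
Definition lend1 := Lend lend1_linear.
Definition lendD f g := Lend (lendD_linear f g).
Definition lendN f := Lend (lendN_linear f).
Definition lendM f g := Lend (lendM_linear f g).
Definition lend_sc c := Lend (lend_sc_linear c).

Lemma lendDA : associative lendD.
Proof. by move=> f g h; apply: lend_eq => x /=; rewrite addrA. Qed.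
Lemma lendDC : commutative lendD.
Proof. by move=> f g; apply: lend_eq => x /=; rewrite addrC. Qed.
Lemma lend0D : left_id lend0 lendD.
Proof. by move=> f; apply: lend_eq => x /=; rewrite add0r. Qed.
Lemma lendND : left_inverse lend0 lendN lendD.
Proof. by move=> f; apply: lend_eq => x /=; rewrite addNr. Qed.

HB.instance Definition _ := GRing.isZmodule.Build lend lendDA lendDC lend0D lendND.

Lemma lend_fun0 (f : lend) : f 0 = 0.
Proof. by have := lend_linear f (-1) 0 0; rewrite scaler0 addr0 scaleN1r addNr. Qed.
Lemma lend_funD (f : lend) x y : f (x + y) = f x + f y.
Proof. by have := lend_linear f 1 x y; rewrite !scale1r. Qed.
Lemma lend_funZ (f : lend) c x : f (c *: x) = c *: f x.
Proof. by have := lend_linear f c x 0; rewrite lend_fun0 !addr0. Qed.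

Lemma lendMA : associative lendM.
Proof. by move=> f g h; apply: lend_eq. Qed.
Lemma lend1M : left_id lend1 lendM.
Proof. by move=> f; apply: lend_eq. Qed.
Lemma lendM1 : right_id lend1 lendM.
Proof. by move=> f; apply: lend_eq. Qed.
Lemma lendMDl : left_distributive lendM lendD.
Proof. by move=> f g h; apply: lend_eq. Qed.
Lemma lendMDr : right_distributive lendM lendD.
Proof. by move=> f g h; apply: lend_eq => x /=; rewrite lend_funD. Qed.

HB.instance Definition _ :=
  GRing.Zmodule_isPzRing.Build lend lendMA lend1M lendM1 lendMDl lendMDr.

Lemma lendDE (f g : lend) x : (f + g) x = f x + g x. Proof. by []. Qed.
Lemma lendBE (f g : lend) x : (f - g) x = f x - g x. Proof. by []. Qed.
Lemma lend0E x : (0 : lend) x = 0. Proof. by []. Qed.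
Lemma lend1E x : (1 : lend) x = x. Proof. by []. Qed.
Lemma lendME (f g : lend) x : (f * g) x = f (g x). Proof. by []. Qed.
Lemma lend_sumE (I : Type) (s : seq I) (P : pred I) (f : I -> lend) x :
  (\sum_(i <- s | P i) f i) x = \sum_(i <- s | P i) f i x.
Proof. by elim/big_rec2: _ => [|i y1 y2 _ <-]. Qed.

Lemma lend_sc_zmod : {morph lend_sc : x y / x - y}.
Proof. by move=> c d; apply: lend_eq => x /=; rewrite scalerBl. Qed.
Lemma lend_sc1 : lend_sc 1 = 1.
Proof. by apply: lend_eq => x /=; rewrite scale1r. Qed.
Lemma lend_scM : {morph lend_sc : x y / x * y}.
Proof. by move=> c d; apply: lend_eq => x /=; rewrite scalerA. Qed.

HB.instance Definition _ := GRing.isZmodMorphism.Build _ _ lend_sc lend_sc_zmod.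
HB.instance Definition _ := GRing.isMonoidMorphism.Build _ _ lend_sc (lend_sc1, lend_scM).

Lemma lend_sc_central c (f : lend) : lend_sc c * f = f * lend_sc c.
Proof. by apply: lend_eq => x; rewrite !lendME /= lend_funZ. Qed.

End LinearEndo.

Arguments lend_sc {F} V c.

Section LeftMul.
Variables (F : fieldType) (I : choiceType) (rels : set (freeAlg F I)).
Local Notation FA := (freeAlg F I).
Local Notation PA := (palg rels).

Lemma free_lmul_linear (m : FA) : linear (fun x : FA => m * x).
Proof. by move=> c x y; rewrite mulrDr free_scalerAr. Qed.

Definition free_lmul (m : FA) : lend FA := Lend (free_lmul_linear m).

Lemma free_lmul_zmod : {morph free_lmul : x y / x - y}.
Proof. by move=> x y; apply: lend_eq => z /=; rewrite mulrBl. Qed.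
Lemma free_lmul1 : free_lmul 1 = 1.
Proof. by apply: lend_eq => z /=; rewrite mul1r. Qed.
Lemma free_lmulM : {morph free_lmul : x y / x * y}.
Proof. by move=> x y; apply: lend_eq => z /=; rewrite mulrA. Qed.
HB.instance Definition _ := GRing.isZmodMorphism.Build _ _ free_lmul free_lmul_zmod.
HB.instance Definition _ := GRing.isMonoidMorphism.Build _ _ free_lmul (free_lmul1, free_lmulM).

Lemma free_lmul_sc c : free_lmul c%:A = lend_sc FA c.
Proof. by apply: lend_eq => z /=; rewrite free_scaleE. Qed.

Lemma palg_scalerAl c (x y : PA) : c *: (x * y) = c *: x * y.
Proof. by rewrite -!pcstE mulrA. Qed.

Lemma palg_scalerAr c (x y : PA) : c *: (x * y) = x * (c *: y).
Proof. by rewrite -!pcstE mulrA pcst_central mulrA. Qed.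

Lemma palg_lmul_linear (m : PA) : linear (fun x : PA => m * x).
Proof. by move=> c x y; rewrite mulrDr palg_scalerAr. Qed.

Definition palg_lmul (m : PA) : lend PA := Lend (palg_lmul_linear m).

Lemma palg_lmul_zmod : {morph palg_lmul : x y / x - y}.
Proof. by move=> x y; apply: lend_eq => z /=; rewrite mulrBl. Qed.
Lemma palg_lmul1 : palg_lmul 1 = 1.
Proof. by apply: lend_eq => z /=; rewrite mul1r. Qed.
Lemma palg_lmulM : {morph palg_lmul : x y / x * y}.
Proof. by move=> x y; apply: lend_eq => z /=; rewrite mulrA. Qed.
HB.instance Definition _ := GRing.isZmodMorphism.Build _ _ palg_lmul palg_lmul_zmod.
HB.instance Definition _ := GRing.isMonoidMorphism.Build _ _ palg_lmul (palg_lmul1, palg_lmulM).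

Lemma palg_lmul_sc c : palg_lmul (pcst rels c) = lend_sc PA c.
Proof. by apply: lend_eq => z /=; rewrite pcstE. Qed.

End LeftMul.

(* Contraction against the identity matrix viewed as a vector of V (x) V^*. *)
Definition contract (A : pzRingType) N (Y : tensOp A N 2) (a : mindex N 2) : A :=
  \sum_b opE Y a b * (b ord0 == b ord_max)%:R.

Lemma contractM (A : pzRingType) N (X Y : tensOp A N 2) a :
  contract (X *m Y) a = \sum_e opE X a e * contract Y e.
Proof.
rewrite /contract; under eq_bigr => b _ do rewrite opE_mul mulr_suml.
rewrite exchange_big; apply: eq_bigr => e _.
by rewrite mulr_sumr; apply: eq_bigr => b _; rewrite mulrA.
Qed.

Lemma contractD (A : pzRingType) N (X Y : tensOp A N 2) a :
  contract (X + Y) a = contract X a + contract Y a.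
Proof.
by rewrite /contract -big_split; apply: eq_bigr => b _; rewrite opE_add mulrDl.
Qed.

Lemma contract_scalar (A : pzRingType) N c (X : tensOp A N 2) a :
  contract (c%:M *m X) a = c * contract X a.
Proof.
rewrite /contract mulr_sumr; apply: eq_bigr => b _.
by rewrite mul_scalar_mx [opE _ _ _]mxE mulrA.
Qed.

Lemma contract1 (A : pzRingType) N a :
  contract (1%:M : tensOp A N 2) a = (a ord0 == a ord_max)%:R.
Proof.
rewrite /contract; under eq_bigr => b _ do rewrite opE1 eq_sym.
exact: sum_deltal.
Qed.

(** * Action of L on the free algebra *)

Section FreeAction.
Variables (F : fieldType) (N : nat) (q : F) (R Psi : tensOp F N 2).
Hypothesis q0 : q != 0.
Hypothesis hR : hecke_symmetry q R.
Hypothesis hPsi : skew_inverse R Psi.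

Local Notation r a b c d := (opE R (pair2 a b) (pair2 c d)).
Local Notation ri a b c d := (opE (invmx R) (pair2 a b) (pair2 c d)).
Local Notation psi a b c d := (opE Psi (pair2 a b) (pair2 c d)).
Local Notation FM := (freeAlg F ('I_N * 'I_N)%type).
Local Notation scF := (GRing.in_alg FM).
Local Notation lsc := (lend_sc FM).

Definition gF : 'M[FM]_N := \matrix_(i, j) freeGen F (i, j).

(* l_{a v} m_{u c} = \sum_b Theta_(u, c) (a, v) b l_{b0 b1} *)
Definition Theta (k : 'I_N * 'I_N) : tensOp FM N 2 :=
  mkop (fun x y : mindex N 2 => \sum_b \sum_d \sum_b2
    (psi d k.1 b (x ord_max) * ri (y ord_max) b2 k.2 d) *:
    opE (map_mx scF (invmx R) *m leg_at 2 0 gF *m map_mx scF R)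
      (pair2 (x ord0) b) (pair2 (y ord0) b2)).

Definition scTheta : {rmorphism F -> tensOp FM N 2} := (@scalar_mx FM _) \o scF.

Lemma scTheta_central c X : scTheta c * X = X * scTheta c.
Proof.
rewrite /= -!mulmxE mul_scalar_mx; apply/matrixP => i j; rewrite !mxE.
rewrite (bigD1 j) //= big1 ?addr0 => [|l lj]; last by rewrite mxE (negbTE lj) mulr0.
by rewrite mxE eqxx mulr1n free_scale_central.
Qed.

(** The multiplicative extension of [Theta]: the row (a, v) of [ThetaE x] holds the coefficients
    that l_{a v} x acquires when the entry of L is moved to the right of x. *)
Definition ThetaE (x : FM) : tensOp FM N 2 := freeEval scTheta Theta x.

Lemma ThetaE1 : ThetaE 1 = 1%:M.
Proof. exact: freeEval1. Qed.

Lemma ThetaE_gen k x : ThetaE (freeGen F k * x) = Theta k *m ThetaE x.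
Proof.
rewrite /ThetaE (freeEvalM _ scTheta_central) mulmxE; congr (_ * _).
exact: freeEval_gen.
Qed.

Lemma ThetaED x y : ThetaE (x + y) = ThetaE x + ThetaE y.
Proof. exact: freeEvalD. Qed.

Lemma ThetaEZ c x : ThetaE (c *: x) = c%:A%:M *m ThetaE x.
Proof. by rewrite /ThetaE freeEvalZ mulmxE. Qed.

(** [contract] replaces each remaining entry of L by its counit, so this is (Id (x) counit) sigma on
    words. *)
Definition actF (a v : 'I_N) (x : FM) : FM := contract (ThetaE x) (pair2 a v).

Lemma actF_linear a v : linear (actF a v).
Proof.
move=> c x y; rewrite /actF ThetaED ThetaEZ contractD contract_scalar.
by rewrite free_scaleE.
Qed.

Definition LF : 'M[lend FM]_N := \matrix_(a, v) Lend (actF_linear a v).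
Definition MF : 'M[lend FM]_N := map_mx (@free_lmul F _) gF.

Lemma actF1 a v : actF a v 1 = (a == v)%:R.
Proof.
by rewrite /actF ThetaE1 contract1 pair2_0 pair2_1.
Qed.

Lemma LFE a v x : LF a v x = actF a v x.
Proof. by rewrite mxE. Qed.

Lemma MFE u c x : MF u c x = freeGen F (u, c) * x.
Proof. by rewrite !mxE. Qed.

Lemma LF_MF a v u c : LF a v * MF u c =
  \sum_b free_lmul (opE (Theta (u, c)) (pair2 a v) b) * LF (b ord0) (b ord_max).
Proof.
apply: lend_eq => x; rewrite lendME lend_sumE LFE MFE /actF ThetaE_gen.
rewrite contractM; apply: eq_bigr => e _.
by rewrite lendME LFE /actF -pair2E.
Qed.

(** [Theta] is built to satisfy the premise of [perm_of_skew]; what remains is a rearrangement of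
    finite sums with central scalars. *)
Lemma LF_MF_perm : perm_defect lsc R LF MF = 0.
Proof.
apply: (perm_of_skew q0 hR hPsi) => [|a v u c]; first exact: lend_sc_central.
rewrite LF_MF big_pair2.
transitivity (\sum_b \sum_d lsc (psi d u b v) * (\sum_x \sum_b2
    opE (map_mx lsc (invmx R) *m leg_at 2 0 MF *m map_mx lsc R) (pair2 a b) (pair2 x b2) *
    \sum_y (LF x y * lsc (ri y b2 c d)))); last first.
  do 2 (apply: eq_bigr => ? _); congr (_ * _); rewrite -[in RHS]mulmxA [RHS]opE_mul [RHS]big_pair2.
  do 2 (apply: eq_bigr => ? _); congr (_ * _); rewrite [RHS]opE_leg2_mull.
  by apply: eq_bigr => ? _; rewrite opE_map.
have mapE : map_mx lsc (invmx R) *m leg_at 2 0 MF *m map_mx lsc R =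
    map_mx (@free_lmul F _) (map_mx scF (invmx R) *m leg_at 2 0 gF *m map_mx scF R).
  rewrite !map_mxM leg_at_map.
  by rewrite -!(@map_sc _ _ _ scF lsc (@free_lmul F _)) // => x; apply: free_lmul_sc.
rewrite {}mapE.
transitivity (\sum_x \sum_y \sum_b \sum_d \sum_b2
   lsc (psi d u b v * ri y b2 c d) * free_lmul (opE (map_mx scF (invmx R) *m leg_at 2 0 gF *m map_mx scF R) (pair2 a b) (pair2 x b2)) * LF x y).
  do 2 (apply: eq_bigr => ? _); rewrite opE_mkop !pair2_0 !pair2_1 /=.
  do 3 (rewrite rmorph_sum mulr_suml; apply: eq_bigr => ? _).
  by rewrite -free_scaleE rmorphM /= free_lmul_sc.
rewrite exchange_2_3; do 2 (apply: eq_bigr => ? _).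
rewrite [in RHS]exchange_big mulr_sumr; apply: eq_bigr => b2 _.
rewrite mulr_sumr; apply: eq_bigr => x _; rewrite !mulr_sumr; apply: eq_bigr => y _.
rewrite -[LF x y * _]lend_sc_central rmorphM -!mulrA; congr (_ * _).
rewrite opE_map !mulrA; congr (_ * _); exact: lend_sc_central.
Qed.

End FreeAction.

Section Pass.
Variables (F : fieldType) (N : nat) (q : F) (R Psi : tensOp F N 2).
Hypothesis q0 : q != 0.
Hypothesis hR : hecke_symmetry q R.
Hypothesis hPsi : skew_inverse R Psi.
Variables (A : pzRingType) (sc : {rmorphism F -> A}).
Hypothesis sc_central : forall c x, sc c * x = x * sc c.
Variables (L M : 'M[A]_N).
Hypothesis LM : perm_defect sc R L M = 0.

Local Notation r a b c d := (opE R (pair2 a b) (pair2 c d)).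
Local Notation Rl := (Rleg R sc 3).
Local Notation Ri := (Rinv R sc 3).

Lemma leg_adj_RE K (X : 'M[A]_N) : (1 < K)%N ->
  leg_adj K 0 (RE_defect sc R X) =
  Rleg R sc K 0 * leg_at K 0 X * Rleg R sc K 0 * leg_at K 0 X -
  leg_at K 0 X * Rleg R sc K 0 * leg_at K 0 X * Rleg R sc K 0.
Proof.
move=> hK; have inj := @block_ord_inj 2 K 0 hK.
rewrite (leg_adjE (hK : (0 + 2 <= K)%N)) /RE_defect embB !(embM inj) !leg_at_block // !emb_map.
by rewrite -!(leg_adjE (hK : (0 + 2 <= K)%N)).
Qed.

Lemma opE3_0_leg (X : tensOp A N 2) (Y : 'M[A]_N) c f g' j k g :
  opE (leg_adj 3 0 X *m leg_at 3 0 Y) (idx3 c f g') (idx3 j k g) =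
  (\sum_w opE X (pair2 c f) (pair2 w k) * Y w j) * (g' == g)%:R.
Proof.
rewrite opE3_0_mull mulr_suml; apply: eq_bigr => w _.
under eq_bigr => u _ do rewrite opE_leg3 andbC -mulnb natrM !mulrA.
by rewrite sum_deltar.
Qed.

Variable S : A -> Prop.
Hypothesis cS : sc_closed sc S.

Lemma scCA x c y : x * (sc c * y) = sc c * (x * y).
Proof. by rewrite mulrA -sc_central mulrA. Qed.

Definition Smx k (X : tensOp A N k) := forall i j, S (opE X i j).

Lemma Smx_mull k X Z : Smx Z -> Smx (map_mx sc X *m Z : tensOp A N k).
Proof.
move=> h i j; rewrite opE_mul; apply: (sc_closed_sum cS) => c _.
by rewrite opE_map; have [_ _ SZ] := cS; apply: SZ.
Qed.

Lemma Smx_leg_adj Z : Smx Z -> Smx (leg_adj 3 0 Z : tensOp A N 3).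
Proof.
move=> h i j; rewrite (idx3E i) (idx3E j) opE3_0; have [S0 _ _] := cS.
by case: (_ == _); rewrite ?mulr1 ?mulr0.
Qed.

(** [RE_pass_right] rewrites L_1 R_12 R_23 E, for E the relation matrix of M, so that only scalars
    stand to the left of E. Its entries then lie in the right ideal S, and Psi strips off the two
    R's, one per use of [skew_strip]. *)
Lemma RE_right :
  (forall x y, S x -> S (x * y)) -> Smx (RE_defect sc R M) ->
  forall a a' i j, S (L a a' * opE (RE_defect sc R M) i j).
Proof.
move=> SM hE.
pose E3 : tensOp A N 3 := leg_adj 3 0 (RE_defect sc R M).
have SE3 : Smx E3 by apply: Smx_leg_adj.
have Smulr (Z W : tensOp A N 3) : Smx Z -> Smx (Z *m W).
  by move=> h i j; rewrite opE_mul; apply: (sc_closed_sum cS) => c _; apply: SM.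
have key : Smx (leg_at 3 0 L *m Rl 0 *m Rl 1 *m E3).
  have := @downcopy_upcopies_legs _ _ _ _ q0 hR _ _ sc_central 2 _ _ LM.
  rewrite !big_ord_recr big_ord0 /= !mul1r mulr1 !mulrA => h.
  have := @RE_pass_right _ (Rl 0) (Rl 1) (Ri 0) (Ri 1) _ _ _ _ _ (leg_at 3 0 L) (leg_at 3 0 M).
  rewrite -[_ - _]leg_adj_RE // -/E3 => pass.
  rewrite !mulmxE pass.
  - have -> : Rl 0 * Rl 1 * (Ri 1 * Ri 0 * Ri 0 * Ri 1) = map_mx sc
      (leg_adj 3 0 R *m leg_adj 3 1 R *m (leg_adj 3 1 (invmx R) *m leg_adj 3 0 (invmx R) *m leg_adj 3 0 (invmx R) *m leg_adj 3 1 (invmx R))).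
      by rewrite !map_mxM.
    by apply: Smulr; apply: Smx_mull.
  - exact: (RlegK q0 hR).
  - exact: (RinvK q0 hR).
  - exact: (RlegK q0 hR).
  - exact: (RinvK q0 hR).
  - exact: (Rleg_braid hR).
  - exact: Rleg_at_commute.
  - by rewrite !mulrA.
move=> a a' i j; rewrite (pair2E i) (pair2E j); move: (i ord0) (i ord_max) (j ord0) (j ord_max) => c f h k.
apply: (skew_strip hPsi cS (f := fun a' c => L a a' * opE (RE_defect sc R M) (pair2 c f) (pair2 h k))) => b d.
apply: (skew_strip hPsi cS (f := fun d f => \sum_a' \sum_c sc (r a' b c d) *
  (L a a' * opE (RE_defect sc R M) (pair2 c f) (pair2 h k)))) => e g.
have := key (idx3 a b e) (idx3 h k g).
rewrite -!mulmxA opE_leg3_mull /Rleg -!leg_adj_map.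
congr S; transitivity (\sum_x \sum_c \sum_d \sum_f
   sc (r d e f g) * (sc (r x b c d) * (L a x * opE (RE_defect sc R M) (pair2 c f) (pair2 h k)))).
  apply: eq_bigr => x _; rewrite opE3_0_mull mulr_sumr; apply: eq_bigr => y _.
  rewrite mulr_sumr; apply: eq_bigr => z _; rewrite opE3_1_mull !mulr_sumr.
  apply: eq_bigr => w _.
  under eq_bigr => g' _ do rewrite /E3 opE3_0 mulrA.
  by rewrite sum_deltar !opE_map !(scCA (L a x)) (scCA (sc (r x b y z))).
rewrite exchange_2_2; apply: eq_bigr => z _; apply: eq_bigr => w _.
by rewrite mulr_sumr; apply: eq_bigr => x _; rewrite mulr_sumr.
Qed.

(** Mirror image of [RE_right]: after passing M only scalars stand to the right of the relation
    matrix of L, and S is a left ideal. *)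
Lemma RE_left :
  (forall x y, S y -> S (x * y)) -> Smx (RE_defect sc R L) ->
  forall h j i i', S (opE (RE_defect sc R L) i i' * M h j).
Proof.
move=> SM hE.
pose E3 : tensOp A N 3 := leg_adj 3 0 (RE_defect sc R L).
have SE3 : Smx E3 by apply: Smx_leg_adj.
have Smull (Z W : tensOp A N 3) : Smx Z -> Smx (W *m Z).
  by move=> h i j; rewrite opE_mul; apply: (sc_closed_sum cS) => c _; apply: SM.
have Smulr (Z : tensOp A N 3) X : Smx Z -> Smx (Z *m map_mx sc X).
  move=> h i j; rewrite opE_mul; apply: (sc_closed_sum cS) => c _.
  by rewrite opE_map -sc_central; have [_ _ SZ] := cS; apply: SZ.
have key : Smx (E3 * (Rl 1 * Rl 0 * leg_at 3 0 M)).
  have h := perm_legs (isT : (1 < 3)%N) LM.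
  have E3E : E3 = Rl 0 * (leg_at 3 0 L * Rl 0 * leg_at 3 0 L) - leg_at 3 0 L * Rl 0 * leg_at 3 0 L * Rl 0.
    by rewrite /E3 leg_adj_RE // !mulrA.
  rewrite E3E (@RE_pass_left _ (Rl 0) (Rl 1) (Ri 0) (Ri 1)) -?E3E.
  - have -> : Ri 1 * Ri 0 = map_mx sc (leg_adj 3 1 (invmx R) *m leg_adj 3 0 (invmx R)).
      by rewrite !map_mxM.
    by apply: Smulr; apply: Smull.
  - exact: (RlegK q0 hR).
  - exact: (RinvK q0 hR).
  - exact: (RlegK q0 hR).
  - exact: (RinvK q0 hR).
  - exact: (Rleg_braid hR).
  - exact: Rleg_at_commute.
  - exact: Rleg_at_commute.
  - by [].
move=> x0 j i i'; rewrite (pair2E i) (pair2E i'); move: (i ord0) (i ord_max) (i' ord0) (i' ord_max) x0 => a b.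
move=> c d h; set Ed := RE_defect sc R L.
move: c h; apply: (skew_strip hPsi cS (f := fun c h => opE Ed (pair2 a b) (pair2 c d) * M h j)) => f k.
move: d f; apply: (skew_strip hPsi cS (f := fun d f => \sum_c \sum_h sc (r c f h k) *
  (opE Ed (pair2 a b) (pair2 c d) * M h j))) => e g.
have := key (idx3 a b e) (idx3 j k g).
rewrite -!mulmxE -!mulmxA /E3 opE3_0_mull /Rleg -!leg_adj_map.
congr S; transitivity (\sum_c \sum_h \sum_d \sum_f
   sc (r d e f g) * (sc (r c f h k) * (opE Ed (pair2 a b) (pair2 c d) * M h j))); last first.
  rewrite exchange_2_2; apply: eq_bigr => z _; apply: eq_bigr => w _.
  by rewrite mulr_sumr; apply: eq_bigr => x _; rewrite mulr_sumr.
apply: eq_bigr => c _; rewrite [RHS]exchange_big; apply: eq_bigr => d _.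
rewrite opE3_1_mull mulr_sumr [RHS]exchange_big; apply: eq_bigr => f _.
have T w := opE3_0_leg (map_mx sc R) M c f w j k g.
rewrite mulr_sumr.
transitivity (\sum_w opE Ed (pair2 a b) (pair2 c d) * sc (r d e f w) *
    (\sum_h opE (map_mx sc R) (pair2 c f) (pair2 h k) * M h j) * (w == g)%:R).
  by apply: eq_bigr => w _; rewrite T !mulrA opE_map.
rewrite sum_deltar mulr_sumr; apply: eq_bigr => h _.
by rewrite -!mulrA opE_map !(scCA (opE Ed _ _)).
Qed.

End Pass.

Lemma ppi_rel (F : fieldType) (I : choiceType) (rels : set (freeAlg F I)) x :
  rels x -> ppi rels x = 0.
Proof.
move=> hx; rewrite -(rmorph0 (ppi rels)); apply: ppi_eq; rewrite subr0.
exists [:: (1, x, 1)]; split; last by rewrite big_seq1 mul1r mulr1.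
by move=> t; rewrite inE => /eqP ->.
Qed.

Section AbstractStable.
Variables (F I : Type) (J : finType) (A : pzRingType) (sc : F -> A) (gen : I -> A).
Hypothesis A_ind : forall P : A -> Prop,
  P 1 -> (forall x y, P x -> P y -> P (x + y)) -> (forall c x, P x -> P (sc c * x)) ->
  (forall i x, P x -> P (gen i * x)) -> forall x, P x.
Variables (Id rels : A -> Prop).
Hypothesis Id0 : Id 0.
Hypothesis IdD : forall x y, Id x -> Id y -> Id (x + y).
Hypothesis IdM : forall x y, Id y -> Id (x * y).
Variables (act : J -> A -> A) (Th : I -> J -> J -> A).
Hypothesis act0 : forall j, act j 0 = 0.
Hypothesis actD : forall j x y, act j (x + y) = act j x + act j y.
Hypothesis act_sc : forall j c x, act j (sc c * x) = sc c * act j x.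
Hypothesis act_gen : forall j k x, act j (gen k * x) = \sum_j' Th k j j' * act j' x.
Hypothesis act_rel : forall e y j, rels e -> Id (act j (e * y)).

(** A term m e y of the ideal is treated by induction on m: passing a generator only produces left
    coefficients [Th], which the ideal absorbs, until the relation e stands in front. *)
Lemma act_ideal (s : seq (A * A * A)) j : (forall t, t \in s -> rels t.1.2) ->
  Id (act j (\sum_(t <- s) t.1.1 * t.1.2 * t.2)).
Proof.
have mon_ok e y m : rels e -> forall j, Id (act j (m * (e * y))).
  move=> he; elim/A_ind: m => [|m m' hm hm'|c m hm|k m hm] j'.
  - by rewrite mul1r; apply: act_rel.
  - by rewrite mulrDl actD; apply: IdD.
  - by rewrite -mulrA act_sc; apply: IdM.
  - by rewrite -mulrA act_gen; apply: (big_ind Id) => // b _; apply: IdM.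
elim: s => [|t s IH] hs; first by rewrite big_nil act0.
rewrite big_cons actD; apply: IdD; last first.
  by apply: IH => u hu; apply: hs; rewrite inE hu orbT.
by rewrite -mulrA; apply: mon_ok; apply: hs; rewrite inE eqxx.
Qed.

End AbstractStable.

(** * Operators induced on a quotient algebra *)

Section Descent.
Variables (F : fieldType) (I : choiceType) (rels : set (freeAlg F I)).
Local Notation FA := (freeAlg F I).
Local Notation pi := (@ppi F I rels).

Definition stable (f : lend FA) := forall x, in_ideal rels x -> in_ideal rels (f x).

Lemma stable_of_gens (J : finType) (act : J -> lend FA) (Th : I -> J -> J -> FA) :
  (forall j k, act j * free_lmul (freeGen F k) = \sum_j' free_lmul (Th k j j') * act j') ->
  (forall e y j, rels e -> in_ideal rels (act j (e * y))) ->
  forall j, stable (act j).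
Proof.
move=> hgen hrel j x [s [hs ->]].
apply: (@act_ideal F I J FA (fun c => c%:A) (@freeGen F I) _ (in_ideal rels) rels _ _ _
  (fun j => lend_fun (act j)) Th) hs.
- move=> P P1 PD PZ Pg; apply: free_ind => // c y hy.
  by rewrite -free_scaleE; apply: PZ.
- exact: in_ideal0.
- exact: in_idealD.
- exact: in_idealMl.
- by move=> j'; apply: lend_fun0.
- by move=> j'; apply: lend_funD.
- by move=> j' c y; rewrite !free_scaleE; apply: lend_funZ.
- move=> j' k y; have := congr1 (fun f : lend FA => f y) (hgen j' k).
  by rewrite lend_sumE.
- by move=> e y j' he; apply: hrel.
Qed.

Lemma ppi_surj (x : palg rels) : exists y, x = pi y.
Proof. by exists (prepr x); rewrite preprK. Qed.

Lemma stable_ppi f x : stable f -> pi (f (prepr (pi x))) = pi (f x).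
Proof.
move=> hf; apply: ppi_eq.
have -> : f (prepr (pi x)) - f x = f (prepr (pi x) - x).
  by rewrite lend_funD -[- x]scaleN1r lend_funZ scaleN1r.
by apply: hf; apply: prepr_ppi.
Qed.

Lemma descend_linear f : stable f -> linear (fun x : palg rels => pi (f (prepr x))).
Proof.
move=> hf c x y; have [x' ->] := ppi_surj x; have [y' ->] := ppi_surj y.
rewrite -ppiZE -ppiD !stable_ppi // -ppiZE -ppiD; congr ppi.
exact: lend_linear.
Qed.

Definition descend f (hf : stable f) : lend (palg rels) := Lend (descend_linear hf).

(** A relation instead of an operation on stable operators: it is compatible with sums and products,
    so an identity between matrices of operators passes to the quotient entry by entry, without a
    stability proof for every intermediate operator. *)
Definition induces (T : lend FA) (T' : lend (palg rels)) := forall x, T' (pi x) = pi (T x).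

Lemma induces_descend f (hf : stable f) : induces f (descend hf).
Proof. by move=> x; apply: stable_ppi. Qed.

Lemma induces_lmul m : induces (free_lmul m) (palg_lmul (pi m)).
Proof. by move=> x; rewrite /= rmorphM. Qed.

Lemma inducesM T T' U U' : induces T T' -> induces U U' -> induces (T * U) (T' * U').
Proof. by move=> hT hU x; rewrite !lendME hU hT. Qed.

Lemma induces0 : induces 0 0.
Proof. by move=> x; rewrite !lend0E rmorph0. Qed.

Lemma inducesD T T' U U' : induces T T' -> induces U U' -> induces (T + U) (T' + U').
Proof. by move=> hT hU x; rewrite !lendDE hU hT ppiD. Qed.

Lemma inducesB T T' U U' : induces T T' -> induces U U' -> induces (T - U) (T' - U').
Proof. by move=> hT hU x; rewrite !lendBE hU hT rmorphB. Qed.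

Lemma induces_sc c : induces (lend_sc FA c) (lend_sc _ c).
Proof. by move=> x; rewrite /= ppiZE. Qed.

Lemma induces_eq0 T' : induces 0 T' -> T' = 0.
Proof.
move=> h; apply: lend_eq => x; have [y ->] := ppi_surj x.
by rewrite h !lend0E rmorph0.
Qed.

Variable N : nat.

Definition induces_mx k (X : tensOp (lend FA) N k) (Y : tensOp (lend (palg rels)) N k) :=
  forall i j, induces (opE X i j) (opE Y i j).

Lemma induces_mxM k X X' Y Y' : @induces_mx k X X' -> induces_mx Y Y' ->
  induces_mx (X *m Y) (X' *m Y').
Proof.
move=> hX hY i j; rewrite !opE_mul; apply: (big_ind2 induces); first exact: induces0.
  by move=> ? ? ? ?; apply: inducesD.
by move=> c _; apply: inducesM.
Qed.

Lemma induces_mxB k X X' Y Y' : @induces_mx k X X' -> induces_mx Y Y' ->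
  induces_mx (X - Y) (X' - Y').
Proof. by move=> hX hY i j; rewrite !opE_sub; apply: inducesB; [apply: hX | apply: hY]. Qed.

Lemma induces_mx_sc k (X : tensOp F N k) :
  induces_mx (map_mx (lend_sc FA) X) (map_mx (lend_sc (palg rels)) X).
Proof. by move=> i j; rewrite !opE_map; apply: induces_sc. Qed.

Lemma induces_mx_leg (X : 'M[lend FA]_N) (X' : 'M[lend (palg rels)]_N) : (forall a v, induces (X a v) (X' a v)) ->
  induces_mx (leg_at 2 0 X) (leg_at 2 0 X').
Proof.
move=> h i j; rewrite (pair2E i) (pair2E j) !opE_leg2.
by case: (_ == _); rewrite ?mulr1 ?mulr0 //; apply: induces0.
Qed.

Lemma induces_perm_defect (R : tensOp F N 2)
    (L M : 'M[lend FA]_N) (L' M' : 'M[lend (palg rels)]_N) :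
  (forall a v, induces (L a v) (L' a v)) -> (forall a v, induces (M a v) (M' a v)) ->
  perm_defect (lend_sc FA) R L M = 0 ->
  perm_defect (lend_sc (palg rels)) R L' M' = 0.
Proof.
move=> hL hM h; have {}hL := induces_mx_leg hL; have {}hM := induces_mx_leg hM.
have hS := @induces_mx_sc 2.
have : induces_mx (perm_defect (lend_sc FA) R L M) (perm_defect (lend_sc (palg rels)) R L' M').
  by apply: induces_mxB; do !apply: induces_mxM.
rewrite h => H; apply: opEP => i j; rewrite opE0; apply: induces_eq0.
by have := H i j; rewrite opE0.
Qed.

Definition ev1 (X : tensOp (lend (palg rels)) N 2) : tensOp (palg rels) N 2 :=
  map_mx (fun f : lend (palg rels) => f 1) X.

Lemma opE_ev1 X i j : opE (ev1 X) i j = opE X i j 1.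
Proof. by rewrite /opE mxE. Qed.

Lemma ev1_leg Y (L : 'M[lend (palg rels)]_N) : (forall a v, L a v 1 = (a == v)%:R) ->
  ev1 (Y *m leg_at 2 0 L) = ev1 Y.
Proof.
move=> hL; apply: opEP => a b; rewrite [b]pair2E !opE_ev1 opE_leg2_mulr lend_sumE.
under eq_bigr => p _ do rewrite lendME hL.
rewrite (bigD1 (b ord0)) //= big1 ?addr0 ?eqxx // => p /negbTE ->.
by rewrite lend_fun0.
Qed.

Lemma ev1_sc Y X : ev1 (Y *m map_mx (lend_sc _) X) = ev1 Y *m map_mx (pcst rels) X.
Proof.
apply: opEP => a b; rewrite opE_ev1 !opE_mul lend_sumE; apply: eq_bigr => c _.
by rewrite opE_ev1 !opE_map lendME /= lend_funZ -pcst_central pcstE.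
Qed.

Lemma ev1B X Y : ev1 (X - Y) = ev1 X - ev1 Y.
Proof. by apply: opEP => a b; rewrite opE_sub !opE_ev1 opE_sub lendBE. Qed.

(** Applied to the vector 1, L acts as the identity matrix, and both sides of the reflection
    equation reduce to R R. *)
Lemma ev1_RE (R : tensOp F N 2) (L : 'M[lend (palg rels)]_N) :
  (forall a v, L a v 1 = (a == v)%:R) -> ev1 (RE_defect (lend_sc _) R L) = 0.
Proof.
move=> hL; have evS X : ev1 (map_mx (lend_sc _) X) = map_mx (pcst rels) X.
  by apply: opEP => i j; rewrite opE_ev1 !opE_map.
have evL : ev1 (leg_at 2 0 L) = 1%:M.
  rewrite -[leg_at 2 0 L]mul1mx ev1_leg //.
  by apply: opEP => i j; rewrite opE_ev1 !opE1; case: eqP.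
by rewrite /RE_defect ev1B !(ev1_leg _ hL, ev1_sc, evS, evL) mul1mx subrr.
Qed.

End Descent.

(** * The operators on M(R) and their relations *)

Section Rep.
Variables (F : fieldType) (N : nat) (q : F) (R Psi : tensOp F N 2).
Hypothesis q0 : q != 0.
Hypothesis hR : hecke_symmetry q R.
Hypothesis hPsi : skew_inverse R Psi.

Local Notation FM := (freeAlg F ('I_N * 'I_N)%type).
Local Notation scF := (GRing.in_alg FM).
Local Notation lsc := (lend_sc FM).
Local Notation rels := (RE_rels R).
Local Notation MR := (REalg R).
Local Notation pi := (@ppi F ('I_N * 'I_N)%type (RE_rels R)).
Local Notation psc := (lend_sc MR).
Local Notation LF := (LF R Psi).
Local Notation MF := (MF F N).

Lemma lmul_RE_defect : map_mx (@free_lmul F _) (RE_defect scF R (gF F N)) = RE_defect lsc R MF.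
Proof. by apply: RE_defect_map => c; apply: free_lmul_sc. Qed.

Lemma RE_rels_entry i j : rels (opE (RE_defect scF R (gF F N)) i j).
Proof. by exists (enum_rank i), (enum_rank j). Qed.

(** The right ideal S consists of the operators whose values all lie in the ideal of M(R). It
    contains left multiplication by each relation, so [RE_right] shows that L sends a relation times
    any element into the ideal. *)
Lemma LF_stable a v : stable rels (LF a v).
Proof.
pose S (f : lend FM) := forall x, in_ideal rels (f x).
have cS : sc_closed lsc S.
  split=> [y|f g hf hg y|c f hf y]; first exact: in_ideal0.
    by apply: in_idealD.
  by rewrite lendME /= -free_scaleE; apply: in_idealMl.
have SE : Smx S (RE_defect lsc R MF).
  move=> i j y; rewrite -lmul_RE_defect opE_map /=; apply: in_idealMr.
  exists [:: (1, opE (RE_defect scF R (gF F N)) i j, 1)].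
  split; last by rewrite big_seq1 mul1r mulr1.
  by move=> t; rewrite inE => /eqP -> /=; apply: RE_rels_entry.
have key := RE_right q0 hR hPsi (@lend_sc_central _ _) (LF_MF_perm q0 hR hPsi) cS (fun f g hf y => hf (g y)) SE.
pose act (p : 'I_N * 'I_N) := LF p.1 p.2.
pose Th k (p p' : 'I_N * 'I_N) := opE (Theta R Psi k) (pair2 p.1 p.2) (pair2 p'.1 p'.2).
apply: (@stable_of_gens _ _ _ _ act Th _ _ (a, v)) => [[a' v'] [u c]|e y [a' v'] [i [j ->]]].
  have <- : MF u c = free_lmul (freeGen F (u, c)) by rewrite !mxE.
  rewrite [LHS]LF_MF big_pair2 pair_bigA; by apply: eq_bigr => -[x y] _; rewrite pair2_0 pair2_1.
have := key a' v' (enum_val i) (enum_val j) y.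
by rewrite -lmul_RE_defect opE_map lendME /= /opE !enum_valK.
Qed.

Definition LP : 'M[lend MR]_N := \matrix_(a, v) descend (LF_stable a v).
Definition MP : 'M[lend MR]_N := map_mx (@palg_lmul _ _ rels) (generator_mx R).

Lemma MPE u c x : MP u c x = pgen rels (u, c) * x.
Proof. by rewrite !mxE. Qed.

Lemma LP_MP_perm : perm_defect psc R LP MP = 0.
Proof.
apply: induces_perm_defect (LF_MF_perm q0 hR hPsi) => a v.
  have -> : LP a v = descend (LF_stable a v) by rewrite mxE.
  exact: induces_descend.
by rewrite !mxE; apply: induces_lmul.
Qed.

Lemma RE_gen : RE_defect (pcst rels) R (generator_mx R) = 0.
Proof.
have -> : generator_mx R = map_mx pi (gF F N) by apply/matrixP => i j; rewrite !mxE.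
rewrite -(@RE_defect_map _ _ _ _ _ scF) => [|c]; last by rewrite /= ppiZE.
apply: opEP => i j; rewrite opE_map opE0; apply: ppi_rel.
exact: RE_rels_entry.
Qed.

Lemma MP_RE : RE_defect psc R MP = 0.
Proof.
rewrite -(@RE_defect_map _ _ _ _ _ (pcst rels)) => [|c]; last exact: palg_lmul_sc.
by rewrite RE_gen map_mx0.
Qed.

Lemma LP1 a v : LP a v 1 = (a == v)%:R.
Proof.
have -> : LP a v = descend (LF_stable a v) by rewrite mxE.
have := induces_descend (LF_stable a v) 1; rewrite rmorph1 => ->.
by rewrite LFE actF1 rmorph_nat.
Qed.

(** Induction on the vector acted on, starting from 1 with [ev1_RE]. If the relation matrix of L
    kills x, it kills every generator times x: apply [RE_left] to the left ideal of operators that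
    kill x. *)
Lemma LP_RE : RE_defect psc R LP = 0.
Proof.
apply: opEP => i j; rewrite opE0; apply: lend_eq => x; rewrite lend0E.
move: i j; elim/palg_ind: x => [|x y hx hy|c x hx|[h k] x hx] i j.
- by rewrite -opE_ev1 (ev1_RE _ LP1) opE0.
- by rewrite lend_funD hx hy addr0.
- by rewrite lend_funZ hx scaler0.
pose S (f : lend MR) := f x = 0.
have cS : sc_closed psc S.
  split=> [|f g hf hg|c f hf]; rewrite /S ?lend0E //.
    by rewrite lendDE hf hg addr0.
  by rewrite lendME hf lend_fun0.
have := RE_left q0 hR hPsi (@lend_sc_central _ _) LP_MP_perm cS.
move/(_ _ hx h k i j); rewrite /S lendME MPE; apply.
by move=> f g hg; rewrite lendME hg lend_fun0.
Qed.

End Rep.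

Section REMorphisms.
Variables (F : fieldType) (N : nat) (R : tensOp F N 2).
Variables (A : pzRingType) (sc : {rmorphism F -> A}).
Hypothesis sc_central : forall c x, sc c * x = x * sc c.

Lemma freeEval_RE (X : 'M[A]_N) : RE_defect sc R X = 0 ->
  forall x, RE_rels R x -> freeEval sc (fun p => X p.1 p.2) x = 0.
Proof.
move=> hX x [i [j ->]].
have [g gE] := freeEval_rmorphism (fun p : 'I_N * 'I_N => X p.1 p.2) sc_central.
have scE : g \o GRing.in_alg _ =1 sc.
  by move=> c; rewrite [LHS]gE freeEvalZ freeEval1 mulr1.
have genE : map_mx g (gF F N) = X.
  by apply/matrixP => a b; rewrite !mxE [LHS]gE freeEval_gen.
have := RE_defect_map R scE (gF F N); rewrite genE hX => /matrixP/(_ i j).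
by rewrite [LHS]mxE [RHS]mxE gE.
Qed.

Definition dgen (L M : 'M[A]_N) (p : 'I_N * 'I_N + 'I_N * 'I_N) : A :=
  match p with inl p => L p.1 p.2 | inr p => M p.1 p.2 end.

Lemma freeEval_double (L M : 'M[A]_N) : RE_defect sc R L = 0 -> RE_defect sc R M = 0 ->
  perm_defect sc R L M = 0 ->
  forall x, double_rels R x -> freeEval sc (dgen L M) x = 0.
Proof.
move=> hL hM hLM x.
have [g gE] := freeEval_rmorphism (dgen L M) sc_central.
have scE : g \o GRing.in_alg _ =1 sc.
  by move=> c; rewrite [LHS]gE freeEvalZ freeEval1 mulr1.
rewrite -gE => -[[]|] [i [j ->]].
- have := RE_defect_map R scE (\matrix_(i, j) freeGen F (inl (i, j))).
  have -> : map_mx g (\matrix_(i, j) freeGen F (inl (i, j))) = L.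
    by apply/matrixP => a b; rewrite !mxE [LHS]gE freeEval_gen.
  by rewrite hL => /matrixP/(_ i j); rewrite [LHS]mxE [RHS]mxE.
- have := RE_defect_map R scE (\matrix_(i, j) freeGen F (inr (i, j))).
  have -> : map_mx g (\matrix_(i, j) freeGen F (inr (i, j))) = M.
    by apply/matrixP => a b; rewrite !mxE [LHS]gE freeEval_gen.
  by rewrite hM => /matrixP/(_ i j); rewrite [LHS]mxE [RHS]mxE.
have := perm_defect_map R scE (\matrix_(i, j) freeGen F (inl (i, j))) (\matrix_(i, j) freeGen F (inr (i, j))).
have -> : map_mx g (\matrix_(i, j) freeGen F (inr (i, j))) = M.
  by apply/matrixP => a b; rewrite !mxE [LHS]gE freeEval_gen.
have -> : map_mx g (\matrix_(i, j) freeGen F (inl (i, j))) = L.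
  by apply/matrixP => a b; rewrite !mxE [LHS]gE freeEval_gen.
by rewrite hLM => /matrixP/(_ i j); rewrite [LHS]mxE [RHS]mxE.
Qed.

End REMorphisms.

(** * Structure maps of the quantum double and the counit *)

Section Double.
Variables (F : fieldType) (N : nat) (R : tensOp F N 2).
Local Notation D := (qdouble R).
Local Notation dsc := (pcst (double_rels R)).
Local Notation pi := (@ppi F ('I_N * 'I_N + 'I_N * 'I_N)%type (double_rels R)).
Local Notation MR := (REalg R).

Definition LD : 'M[D]_N := \matrix_(i, j) pgen (double_rels R) (inl (i, j)).
Definition MD : 'M[D]_N := \matrix_(i, j) pgen (double_rels R) (inr (i, j)).

Lemma pi_sc : pi \o GRing.in_alg _ =1 dsc.
Proof. by move=> c; rewrite /= ppiZE. Qed.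

Lemma LD_RE : RE_defect dsc R LD = 0.
Proof.
have -> : LD = map_mx pi (\matrix_(i, j) freeGen F (inl (i, j))) by apply/matrixP => i j; rewrite !mxE.
rewrite -(RE_defect_map R pi_sc).
apply: opEP => i j; rewrite opE_map opE0; apply: ppi_rel.
by left; left; exists (enum_rank i), (enum_rank j).
Qed.

Lemma MD_RE : RE_defect dsc R MD = 0.
Proof.
have -> : MD = map_mx pi (\matrix_(i, j) freeGen F (inr (i, j))) by apply/matrixP => i j; rewrite !mxE.
rewrite -(RE_defect_map R pi_sc).
apply: opEP => i j; rewrite opE_map opE0; apply: ppi_rel.
by left; right; exists (enum_rank i), (enum_rank j).
Qed.

Lemma LD_MD_perm : perm_defect dsc R LD MD = 0.
Proof.
have -> : MD = map_mx pi (\matrix_(i, j) freeGen F (inr (i, j))) by apply/matrixP => i j; rewrite !mxE.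
have -> : LD = map_mx pi (\matrix_(i, j) freeGen F (inl (i, j))) by apply/matrixP => i j; rewrite !mxE.
rewrite -(perm_defect_map R pi_sc).
apply: opEP => i j; rewrite opE_map opE0; apply: ppi_rel.
by right; exists (enum_rank i), (enum_rank j).
Qed.

Lemma iota_ext (X : 'M[D]_N) (f : 'I_N * 'I_N -> D) x : (fun p => X p.1 p.2) =1 f ->
  plift (RE_rels R) dsc f x = plift (RE_rels R) dsc (fun p => X p.1 p.2) x.
Proof. by move=> /funext ->. Qed.

Lemma iotaLE x : iotaL x = plift (RE_rels R) dsc (fun p => LD p.1 p.2) x.
Proof. by apply: iota_ext => -[a b]; rewrite mxE. Qed.

Lemma iotaME x : iotaM x = plift (RE_rels R) dsc (fun p => MD p.1 p.2) x.
Proof. by apply: iota_ext => -[a b]; rewrite mxE. Qed.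

Lemma iotaL_rmorphism : {g : {rmorphism MR -> D} | g =1 @iotaL F N R}.
Proof.
have [g gE] := plift_rmorphism (@pcst_central _ _ _) (freeEval_RE (@pcst_central _ _ _) LD_RE).
by exists g => x; rewrite gE iotaLE.
Qed.

Lemma iotaM_rmorphism : {g : {rmorphism MR -> D} | g =1 @iotaM F N R}.
Proof.
have [g gE] := plift_rmorphism (@pcst_central _ _ _) (freeEval_RE (@pcst_central _ _ _) MD_RE).
by exists g => x; rewrite gE iotaME.
Qed.

Lemma iotaL_gen i j : iotaL (pgen (RE_rels R) (i, j)) = LD i j.
Proof.
rewrite iotaLE.
by rewrite (plift_gen (@pcst_central _ _ _) (freeEval_RE (@pcst_central _ _ _) LD_RE)).
Qed.

Lemma iotaM_gen i j : iotaM (pgen (RE_rels R) (i, j)) = MD i j.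
Proof.
rewrite iotaME.
by rewrite (plift_gen (@pcst_central _ _ _) (freeEval_RE (@pcst_central _ _ _) MD_RE)).
Qed.

Lemma iotaLZ c x : iotaL (c *: x) = c *: iotaL x :> D.
Proof.
rewrite !iotaLE.
by rewrite (pliftZ (@pcst_central _ _ _) (freeEval_RE (@pcst_central _ _ _) LD_RE)) pcstE.
Qed.

Lemma iotaMZ c x : iotaM (c *: x) = c *: iotaM x :> D.
Proof.
rewrite !iotaME.
by rewrite (pliftZ (@pcst_central _ _ _) (freeEval_RE (@pcst_central _ _ _) MD_RE)) pcstE.
Qed.

Lemma RE_defect1 : RE_defect (idfun : {rmorphism F -> F}) R 1%:M = 0.
Proof.
have -> : RE_defect idfun R 1%:M = RE_defect (idfun : F -> F) R 1%:M by [].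
by rewrite /RE_defect leg_at1 !mulmx1 mul1mx subrr.
Qed.

(** The counit is well defined because the identity matrix solves the reflection equation. *)
Lemma counit_rels : forall x, RE_rels R x ->
  freeEval (idfun : {rmorphism F -> F}) (fun p : 'I_N * 'I_N => (p.1 == p.2)%:R) x = 0.
Proof.
move=> x hx.
have := freeEval_RE (sc := idfun) (fun c x => mulrC _ _) RE_defect1 hx.
congr (_ = _); congr (freeEval _ _ x); apply: funext => -[a b]; by rewrite mxE.
Qed.

Lemma counit_rmorphism : {g : {rmorphism MR -> F} | g =1 @counit F N R}.
Proof. exact: (plift_rmorphism (sc := idfun) (fun c x => mulrC _ _) counit_rels). Qed.

Lemma counit_gen i j : counit (pgen (RE_rels R) (i, j)) = (i == j)%:R.
Proof. exact: (plift_gen (sc := idfun) (fun c x => mulrC _ _) counit_rels). Qed.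

Lemma counitZ c x : counit (c *: x : MR) = c * counit x.
Proof. exact: (pliftZ (sc := idfun) (fun c x => mulrC _ _) counit_rels). Qed.

End Double.

Section Uniqueness.
Variables (F : fieldType) (N : nat) (q : F) (R Psi : tensOp F N 2).
Hypothesis q0 : q != 0.
Hypothesis hR : hecke_symmetry q R.
Hypothesis hPsi : skew_inverse R Psi.
Local Notation D := (qdouble R).
Local Notation MR := (REalg R).
Local Notation psc := (lend_sc MR).
Local Notation LP := (LP q0 hR hPsi).
Local Notation MP := (MP R).

Let drels := freeEval_double (@lend_sc_central _ MR) (LP_RE q0 hR hPsi) (MP_RE R) (LP_MP_perm q0 hR hPsi).

(** The defining relations of the double are the three matrix identities already proved for [LP] and
    [MP]. *)
Lemma rep_rmorphism : {g : {rmorphism D -> lend MR} |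
  [/\ forall c x, g (c *: x) = psc c * g x, forall i j, g (LD R i j) = LP i j &
      forall i j, g (MD R i j) = MP i j]}.
Proof.
have [g gE] := plift_rmorphism (@lend_sc_central _ MR) drels.
exists g; split=> [c x|i j|i j].
- by rewrite !gE (pliftZ (@lend_sc_central _ MR) drels).
- by rewrite gE mxE (plift_gen (@lend_sc_central _ MR) drels).
- by rewrite gE mxE (plift_gen (@lend_sc_central _ MR) drels).
Qed.

Lemma action_unique (a b c c' : MR) : is_action a b c -> is_action a b c' -> c = c'.
Proof.
have [g [gZ gL gM]] := rep_rmorphism.
have [iL iLE] := iotaL_rmorphism R.
have [iM iME] := iotaM_rmorphism R.
have [ep epE] := counit_rmorphism R.
have iMZ c0 x : iM (c0 *: x) = c0 *: iM x by rewrite !iME iotaMZ.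
have iMg i j : iM (pgen (RE_rels R) (i, j)) = MD R i j by rewrite iME iotaM_gen.
have iLZ c0 x : iL (c0 *: x) = c0 *: iL x by rewrite !iLE iotaLZ.
have iLg i j : iL (pgen (RE_rels R) (i, j)) = LD R i j by rewrite iLE iotaL_gen.
have epZ c0 x : ep (c0 *: x) = c0 * ep x by rewrite !epE counitZ.
have epg i j : ep (pgen (RE_rels R) (i, j)) = (i == j)%:R by rewrite epE counit_gen.
have evM m : g (iM m) = palg_lmul m.
  elim/palg_ind: m => [|x y hx hy|d x hx|[i j] x hx].
  - by rewrite (rmorph1 iM) (rmorph1 g) palg_lmul1.
  - rewrite (rmorphD iM) (rmorphD g) hx hy.
    by apply: lend_eq => z; rewrite lendDE /= mulrDl.
  - by rewrite iMZ gZ hx; apply: lend_eq => y; rewrite lendME /= palg_scalerAl.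
  - rewrite (rmorphM iM) (rmorphM g) hx iMg gM palg_lmulM.
    by congr (_ * _); rewrite !mxE.
have evL l : g (iL l) (1 : MR) = ep l *: (1 : MR).
  elim/palg_ind: l => [|x y hx hy|d x hx|[i j] x hx].
  - by rewrite (rmorph1 iL) (rmorph1 g) (rmorph1 ep) scale1r lend1E.
  - by rewrite (rmorphD iL) (rmorphD g) (rmorphD ep) lendDE hx hy scalerDl.
  - by rewrite iLZ gZ lendME hx epZ /= scalerA.
  - rewrite (rmorphM iL) (rmorphM g) (rmorphM ep) lendME hx lend_funZ.
    rewrite iLg epg gL LP1 mulrC -scalerA.
    by case: (_ == _); rewrite ?scale1r ?scale0r.
have ev s e : is_sigma a b s -> e = \sum_(t <- s) counit t.2 *: t.1 -> e = g (iotaL a * iotaM b) 1.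
  move=> hs ->; rewrite hs (rmorph_sum g) lend_sumE; apply: eq_bigr => t _.
  by rewrite (rmorphM g) lendME -iLE -iME evL evM lend_funZ epE /= mulr1.
by move=> [s hs hc] [s' hs' hc']; rewrite (ev _ _ hs hc) (ev _ _ hs' hc').
Qed.

(** Once a value is exhibited, uniqueness forces the choice made by [xget], and its default 0 cannot
    intervene. *)
Lemma REaction_eq (a b c : MR) : is_action a b c -> REaction a b = c.
Proof.
move=> h; rewrite /REaction; case: xgetP => [x _ hx|/(_ c)]; last by case.
exact: action_unique hx h.
Qed.

End Uniqueness.

(** * Antisymmetrizers and the trace of C *)

Section Antisym.
Variables (B : pzRingType) (r : nat -> B) (c : B).

(* asym k = \sum_(w in S_k) (- c)^(length w) T_w, factored through the coset
   representatives xsum k = 1 - c r_(k-1) + c^2 r_(k-1) r_(k-2) - ... *)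
Fixpoint xsum k := if k is j.+1 then 1 - c * (r j * xsum j) else 1.
Fixpoint asym k := if k is j.+1 then asym j * xsum j else 1.
Fixpoint ssum k := if k is j.+1 then 1 + c * c * ssum j else 1.

Hypothesis c_central : forall x, c * x = x * c.
Variable m : nat.
Hypothesis hecke : forall i, (i < m)%N -> (1 - c * r i) * r i = - c * (1 - c * r i).
Hypothesis braid : forall i, (i.+1 < m)%N ->
  r i * r i.+1 * r i = r i.+1 * r i * r i.+1.
Hypothesis far : forall i j, (i.+1 < j)%N -> (j < m)%N -> r i * r j = r j * r i.

Lemma xsum_far k j : (k < j < m)%N -> xsum k * r j = r j * xsum k.
Proof.
elim: k => [|k IH] /andP[hk hj] /=; first by rewrite mul1r mulr1.
rewrite mulrBl mulrBr mul1r mulr1; congr (_ - _).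
rewrite -!mulrA IH ?hj ?andbT ?(ltnW hk) // [r k * (r j * _)]mulrA (far hk hj).
by rewrite !mulrA c_central.
Qed.

(** The coset factor extends antisymmetry by one generator. For the last generator, [xsum] is
    expanded twice: the Hecke relation treats 1 - c r, the braid relation the remaining term. For a
    lower one, E times the last generator is still antisymmetric under the generators far from it,
    and the induction hypothesis applies to that product. *)
Lemma xsum_eigen k (E : B) : (k <= m)%N ->
  (forall j, (j.+1 < k)%N -> E * r j = - c * E) ->
  forall i, (i < k)%N -> E * xsum k * r i = - c * (E * xsum k).
Proof.
elim: k E => [//|k IH] E hkm hE i; rewrite ltnS leq_eqVlt => /orP[/eqP->|hi].
  case: k hkm hE {IH i} => [|k] hkm hE.
    by rewrite /= mulr1 -mulrA hecke // mulrA mulrN -c_central -mulNr -mulrA.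
  have Ek := hE k (ltnSn _).
  have xr : xsum k * r k.+1 = r k.+1 * xsum k by apply: xsum_far; rewrite ltnSn hkm.
  have b := braid hkm; have h := hecke hkm.
  set s := r k.+1 in xr b h *; set t := r k in Ek b *; set x := xsum k in xr *.
  have xE : xsum k.+2 = (1 - c * s) + c * c * (s * t * x).
    transitivity (1 - c * (s * (1 - c * (t * x)))); first by [].
    rewrite !mulrBr mulr1 opprB addrA addrAC; congr (_ + _).
    by rewrite !mulrA -[c * s * c]mulrA -[s * c]c_central !mulrA.
  rewrite xE; move: (1 - c * s) h => y h.
  rewrite -mulrA mulrDl h !mulrDr; congr (_ + _).
    by rewrite mulrA mulrN -c_central -mulNr -mulrA.
  transitivity (c * c * (E * t * (s * t * x))).
    transitivity (E * c * c * (s * t * (x * s))); first by rewrite !mulrA.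
    rewrite xr; transitivity (E * c * c * (s * t * s * x)); first by rewrite !mulrA.
    by rewrite -b -[E * c]c_central -[c * E * c]mulrA -[E * c]c_central !mulrA.
  rewrite Ek; transitivity (- (c * c * c * E * (s * t * x))).
    by rewrite !mulNr mulrN !mulrA.
  rewrite mulNr; congr (- _).
  transitivity (c * (E * c * c * (s * t * x))); last by rewrite !mulrA.
  by rewrite -[E * c]c_central -[c * E * c]mulrA -[E * c]c_central !mulrA.
have E' j : (j.+1 < k)%N -> E * r k * r j = - c * (E * r k).
  move=> hj; rewrite -mulrA -(far hj hkm) mulrA hE ?mulrA //; exact: ltnW.
have := IH (E * r k) (ltnW hkm) E' i hi.
rewrite -!mulrA => h.
rewrite /= mulrA mulrBr mulr1 mulrBl mulrBr hE // !mulNr; congr (- _ - _).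
rewrite [E * (c * _)]mulrA -c_central -!mulrA h.
by rewrite mulNr mulrN.
Qed.

Lemma asym_eigen k i : (k.-1 <= m)%N -> (i.+1 < k)%N -> asym k * r i = - c * asym k.
Proof.
elim: k i => [//|k IH] i hk hi /=; apply: xsum_eigen => // j hj.
by apply: IH => //; apply: leq_trans hk; rewrite leq_pred.
Qed.

(** A term of [xsum] with j generators carries the coefficient (-c)^j, and E turns the generators
    into another (-c)^j, so the term contributes c^(2j). *)
Lemma eigen_xsum k (E : B) : (forall j, (j < k)%N -> E * r j = - c * E) ->
  E * xsum k = ssum k * E.
Proof.
elim: k => [|k IH] hE /=; first by rewrite mulr1 mul1r.
rewrite mulrBr mulr1 mulrDl mul1r; congr (_ + _).
rewrite mulrA -c_central -!mulrA [E * (r k * _)]mulrA hE // -!mulrA.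
rewrite IH => [|j hj]; last by apply: hE; apply: ltnW.
by rewrite !mulNr mulrN opprK !mulrA.
Qed.

End Antisym.

Section TraceC.
Variables (F : fieldType) (N : nat) (q : F) (R Psi : tensOp F N 2).
Hypothesis q0 : q != 0.
Hypothesis hR : hecke_symmetry q R.
Hypothesis hPsi : skew_inverse R Psi.

Local Notation C := (Cmat Psi).
Local Notation scF := (idfun : {rmorphism F -> F}).
Local Notation r K := (Rleg R scF K).
Local Notation cM K := ((q^-1)%:M : tensOp F N K).

Lemma idfun_central (d x : F) : scF d * x = x * scF d.
Proof. exact: mulrC. Qed.

Lemma cM_central K x : cM K * x = x * cM K.
Proof. by have := sc_scalar_central idfun_central q^-1 x. Qed.

Lemma Rleg_hecke K i : (i.+1 < K)%N ->
  (1 - cM K * r K i) * r K i = - cM K * (1 - cM K * r K i).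
Proof.
move=> hi; have h := RlegK q0 hR scF K i; rewrite (RinvE q0 hR) // in h.
have h2 : r K i * r K i = 1 + (q - q^-1)%:M * r K i.
  by rewrite -h mulrBr -(sc_scalar_central idfun_central) subrK.
have cnu : cM K * (q - q^-1)%:M = 1 - cM K * cM K.
  by rewrite -!mulmxE -!scalar_mxM mulrBr mulVf // raddfB.
rewrite mulrBl mul1r -mulrA h2 mulrDr mulr1 [cM K * (_ * _)]mulrA cnu [(1 - _) * _]mulrBl mul1r.
rewrite opprD opprB addrCA [r K i + _]addrC subrK.
by rewrite mulrBr mulr1 mulNr opprK mulrA.
Qed.

Definition antisym K k := asym (r K) (cM K) k.

Lemma antisym_eigen K k i : (k <= K)%N -> (i.+1 < k)%N ->
  antisym K k * r K i = - cM K * antisym K k.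
Proof.
move=> hk hi; apply: (@asym_eigen _ _ _ _ K.-1) => //.
- exact: cM_central.
- by move=> j hj; apply: Rleg_hecke; case: (K) hj.
- by move=> j hj; apply: (Rleg_braid hR); case: (K) hj.
- by move=> j l hj hl; apply: Rleg_far => //; case: (K) hl.
- by case: (k) (K) hk => [|?] [|?].
Qed.

Lemma widen_xsum K k : (k < K)%N ->
  widen_op (xsum (r K) (cM K) k) = xsum (r K.+1) (cM K.+1) k.
Proof.
elim: k => [|k IH] hk /=; first exact: widen1.
by rewrite widen_opB !widenM widen1 widen_scalar widen_Rleg // IH // ltnW.
Qed.

Lemma widen_antisym K k : (k <= K)%N -> widen_op (antisym K k) = antisym K.+1 k.
Proof.
rewrite /antisym; elim: k => [|k IH] hk /=; first exact: widen1.
by rewrite widenM IH ?widen_xsum // ltnW.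
Qed.

(** The sum 1 + q^-2 + ... + q^(-2k) has k+1 terms; multiplied by q^-1 it becomes q^-(k+1)
    (k+1)_q. *)
Fixpoint qsum k : F := if k is j.+1 then 1 + q^-1 * q^-1 * qsum j else 1.

Lemma ssumE K k : ssum (cM K) k = (qsum k)%:M.
Proof.
elim: k => //= k ->; rewrite raddfD /= -mulmxE !scalar_mxM mulmxE.
by [].
Qed.

(** The last coset factor contains the generator of the last two factors only once, so its R-trace
    is Tr C - q^-1 [xsum]; the smaller antisymmetrizer absorbs [xsum] on its right as the number
    [qsum k]. *)
Lemma ptC_antisym k : ptC Psi scF (antisym k.+2 k.+2) =
  (\tr C - q^-1 * qsum k)%:M * antisym k.+1 k.+1.
Proof.
have -> : antisym k.+2 k.+2 = widen_op (antisym k.+1 k.+1) *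
    (1 - widen_op (cM k.+1) * (r k.+2 k * widen_op (xsum (r k.+1) (cM k.+1) k))).
  by rewrite widen_antisym // widen_scalar widen_xsum.
rewrite (ptC_mull _ idfun_central) ptCB ptC_1 (ptC_mull _ idfun_central) ptC_mulr (ptC_Rleg hPsi) mul1r.
have eig j : (j < k)%N -> antisym k.+1 k.+1 * r k.+1 j = - cM k.+1 * antisym k.+1 k.+1.
  by move=> hj; apply: antisym_eigen.
move: (antisym k.+1 k.+1) eig => a eig.
rewrite mulrBr (sc_scalar_central idfun_central) [a * (_ * _)]mulrA -cM_central -mulrA.
rewrite (@eigen_xsum _ (r k.+1) (cM k.+1) (@cM_central k.+1)) //.
by rewrite ssumE raddfB /= mulrBl scalar_mxM mulmxE mulrA.
Qed.

Lemma qsumE k : q ^+ 2 != 1 -> q^-1 * qsum k = qnum q k.+1 / q ^+ k.+1.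
Proof.
move=> q2; rewrite /qnum.
have d0 : q - q^-1 != 0 by apply: subrV_neq0.
have q21 : q * q - 1 != 0 by rewrite subr_eq0 -expr2.
have h : q^-1 * qsum k = (1 - q ^- k.+1 * q ^- k.+1) / (q - q^-1).
  elim: k => [|k IH] /=; first by rewrite expr1; field; rewrite q0.
  rewrite exprS invfM; set p := q ^- k.+1 in IH *.
  have -> : qsum k = q * ((1 - p * p) / (q - q^-1)) by rewrite -IH mulrA mulfV // mul1r.
  by field; rewrite q0.
have qk : q ^+ k.+1 != 0 by rewrite expf_neq0.
rewrite h; set Q := q ^+ k.+1 in qk *.
by field; rewrite q0 qk.
Qed.

End TraceC.

Section Columns.
Variables (F : fieldType) (N : nat).
Local Notation colT K := ('cV[F]_#|{ffun 'I_K -> 'I_N}|).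

Definition vE K (v : colT K) (a : mindex N K) : F := v (enum_rank a) 0.

Lemma vE_ext K (v w : colT K) : vE v =1 vE w -> v = w.
Proof.
move=> h; apply/matrixP => i j; rewrite (ord1 j).
by have := h (enum_val i); rewrite /vE enum_valK.
Qed.

Lemma vE_mul K (X : tensOp F N K) v a : vE (X *m v) a = \sum_c opE X a c * vE v c.
Proof.
rewrite /vE /opE mxE (reindex (@enum_rank (mindex N K))) //=.
by apply: onW_bij; apply: enum_rank_bij.
Qed.

Lemma vE_leg_adj K i (h : (i + 2 <= K)%N) (S : tensOp F N 2) v a :
  vE (leg_adj K i S *m v) a =
  \sum_c opE S (idx_pull (block_ord h) a) c * vE v (idx_upd (block_ord h) a c).
Proof.
have inj := @block_ord_inj 2 K i h.
rewrite (leg_adjE h) vE_mul (bigID (agree_off (block_ord h) a)) /= [X in _ + X]big1 ?addr0; last first.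
  by move=> c /negbTE hc; rewrite opE_emb hc mul0r.
rewrite (sum_agree inj); apply: eq_bigr => c _.
by rewrite opE_emb agree_upd ?idx_pull_upd.
Qed.

End Columns.

Lemma scale_eq0 (F : fieldType) (V : lmodType F) (c : F) (x : V) :
  c != 0 -> c *: x = 0 -> x = 0.
Proof. by move=> c0 E; rewrite -[x]scale1r -(mulVf c0) -scalerA E scaler0. Qed.

(** * Antisymmetrizers and the R-skew-symmetric algebra *)

Section Lambda.
Variables (F : fieldType) (N : nat) (q : F) (R : tensOp F N 2).
Hypothesis q0 : q != 0.
Hypothesis hR : hecke_symmetry q R.
Hypothesis hq : forall k, (1 < k)%N -> q ^+ k != 1.

Local Notation rels := (skew_rels q R).
Local Notation Lam := (Lambda q R).
Local Notation FA := (freeAlg F 'I_N).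
Local Notation g := (pgen rels).
Local Notation S := ((q^-1)%:M + R).
Local Notation colT K := ('cV[F]_#|{ffun 'I_K -> 'I_N}|).
Local Notation scF := (idfun : {rmorphism F -> F}).

Lemma skew_rel (d : mindex N 2) : \sum_c opE S c d *: (g (c ord0) * g (c ord_max)) = 0 :> Lam.
Proof.
pose v : colT 2 := delta_mx (enum_rank d) 0.
have hv : rels (tensor2 (S *m v)) by exists v.
rewrite -[RHS](ppi_rel hv) /tensor2 raddf_sum; apply: eq_bigr => c _ /=.
rewrite ppiZE rmorphM; congr (_ *: _).
rewrite mxE (bigD1 (enum_rank d)) //= big1 ?addr0 => [|j jd]; last first.
  by rewrite [X in _ * X]mxE (negbTE jd) mulr0.
by rewrite [X in _ * X]mxE !eqxx mulr1.
Qed.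

Definition lword K (a : mindex N K) : Lam := \prod_(i < K) g (a i).

(** x and y are the parts of the word before and after the two letters. As they do not depend on c,
    a relation among pairs of letters can be applied inside the word. *)
Lemma lword_upd K i (h : (i + 2 <= K)%N) (b : mindex N K) :
  exists x y : Lam, forall c, lword (idx_upd (block_ord h) b c) = x * (g (c ord0) * g (c ord_max)) * y.
Proof.
have [m Km] : exists m, K = (i + (2 + m))%N by exists (K - (i + 2))%N; rewrite addnA subnKC.
subst K; have inj := @block_ord_inj 2 _ i h.
exists (\prod_(j < i) g (b (lshift _ j))), (\prod_(j < m) g (b (rshift i (rshift 2 j)))) => c.
rewrite /lword big_split_ord /= -mulrA; congr (_ * _).
  apply: eq_bigr => j _; congr (g _); rewrite idx_upd_out //; apply/negP => /codomP[l] /(congr1 val) /= E.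
  by have := ltn_ord j; rewrite E ltnNge leq_addr.
rewrite big_split_ord /=; congr (_ * _).
  rewrite big_ord_recl big_ord1; congr (g _ * g _).
    by rewrite -[RHS](idx_upd_in inj b); congr (idx_upd _ _ _ _); apply: val_inj.
  by rewrite -[RHS](idx_upd_in inj b); congr (idx_upd _ _ _ _); apply: val_inj.
apply: eq_bigr => j _; congr (g _); rewrite idx_upd_out //; apply/negP => /codomP[l] /(congr1 val) /= /addnI E.
by have := ltn_ord l; rewrite -E ltnNge leq_addr.
Qed.

(** The canonical map from the K-th tensor power onto the degree K component of Lambda_R(V). *)
Definition lphi K (v : colT K) : Lam := \sum_a vE v a *: lword a.

Lemma lphi_lin K c (v w : colT K) : lphi (c *: v + w) = c *: lphi v + lphi w.
Proof.
rewrite /lphi scaler_sumr -big_split; apply: eq_bigr => a _.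
by rewrite /vE !mxE scalerDl scalerA.
Qed.

Lemma lphi0 K : lphi (0 : colT K) = 0.
Proof. by apply: big1 => a _; rewrite /vE mxE scale0r. Qed.

Lemma lphi_rel K i v : (i.+1 < K)%N -> lphi (leg_adj K i S *m v) = 0.
Proof.
move=> hi; have h : (i + 2 <= K)%N by rewrite addn2.
have inj := @block_ord_inj 2 K i h.
set e := block_ord h.
transitivity (\sum_(p : mindex N K * mindex N 2)
   (opE S (idx_pull e p.1) p.2 * vE v (idx_upd e p.1 p.2)) *: lword p.1).
  rewrite -(pair_bigA _ (fun a c => (opE S (idx_pull e a) c * vE v (idx_upd e a c)) *: lword a)) /=.
  by apply: eq_bigr => a _; rewrite (vE_leg_adj h) scaler_suml.
(* Exchange the two letters of the word with the summation index of the matrix product. After this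
   involution the sum runs down a column of S, as [skew_rel] requires. *)
pose f (p : mindex N K * mindex N 2) := (idx_upd e p.1 p.2, idx_pull e p.1).
have u1 b c : idx_pull e (idx_upd e b c) = c by apply: idx_pull_upd.
have u2 b c : idx_upd e (idx_upd e b c) (idx_pull e b) = b.
  by rewrite agree_updE // agree_sym agree_upd.
have fK : involutive f by move=> [a c]; rewrite /f /= u1 u2.
rewrite (reindex_inj (inv_inj fK)) /=.
rewrite -(pair_bigA _ (fun b c' => (opE S (idx_pull e (idx_upd e b c')) (idx_pull e b) *
   vE v (idx_upd e (idx_upd e b c') (idx_pull e b))) *: lword (idx_upd e b c'))) /=.
apply: big1 => b _; have [x [y xy]] := lword_upd h b.
transitivity (vE v b *: (x * (\sum_c opE S c (idx_pull e b) *: (g (c ord0) * g (c ord_max))) * y)).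
  rewrite mulr_sumr mulr_suml scaler_sumr; apply: eq_bigr => c _.
  rewrite u1 u2 xy mulrC -scalerA -palg_scalerAr -palg_scalerAl.
  by [].
by rewrite skew_rel mulr0 mul0r scaler0.
Qed.

Local Notation r K := (Rleg R scF K).
Local Notation cM K := ((q^-1)%:M : tensOp F N K).

Lemma RlegE K i : r K i = leg_adj K i R.
Proof. by apply/matrixP => a b; rewrite mxE. Qed.

Lemma leg_adj_S K i : (i.+1 < K)%N -> leg_adj K i S = cM K + r K i.
Proof.
move=> hi; have h : (i + 2 <= K)%N by rewrite addn2.
by rewrite RlegE !(leg_adjE h) embD emb_scalar //; apply: block_ord_inj.
Qed.

Lemma lphi_R K i v : (i.+1 < K)%N -> lphi (r K i *m v) = - q^-1 *: lphi v.
Proof.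
move=> hi; have := lphi_rel v hi; rewrite leg_adj_S // mulmxDl mul_scalar_mx lphi_lin.
by move/eqP; rewrite addrC addr_eq0 => /eqP ->; rewrite scaleNr.
Qed.

Lemma lphi_xsum K k v : (k < K)%N -> lphi (xsum (r K) (cM K) k *m v) = qsum q k *: lphi v.
Proof.
elim: k => [|k IH] hk /=; first by rewrite mul1mx scale1r.
rewrite mulmxBl mul1mx -mulmxE -mulmxA mul_scalar_mx -mulmxA -scaleNr addrC lphi_lin.
by rewrite lphi_R // IH ?(ltnW hk) // !scalerA mulrNN scalerDl scale1r addrC.
Qed.

(** A zero would force q^(2k+2) = 1, against the genericity of q. *)
Lemma qsum_neq0 k : qsum q k != 0.
Proof.
have q2 : q ^+ 2 != 1 by apply: hq.
have E := qsumE q0 k q2; apply/eqP => h; move/eqP: E; rewrite h mulr0 eq_sym /qnum.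
have d0 : q - q^-1 != 0 by apply: subrV_neq0.
have qk : q ^+ k.+1 != 0 by rewrite expf_neq0.
rewrite !mulf_eq0 !invr_eq0 (negbTE d0) (negbTE qk) !orbF subr_eq0 => /eqP h'.
have := hq (k := k.+1 + k.+1); rewrite exprD [X in X * _]h' mulVf // eqxx.
by rewrite addSn addnS => /(_ isT).
Qed.

(** In Lambda_R(V) each R_i acts as -q^-1, so every coset factor becomes a number. The product is a
    q-factorial up to a power of q; being nonzero, it prevents A_K from vanishing when the degree K
    component does not. *)
Lemma lphi_antisym K k (v : colT K) : (k <= K)%N ->
  lphi (antisym q R K k *m v) = (\prod_(j < k) qsum q j) *: lphi v.
Proof.
elim: k v => [|k IH] v hk.
  by rewrite big_ord0 scale1r [antisym _ _ _ _ *m v]mul1mx.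
have -> : antisym q R K k.+1 *m v = antisym q R K k *m (xsum (r K) (cM K) k *m v).
  by rewrite mulmxA.
rewrite IH; last exact: ltnW.
by rewrite lphi_xsum ?scalerA ?big_ord_recr.
Qed.

Lemma Lambda_degE K x : @Lambda_deg F N q R K x <-> exists v : colT K, x = lphi v.
Proof.
split=> [[c ->]|[v ->]]; last by exists (vE v).
exists (\col_i c (enum_val i)); rewrite /lphi; apply: eq_bigr => a _.
by rewrite /vE mxE enum_rankK.
Qed.

Lemma antisym_neq0 K (x : Lam) : @Lambda_deg F N q R K x -> x <> 0 -> antisym q R K K <> 0.
Proof.
move=> h x0 h0; apply: x0; have [v ->] := (@Lambda_degE K x).1 h.
have c0 : \prod_(j < K) qsum q j != 0 by apply/prodf_neq0 => j _; apply: qsum_neq0.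
have := lphi_antisym v (leqnn K); rewrite h0 mul0mx lphi0 => E.
by apply: (scale_eq0 c0); rewrite -E.
Qed.

End Lambda.

(** Reduces two-sided multiples of a relation by arbitrary polynomials to multiples by words. *)
Lemma bilinear_span (F : pzRingType) (A : pzRingType) (sc : F -> A) (Z : A -> Prop) :
  (forall c x, sc c * x = x * sc c) ->
  Z 0 -> (forall x y, Z x -> Z y -> Z (x + y)) -> (forall c x, Z x -> Z (sc c * x)) ->
  forall (T : Type) (s s' : seq T) (c c' : T -> F) (X : T -> A) (rel : A),
  (forall m m', Z (X m * rel * X m')) ->
  Z ((\sum_(m <- s) sc (c m) * X m) * rel * (\sum_(m <- s') sc (c' m) * X m)).
Proof.
move=> scC Z0 ZD Zsc T s s' c c' X rel h.
rewrite !mulr_suml; apply: (big_ind Z) => // m _; rewrite mulr_sumr.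
apply: (big_ind Z) => // m' _; rewrite mulrA -[_ * rel * sc _]scC -!mulrA.
by apply: (Zsc); apply: (Zsc); rewrite mulrA.
Qed.

(** * Homogeneous components of the free algebra *)

Section Coefficients.
Variables (F : fieldType) (N : nat).
Local Notation FA := (freeAlg F 'I_N).
Local Notation colT K := ('cV[F]_#|{ffun 'I_K -> 'I_N}|).

Definition idx_word K (a : mindex N K) : seq 'I_N := [seq a j | j <- enum 'I_K].

Lemma size_idx_word K (a : mindex N K) : size (idx_word a) = K.
Proof. by rewrite size_map size_enum_ord. Qed.

Lemma nth_idx_word K (a : mindex N K) x0 (j : 'I_K) : nth x0 (idx_word a) j = a j.
Proof. by rewrite (nth_map j) ?size_enum_ord // nth_ord_enum. Qed.

Lemma idx_word_inj K : injective (@idx_word K).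
Proof.
move=> a b E; apply/ffunP => j.
by rewrite -(nth_idx_word a (a j)) -(nth_idx_word b (a j)) E.
Qed.

Definition mon (s : seq 'I_N) : FA := mkmalgU (FMonom s) 1.

Lemma monE s : mon s = \prod_(x <- s) freeGen F x.
Proof. exact: freeMon. Qed.

Lemma mon_idx_word K (a : mindex N K) : mon (idx_word a) = \prod_(j < K) freeGen F (a j).
Proof. by rewrite monE big_map enumT [index_enum _]unlock. Qed.

(** The degree K component of a noncommutative polynomial, as a vector of the K-th tensor power. *)
Definition coefs K (x : FA) : colT K := \col_i mcoeff (FMonom (idx_word (enum_val i))) x.

Lemma vE_coefs K x a : vE (coefs K x) a = mcoeff (FMonom (idx_word a)) x.
Proof. by rewrite /vE mxE enum_rankK. Qed.

Lemma coefs_mon s t : mcoeff (FMonom t) (mon s) = (s == t)%:R :> F.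
Proof. by rewrite mcoeffU. Qed.

Lemma coefs0 K : coefs K 0 = 0.
Proof. by apply/matrixP => i j; rewrite !mxE mcoeff0. Qed.

Lemma coefsD K x y : coefs K (x + y) = coefs K x + coefs K y.
Proof. by apply/matrixP => i j; rewrite !mxE mcoeffD. Qed.

Lemma coefsZ K c x : coefs K (c *: x) = c *: coefs K x.
Proof. by apply/matrixP => i j; rewrite !mxE mcoeffZ. Qed.

Lemma coefs_sum K (I : finType) (f : I -> FA) : coefs K (\sum_i f i) = \sum_i coefs K (f i).
Proof. exact: (big_morph _ (@coefsD K) (coefs0 K)). Qed.

Lemma coefs_lin K (v : colT K) : coefs K (\sum_a vE v a *: mon (idx_word a)) = v.
Proof.
apply: vE_ext => b; rewrite coefs_sum /vE summxE -[RHS](sum_deltar (vE v)).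
apply: eq_bigr => a _; rewrite coefsZ mxE -[coefs _ _ _ _]/(vE _ b) vE_coefs coefs_mon.
by rewrite (inj_eq (@idx_word_inj K)).
Qed.

Lemma free_expand (x : FA) : x = \sum_(s <- map (@fmonom_val _) (msupp x)) (mcoeff (FMonom s) x)%:A * mon s.
Proof.
rewrite big_map {1}(monalgE x); apply: eq_bigr => m _.
rewrite free_scaleE /mon; case: m => s.
by rewrite -[RHS]mul_malgC malgM_def fgmulUU mulr1 mul1m.
Qed.

Lemma coefs_rel K (s s' : seq 'I_N) (i := size s) (z : colT 2) (a : mindex N K) :
  vE (coefs K (mon s * tensor2 z * mon s')) a =
  \sum_b vE z b * (s ++ b ord0 :: b ord_max :: s' == idx_word a)%:R.
Proof.
rewrite vE_coefs.
have -> : mon s * tensor2 z * mon s' = \sum_b vE z b *: mon (s ++ b ord0 :: b ord_max :: s').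
  have E b : mon (s ++ b ord0 :: b ord_max :: s') =
      mon s * (freeGen F (b ord0) * freeGen F (b ord_max)) * mon s'.
    by rewrite !monE big_cat !big_cons /= !mulrA.
  rewrite /tensor2 mulr_sumr mulr_suml; apply: eq_bigr => b _.
  by rewrite E free_scalerAr -scalerAl.
rewrite raddf_sum; apply: eq_bigr => b _.
by rewrite /= mcoeffZ coefs_mon.
Qed.

End Coefficients.

Section Vanishing.
Variables (F : fieldType) (N : nat).
Local Notation FA := (freeAlg F 'I_N).
Local Notation colT K := ('cV[F]_#|{ffun 'I_K -> 'I_N}|).

(** [A0] has the arbitrary letter x0 in the two places that [agree_off] does not inspect. The
    equivalence separates the condition on s and s' from the one on the two letters where R acts. *)
Lemma word_eq K (s s' : seq 'I_N) (h : (size s + 2 <= K)%N) x0 (a : mindex N K) (b : mindex N 2)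
    (A0 := [ffun j : 'I_K => nth x0 (s ++ x0 :: x0 :: s') j]) :
  (size s + (2 + size s') = K)%N ->
  (s ++ b ord0 :: b ord_max :: s' == idx_word a) =
  agree_off (block_ord h) A0 a && (b == idx_pull (block_ord h) a).
Proof.
move=> hK; have inj := @block_ord_inj 2 K _ h.
have -> : s ++ b ord0 :: b ord_max :: s' = idx_word (idx_upd (block_ord h) A0 b).
  have hsz : size (s ++ b ord0 :: b ord_max :: s') = K by rewrite size_cat -hK.
  apply: (@eq_from_nth _ x0); first by rewrite hsz size_idx_word.
  rewrite hsz => j hj.
  rewrite (nth_idx_word _ x0 (Ordinal hj)).
  have E0 : block_ord h ord0 = size s :> nat by rewrite /= addn0.
  have E1 : block_ord h ord_max = (size s).+1 :> nat by rewrite /= addn1.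
  rewrite nth_cat; have [js|js] := ltnP j (size s).
    rewrite idx_upd_out; first by rewrite ffunE /= nth_cat js.
    by apply/negP => /codomP[l] /(congr1 val) /= E; move: js; rewrite E ltnNge leq_addr.
  move: js; rewrite leq_eqVlt => /orP[/eqP js|js].
    have -> : (j - size s = 0)%N by rewrite -js subnn.
    have -> : Ordinal hj = block_ord h ord0 by apply: val_inj; rewrite /= addn0 js.
    by rewrite idx_upd_in.
  move: js; rewrite leq_eqVlt => /orP[/eqP js|js].
    have -> : (j - size s = 1)%N by rewrite -js subSnn.
    have -> : Ordinal hj = block_ord h ord_max by apply: val_inj; rewrite /= addn1 js.
    by rewrite idx_upd_in.
  have hs : (size s <= j)%N by apply: ltnW; apply: ltnW.
  rewrite idx_upd_out.
    rewrite ffunE /= nth_cat ltnNge hs /=.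
    have : (1 < j - size s)%N by rewrite ltn_subRL addn1.
    by case: (j - size s)%N => [|[|l]].
  apply/negP => /codomP[l] /(congr1 val) /= E; move: js; rewrite E.
  by rewrite -[(size s).+1]addn1 ltn_add2l; case: (l) => [[|[|]]].
rewrite (inj_eq (@idx_word_inj N K)).
apply/eqP/andP => [<-|[hag /eqP ->]]; last exact: agree_updE.
by rewrite idx_pull_upd // agree_upd.
Qed.

Lemma coefs_rel_mul K (s s' : seq 'I_N) (S : tensOp F N 2) (v : colT 2) :
  (size s + (2 + size s') = K)%N ->
  coefs K (mon F s * tensor2 (S *m v) * mon F s') =
  leg_adj K (size s) S *m coefs K (mon F s * tensor2 v * mon F s').
Proof.
move=> hK; have h : (size s + 2 <= K)%N by rewrite -hK addnA leq_addr.
have inj := @block_ord_inj 2 K _ h.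
apply: vE_ext => a; rewrite coefs_rel (vE_leg_adj h).
pose x0 := a (block_ord h ord0).
set A0 := [ffun j : 'I_K => nth x0 (s ++ x0 :: x0 :: s') j].
transitivity ((agree_off (block_ord h) A0 a)%:R *
    \sum_c opE S (idx_pull (block_ord h) a) c * vE v c).
  under eq_bigr => b _ do rewrite (word_eq h x0) // -mulnb natrM mulrA.
  by rewrite sum_deltar vE_mul mulrC.
rewrite mulr_sumr; apply: eq_bigr => c _; rewrite coefs_rel.
under eq_bigr => b _ do rewrite (word_eq h x0) // -mulnb natrM mulrA.
have -> : agree_off (block_ord h) A0 (idx_upd (block_ord h) a c) = agree_off (block_ord h) A0 a.
  by rewrite agree_sym idx_agree_updl agree_sym.
by rewrite sum_deltar idx_pull_upd // mulrC mulrA.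
Qed.

Lemma coefs_rel_size K (s s' : seq 'I_N) (v : colT 2) :
  (size s + (2 + size s') != K)%N -> coefs K (mon F s * tensor2 v * mon F s') = 0.
Proof.
move=> hK; apply: vE_ext => a; rewrite coefs_rel /vE mxE big1 // => b _.
case: eqP => [E|]; rewrite ?mulr0 //.
by case/eqP: hK; rewrite -(size_idx_word a) -E size_cat.
Qed.

Variables (q : F) (R : tensOp F N 2).
Hypothesis q0 : q != 0.
Hypothesis hR : hecke_symmetry q R.
Local Notation S := ((q^-1)%:M + R).
Local Notation rels := (skew_rels q R).

Lemma antisym_S K i : (i.+1 < K)%N -> antisym q R K K *m leg_adj K i S = 0.
Proof.
move=> hi; rewrite leg_adj_S // mulmxDr.
have := antisym_eigen q0 hR (leqnn K) hi; rewrite -!mulmxE => ->.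
have := cM_central q (antisym q R K K); rewrite -!mulmxE => E.
by rewrite mulNmx E subrr.
Qed.

(** The degree K component of a relation between two words is either zero or in the image of some
    q^-1 + R_i, which A_K kills from the left. Expanding the multipliers into words gives the whole
    ideal. *)
Lemma antisym_ideal K x : in_ideal rels x -> antisym q R K K *m coefs K x = 0.
Proof.
move=> [l [hl ->]]; pose Z x := antisym q R K K *m coefs K x = 0.
have Z0 : Z 0 by rewrite /Z coefs0 mulmx0.
have ZD x1 y1 : Z x1 -> Z y1 -> Z (x1 + y1).
  by rewrite /Z coefsD mulmxDr => -> ->; rewrite addr0.
have Zsc c x1 : Z x1 -> Z (c%:A * x1).
  by rewrite /Z free_scaleE coefsZ -scalemxAr => ->; rewrite scaler0.
have Zrel s s' e : rels e -> Z (mon F s * e * mon F s').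
  move=> [v ->]; rewrite /Z; have [hK|hK] := eqVneq (size s + (2 + size s'))%N K.
    rewrite coefs_rel_mul // mulmxA antisym_S ?mul0mx //.
    by rewrite -hK -[(size s).+1]addn1 ltn_add2l.
  by rewrite coefs_rel_size // mulmx0.
elim: l hl => [|t l IH] hl; first by rewrite big_nil.
rewrite big_cons; apply: (ZD); last by apply: IH => u hu; apply: hl; rewrite inE hu orbT.
rewrite (free_expand t.1.1) (free_expand t.2).
apply: (bilinear_span (@free_scale_central F _) Z0 ZD Zsc) => s s'.
by apply: Zrel; apply: hl; rewrite inE eqxx.
Qed.

Lemma antisym_eq0 K : (forall x : Lambda q R, @Lambda_deg F N q R K x -> x = 0) ->
  antisym q R K K = 0.
Proof.
move=> h.
have key (v : colT K) : antisym q R K K *m v = 0.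
  rewrite -[v]coefs_lin; apply: antisym_ideal.
  have := h (lphi q R v) ((Lambda_degE _ _).2 (ex_intro _ v erefl)).
  have -> : lphi q R v = ppi rels (\sum_a vE v a *: mon F (idx_word a)).
    rewrite raddf_sum; apply: eq_bigr => a _; rewrite /= ppiZE mon_idx_word rmorph_prod.
    by [].
  rewrite -[X in _ = X](rmorph0 (ppi rels)) => /ppi_eqP; rewrite subr0.
  by [].
apply/matrixP => i j; have := congr1 (fun X : colT K => X i 0) (key (delta_mx j 0)).
rewrite /= !mxE (bigD1 j) //= big1 ?addr0 => [|l lj]; last by rewrite !mxE (negbTE lj) mulr0.
by rewrite !mxE !eqxx mulr1.
Qed.

End Vanishing.

Section TraceOfC.
Variables (F : fieldType) (N : nat) (q : F) (R Psi : tensOp F N 2).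

Lemma trace_C : generic q -> GL_type q R N -> skew_inverse R Psi ->
  \tr (Cmat Psi) = qnum q N / q ^+ N.
Proof.
move=> [q0 _ _ hq] [hR _ [p [pm ps hp]]] hPsi.
(* For N = 0 both sides vanish. The recursion [ptC_antisym] ends at one factor or more, and so
   serves N = n+1. *)
case: N R Psi hR hPsi hp ps => [|n] R' Psi' hR hPsi hp ps.
  by rewrite /mxtrace big_ord0 /qnum expr0 invr1 subrr mul0r mul0r.
have q2 : q ^+ 2 != 1 by apply: hq.
rewrite -(qsumE q0 n q2).
have A0 : antisym q R' n.+2 n.+2 = 0.
  apply: (antisym_eq0 q0 hR) => x hx; have [d [f [_ hf]] pd] := hp n.+2.
  move: pd; rewrite nth_default ?ps // => pd.
  have d0 : d = 0%N by apply/eqP; rewrite -(pnatr_eq0 int) -pd.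
  subst d; have [v ->] := (hf x).1 hx.
  have -> : v = 0 by apply/matrixP => i [].
  exact: raddf0.
have A1 : antisym q R' n.+1 n.+1 <> 0.
  have [d [f [finj hf]] pd] := hp n.+1.
  have d1 : d = 1%N.
    by apply/eqP; rewrite -(pnatr_eq1 int) -pd; move: pm; rewrite monicE lead_coefE ps.
  subst d.
  apply: (antisym_neq0 q0 hq (x := f (const_mx 1))).
    by apply/hf; exists (const_mx 1).
  rewrite -(raddf0 f) => /finj /matrixP/(_ 0 0); rewrite !mxE => /eqP.
  by rewrite oner_eq0.
have := ptC_antisym q0 hR hPsi n; rewrite A0.
have -> : ptC Psi' (idfun : {rmorphism F -> F}) 0 = 0 :> tensOp F n.+1 n.+1.
  by rewrite -(subrr (0 : tensOp F n.+1 n.+2)) ptCB subrr.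
rewrite -mulmxE mul_scalar_mx => E; apply/eqP; rewrite -subr_eq0; apply/eqP.
have [//|nz] := eqVneq (\tr (Cmat Psi') - q^-1 * qsum q n) 0.
by case: A1; apply: (scale_eq0 nz); rewrite -E.
Qed.

End TraceOfC.

(** * The Casimir eigenvalue *)

Section RelationImages.
Variables (A B : pzRingType) (g : {rmorphism A -> B}).

Lemma rmorph_braid a b : g (a * b * a - b * a * b) = g a * g b * g a - g b * g a * g b.
Proof. by rewrite rmorphB !rmorphM. Qed.

Lemma rmorph_comm a b : g (a * b - b * a) = g a * g b - g b * g a.
Proof. by rewrite rmorphB !rmorphM. Qed.

Lemma rmorph_hecke a b c : g ((a - b) * (c + b)) = (g a - g b) * (g c + g b).
Proof. by rewrite rmorphM rmorphB rmorphD. Qed.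

End RelationImages.

Section Representation.
Variables (F : fieldType) (N : nat) (q : F) (R : tensOp F N 2) (k : nat).
Hypothesis q0 : q != 0.
Hypothesis hR : hecke_symmetry q R.
Local Notation scF := (idfun : {rmorphism F -> F}).
Local Notation r := (Rleg R scF k).
Local Notation s := (Rinv R scF k).
Local Notation fR := (fun j : 'I_k.-1 => leg_adj k j R).

Lemma scalar_central (c : F) (X : tensOp F N k) : c%:M * X = X * c%:M.
Proof. by rewrite -!mulmxE scalar_mxC. Qed.

Let scM : {rmorphism F -> tensOp F N k} := @scalar_mx F _.

Lemma hecke_rels_rho x : hecke_rels q x -> freeEval scM fR x = 0.
Proof.
have hk (j : 'I_k.-1) : (j.+1 < k)%N by rewrite -ltn_predRL.
have [g gE] := freeEval_rmorphism fR (sc := scM) scalar_central.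
have gen j : g (freeGen F j) = r j by rewrite gE freeEval_gen RlegE.
have gZ c y : g (c *: y) = scM c * g y by rewrite !gE freeEvalZ.
have g1 c : g (c *: 1) = scM c by rewrite gZ rmorph1 mulr1.
rewrite -gE => -[[i [j [ij ->]]]|[i [j [ij ->]]]|[i ->]].
- etransitivity; first exact: rmorph_braid.
  rewrite !gen ij (Rleg_braid hR) ?subrr //.
  by rewrite -ij.
- etransitivity; first exact: rmorph_comm.
  rewrite !gen; case: ij => ij; first by rewrite Rleg_far ?subrr.
  by rewrite -Rleg_far ?subrr.
- etransitivity; first exact: rmorph_hecke.
  rewrite !g1 !gen.
  have [_ h] := hR; have := congr1 (leg_adj k i) h.
  have hi : (i + 2 <= k)%N by rewrite addn2.
  have inj := @block_ord_inj 2 k i hi.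
  rewrite !(leg_adjE hi) (embM inj) embB embD !emb_scalar // emb0.
  by rewrite RlegE (leg_adjE hi).
Qed.

Lemma rho_rmorphism : {g : {rmorphism heckeAlg q k -> tensOp F N k} |
  g =1 rho R & forall c x, g (c *: x) = c%:M * g x}.
Proof.
have [g gE] := plift_rmorphism (sc := scM) scalar_central hecke_rels_rho.
exists g => // c x; rewrite !gE.
exact: (pliftZ (sc := scM) scalar_central hecke_rels_rho).
Qed.

Lemma rho_tau j : (j.+1 < k)%N -> rho R (tau q k j) = r j.
Proof.
move=> hj; have hj' : (j < k.-1)%N by rewrite ltn_predRL.
rewrite /tau (insubT (fun i => (i < k.-1)%N) hj') /rho.
by rewrite (plift_gen (sc := scM) scalar_central hecke_rels_rho) RlegE.
Qed.

Lemma rho_jm i : (i < k)%N -> rho R (jucys_murphy q k i) = jm r i.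
Proof.
have [g gE gZ] := rho_rmorphism; rewrite -gE.
elim: i => [|i IH] hi /=; first by rewrite rmorph1.
by rewrite !rmorphM IH ?(ltnW hi) // !gE rho_tau.
Qed.

(** The eigenvalue of J_i on P is inverted for J_i^-1. The inverse is formed only among matrices, so
    the eigenvalue equation is first carried there by [rho]. *)
Lemma rho_idempotent_jminv (P : heckeAlg q k) (c : int) (i : 'I_k) :
  P * jucys_murphy q k i = q ^ (2 * c) *: P ->
  rho R P * jminv s i = q ^ (-2 * c) *: rho R P.
Proof.
have [g gE gZ] := rho_rmorphism; rewrite -!gE => /(congr1 g).
rewrite rmorphM gZ [g (jucys_murphy _ _ _)]gE rho_jm // => h.
have u : jm r i * jminv s i = 1 by exact: (jmK (RlegK q0 hR scF k)).
have E : g P = q ^ (2 * c) *: (g P * jminv s i).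
  have := congr1 (fun X => X * jminv s i) h; rewrite -mulrA u mulr1 -mulrA => {1}->.
  by rewrite -[in LHS]mulmxE mul_scalar_mx.
rewrite [in RHS]E scalerA -expfzDr // mulNr addNr expr0z scale1r.
by [].
Qed.

End Representation.

Section Tableaux.
Variables (F : fieldType) (q : F) (k : nat) (lam : seq nat).

(** Both tableaux enumerate the boxes of the same diagram without repetition. *)
Lemma tableau_sum (V : nmodType) (f : nat * nat -> V) (T T' : 'I_k -> nat * nat) :
  standard_tableau lam T -> standard_tableau lam T' ->
  \sum_i f (T i) = \sum_i f (T' i).
Proof.
move=> [injT boxT _ _] [injT' boxT' _ _].
have E (U : 'I_k -> nat * nat) : \sum_i f (U i) = \sum_(b <- map U (enum 'I_k)) f b.
  by rewrite big_map big_enum.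
have uq (U : 'I_k -> nat * nat) : injective U -> uniq (map U (enum 'I_k)).
  by move=> hU; rewrite (map_inj_uniq hU); apply: enum_uniq.
rewrite !E; apply: perm_big; apply: uniq_perm; [exact: uq|exact: uq|] => b.
apply/mapP/mapP => -[i _ ->].
  by have [j <-] := (boxT' (T i)).1 ((boxT (T i)).2 (ex_intro _ i erefl)); exists j; first exact: mem_enum.
by have [j <-] := (boxT (T' i)).1 ((boxT' (T' i)).2 (ex_intro _ i erefl)); exists j; first exact: mem_enum.
Qed.

End Tableaux.

Section MapCopies.
Variables (F : fieldType) (N : nat) (R Psi : tensOp F N 2).
Variables (A B : pzRingType) (sc : {rmorphism F -> A}) (sc' : {rmorphism F -> B}).
Variable f : {rmorphism A -> B}.
Hypothesis scE : f \o sc =1 sc'.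

Lemma map_upcopy K (X : 'M[A]_N) i :
  map_mx f (upcopy (Rleg R sc K) (Rinv R sc K) (leg_at K 0 X) i) =
  upcopy (Rleg R sc' K) (Rinv R sc' K) (leg_at K 0 (map_mx f X)) i.
Proof.
elim: i => [|i IH] /=; first by rewrite leg_at_map.
by rewrite -!mulmxE !map_mxM IH !(map_sc scE).
Qed.

Lemma map_upcopies K (X : 'M[A]_N) n :
  map_mx f (\prod_(i < n) upcopy (Rleg R sc K) (Rinv R sc K) (leg_at K 0 X) i) =
  \prod_(i < n) upcopy (Rleg R sc' K) (Rinv R sc' K) (leg_at K 0 (map_mx f X)) i.
Proof.
elim: n => [|n IH]; first by rewrite !big_ord0 [LHS]map_mx1.
by rewrite !big_ord_recr /= -!mulmxE map_mxM IH map_upcopy.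
Qed.

Lemma map_jminv K i : map_mx f (jminv (Rinv R sc K) i) = jminv (Rinv R sc' K) i.
Proof.
elim: i => [|i IH] /=; first by rewrite [LHS]map_mx1.
by rewrite -!mulmxE !map_mxM IH !(map_sc scE).
Qed.

Lemma map_ptC k (Z : tensOp A N k.+1) :
  map_mx f (ptC Psi sc Z) = ptC Psi sc' (map_mx f Z).
Proof.
apply: opEP => a b; rewrite opE_map !opE_mkop rmorph_sum; apply: eq_bigr => c _.
by rewrite rmorph_sum; apply: eq_bigr => d _; rewrite rmorphM -scE opE_map.
Qed.

Lemma map_trR (X : 'M[A]_N) : f (trR sc Psi X) = trR sc' Psi (map_mx f X).
Proof. by rewrite /trR -trace_map_mx map_mxM (map_sc scE). Qed.

Lemma map_tr_sc n (G : 'M[F]_n) (X : 'M[A]_n) :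
  f (\tr (map_mx sc G *m X)) = \tr (map_mx sc' G *m map_mx f X).
Proof. by rewrite -trace_map_mx map_mxM (map_sc scE). Qed.

End MapCopies.

Lemma mul_tr_sc (F : fieldType) (A : pzRingType) (sc : {rmorphism F -> A}) n t
    (G : 'M[F]_n) (X : 'M[A]_n) : (forall c x, sc c * x = x * sc c) ->
  t * \tr (map_mx sc G *m X) = \tr (map_mx sc G *m (t%:M *m X)).
Proof.
move=> scC; rewrite /mxtrace mulr_sumr; apply: eq_bigr => i _.
rewrite !mxE mulr_sumr; apply: eq_bigr => j _.
by rewrite mul_scalar_mx !mxE !mulrA scC.
Qed.

(** * Computing the action by moving Tr_R L to the right *)

Section Existence.
Variables (F : fieldType) (N : nat) (q : F) (R Psi : tensOp F N 2).
Hypothesis q0 : q != 0.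
Hypothesis hR : hecke_symmetry q R.
Hypothesis hPsi : skew_inverse R Psi.
Local Notation D := (qdouble R).
Local Notation MR := (REalg R).
Local Notation dsc := (pcst (double_rels R)).
Local Notation msc := (pcst (RE_rels R)).

(* d is the ordered product of a tensor whose image under Id (x) counit is c *)
Definition evaluates (d : D) (c : MR) : Prop :=
  exists2 s : seq (MR * MR), d = \sum_(t <- s) iotaM t.1 * iotaL t.2 &
    c = \sum_(t <- s) counit t.2 *: t.1.

Lemma evaluates0 : evaluates 0 0.
Proof. by exists [::]; rewrite big_nil. Qed.

Lemma evaluatesD d d' c c' : evaluates d c -> evaluates d' c' -> evaluates (d + d') (c + c').
Proof.
by move=> [s -> ->] [s' -> ->]; exists (s ++ s'); rewrite big_cat.
Qed.

Lemma evaluates_sc x d c : evaluates d c -> evaluates (dsc x * d) (msc x * c).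
Proof.
move=> [s -> ->]; exists [seq (x *: t.1, t.2) | t <- s]; rewrite big_map mulr_sumr.
  apply: eq_bigr => t _; rewrite pcstE iotaMZ; exact: palg_scalerAl.
apply: eq_bigr => t _; rewrite pcstE scalerA [RHS]scalerA; congr (_ *: _).
exact: mulrC.
Qed.

Lemma evaluatesM m l : evaluates (iotaM m * iotaL l) (counit l *: m).
Proof. by exists [:: (m, l)]; rewrite big_seq1. Qed.

Lemma evaluates_sum (I : Type) (s : seq I) (P : pred I) (f : I -> D) (g : I -> MR) :
  (forall i, P i -> evaluates (f i) (g i)) ->
  evaluates (\sum_(i <- s | P i) f i) (\sum_(i <- s | P i) g i).
Proof.
by move=> h; apply: (big_ind2 evaluates) => //; [exact: evaluates0|move=> ? ? ? ?; exact: evaluatesD].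
Qed.

Definition evaluates_mx n (X : 'M[D]_n) (Y : 'M[MR]_n) := forall i j, evaluates (X i j) (Y i j).

Lemma evaluates_mx_sc n (G : 'M[F]_n) X Y : evaluates_mx X Y ->
  evaluates_mx (map_mx dsc G *m X) (map_mx msc G *m Y).
Proof.
move=> h i j; rewrite !mxE; apply: evaluates_sum => l _.
rewrite mxE [X in _ (X * _)]mxE; exact: evaluates_sc.
Qed.

Lemma evaluates_mx_tr n (X : 'M[D]_n) (Y : 'M[MR]_n) : evaluates_mx X Y ->
  evaluates (\tr X) (\tr Y).
Proof. by move=> h; apply: evaluates_sum => i _; apply: h. Qed.

Lemma evaluates_mx_ptC k (X : tensOp D N k.+1) (Y : tensOp MR N k.+1) :
  evaluates_mx X Y -> evaluates_mx (ptC Psi dsc X) (ptC Psi msc Y).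
Proof.
move=> h i j; rewrite !mxE; do 2 (apply: evaluates_sum => ? _).
by apply: evaluates_sc; apply: h.
Qed.

(** A product with M(R) on the left and L(R) on the right is already in normal order, so only the
    counit of its right factor has to be known. *)
Lemma map_counit (iM iL : {rmorphism MR -> D}) (ep : {rmorphism MR -> F}) n
    (X Y : 'M[MR]_n) : iM =1 @iotaM F N R -> iL =1 @iotaL F N R -> ep =1 @counit F N R ->
  map_mx ep Y = 1%:M -> evaluates_mx (map_mx iM X * map_mx iL Y) X.
Proof.
move=> iME iLE epE hY i j; rewrite -mulmxE mxE.
have -> : X i j = \sum_l counit (Y l j) *: X i l.
  rewrite (bigD1 j) //= big1 ?addr0 => [|l lj].
    have := congr1 (fun Z : 'M[F]_n => Z j j) hY; rewrite !mxE eqxx epE => ->.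
    by rewrite scale1r.
  have := congr1 (fun Z : 'M[F]_n => Z l j) hY; rewrite !mxE (negbTE lj) epE => ->.
  by rewrite scale0r.
by apply: evaluates_sum => l _; rewrite !mxE iME iLE; apply: evaluatesM.
Qed.

Lemma upcopy1 (K : nat) i : upcopy (Rleg R (idfun : {rmorphism F -> F}) K)
  (Rinv R (idfun : {rmorphism F -> F}) K) 1 i = 1.
Proof. by elim: i => //= i ->; rewrite mulr1 (RlegK q0 hR). Qed.

Local Notation scF := (idfun : {rmorphism F -> F}).
Local Notation MM A sc k X := (\prod_(i < k) upcopy (Rleg R sc k) (Rinv R sc k) (leg_at k 0 X) i).

(** The explicit formula for the action, R-traced over the last factor and paired with an arbitrary
    scalar matrix G. For a Schur polynomial, G is the product of the C's with the idempotent. *)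
Lemma action_trace k (G : tensOp F N k) (M := generator_mx R) :
  is_action (trR msc Psi M) (\tr (map_mx msc G *m MM MR msc k M))
    (\tr (map_mx msc (G *m ptC Psi scF (jminv (Rinv R scF k.+1) k)) *m MM MR msc k M)).
Proof.
have [iL iLE] := iotaL_rmorphism R.
have [iM iME] := iotaM_rmorphism R.
have [ep epE] := counit_rmorphism R.
have iLs : iL \o msc =1 dsc.
  by move=> c; rewrite /= iLE /pcst iotaLZ -iLE (rmorph1 iL).
have iMs : iM \o msc =1 dsc.
  by move=> c; rewrite /= iME /pcst iotaMZ -iME (rmorph1 iM).
have eps : ep \o msc =1 scF.
  by move=> c; rewrite /= epE /pcst counitZ -epE (rmorph1 ep) mulr1.
have iLM : map_mx iL M = LD R by apply/matrixP => i j; rewrite !mxE iLE iotaL_gen mxE.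
have iMM : map_mx iM M = MD R by apply/matrixP => i j; rewrite !mxE iME iotaM_gen mxE.
have epM : map_mx ep M = 1%:M by apply/matrixP => i j; rewrite !mxE epE counit_gen.
suff [s hs hc] : evaluates (iotaL (trR msc Psi M) * iotaM (\tr (map_mx msc G *m MM MR msc k M)))
  (\tr (map_mx msc (G *m ptC Psi scF (jminv (Rinv R scF k.+1) k)) *m MM MR msc k M)) by exists s.
have mi : msc \o scF =1 msc by [].
have di : dsc \o scF =1 dsc by [].
have dC := @pcst_central _ _ (double_rels R).
have mC := @pcst_central _ _ (RE_rels R).
rewrite -iLE -iME (map_trR Psi iLs) (map_tr_sc iMs) iLM (map_upcopies R iMs) iMM.
rewrite mul_tr_sc //.
(* Tr_R L becomes the R-trace, over an additional last factor, of the underlined copy of L; the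
   copies of M are drawn under this trace, where L can be moved past them. *)
rewrite -(ptC_downcopy q0 hR hPsi dC) mulmxE -ptC_mulr widen_upcopies.
rewrite (downcopy_upcopies_legs q0 hR dC k (LD_MD_perm R)).
have -> : \tr (map_mx msc (G *m ptC Psi scF (jminv (Rinv R scF k.+1) k)) *m MM MR msc k M) =
    \tr (map_mx msc G *m ptC Psi msc (map_mx msc (jminv (Rinv R scF k.+1) k) *m
      \prod_(i < k) upcopy (Rleg R msc k.+1) (Rinv R msc k.+1) (leg_at k.+1 0 M) i)).
  rewrite mulmxE -widen_upcopies ptC_mulr map_mxM (map_ptC Psi mi).
  by rewrite -!mulmxE mulmxA.
apply: evaluates_mx_tr; apply: evaluates_mx_sc; apply: evaluates_mx_ptC.
rewrite -mulrA -(map_jminv R di) -[in X in evaluates_mx X _]mulmxE.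
apply: evaluates_mx_sc.
rewrite -iLM -iMM -(map_upcopies R iMs) -(map_upcopy R iLs).
apply: (map_counit _ iME iLE epE).
by rewrite (map_upcopy R eps) epM leg_at1 -[1%:M]/1 upcopy1.
Qed.

End Existence.

Lemma tr_scale_sc (F : fieldType) (A : pzRingType) (sc : {rmorphism F -> A}) n c
    (G : 'M[F]_n) (X : 'M[A]_n) :
  \tr (map_mx sc (c *: G) *m X) = sc c * \tr (map_mx sc G *m X).
Proof.
rewrite /mxtrace mulr_sumr; apply: eq_bigr => i _.
rewrite !mxE mulr_sumr; apply: eq_bigr => j _.
by rewrite !mxE rmorphM mulrA.
Qed.

Lemma tr_scale_pcst (F : fieldType) (I : choiceType) (rels : set (freeAlg F I)) n c
    (G : 'M[F]_n) (X : 'M[palg rels]_n) :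
  \tr (map_mx (pcst rels) (c *: G) *m X) = c *: \tr (map_mx (pcst rels) G *m X).
Proof.
etransitivity; first exact: (@tr_scale_sc F _ (pcst rels) n c G X).
exact: pcstE.
Qed.

Section Casimir.
Variables (F : fieldType) (N : nat) (q : F) (R Psi : tensOp F N 2) (k : nat).
Local Notation scF := (idfun : {rmorphism F -> F}).

Lemma idempotent_ptC_jminv (P : heckeAlg q k) (T : 'I_k -> nat * nat) :
  generic q -> GL_type q R N -> skew_inverse R Psi -> young_idempotent T P ->
  rho R P *m ptC Psi scF (jminv (Rinv R scF k.+1) k) = chi q N T *: rho R P.
Proof.
move=> hq hG hPsi [_ hP]; have tC := trace_C hq hG hPsi.
have [q0 _ _ hq1] := hq; have [hR _ _] := hG.
have qN : q ^+ N != 0 by rewrite expf_neq0.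
have d0 : q - q^-1 != 0 by apply: subrV_neq0 => //; apply: hq1.
have q21 : q * q - 1 != 0.
  by rewrite -(mulfV q0) -mulrBr mulf_neq0.
rewrite (ptC_jminv q0 hR hPsi (@idfun_central F)) tC.
(* As Tr C = (1 - q^(-2N)) / nu, the factor 1 - nu Tr C equals q^(-2N); this is the origin of the
   constant nu / q^(2N). *)
have -> : (q - q^-1) * (1 - (q - q^-1) * (qnum q N / q ^+ N)) = (q - q^-1) / q ^+ (2 * N).
  rewrite /qnum mulnC exprM expr2; set Q := q ^+ N in qN *.
  by field; rewrite q0 q21 qN.
have hj (i : 'I_k) : rho R P * jminv (Rinv R scF k) i = q ^ (-2 * content (T i)) *: rho R P.
  by apply: (rho_idempotent_jminv q0 hR); have [_ ->] := hP i.
move: (rho R P) hj => rP hj.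
rewrite mulmxE mulrBr -[rP * _%:M]scalar_central [rP * (_ * _)]mulrA -[rP * _%:M]scalar_central.
rewrite -[_ * rP * _]mulrA mulr_sumr (eq_bigr _ (fun i _ => hj i)) -scaler_suml.
by rewrite -!mulmxE !mul_scalar_mx scalerA -scalerBl.
Qed.

Lemma schur_eigenvector (lam : seq nat) (T T' : 'I_k -> nat * nat) (P : heckeAlg q k) :
  generic q -> GL_type q R N -> skew_inverse R Psi ->
  standard_tableau lam T -> young_idempotent T P -> standard_tableau lam T' ->
  REaction (trR (pcst (RE_rels R)) Psi (generator_mx R)) (schur R Psi P)
    = chi q N T' *: schur R Psi P.
Proof.
move=> hq hG hPsi hT hP hT'.
have [q0 _ _ _] := hq; have [hR _ _] := hG.
(* The idempotent supplies the contents along its own tableau T only. *)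
have -> : chi q N T' = chi q N T.
  by rewrite /chi (tableau_sum (fun b => q ^ (-2 * content b)) hT hT').
apply: (REaction_eq q0 hR hPsi).
set GC := \prod_(i < k) leg1 i (Cmat Psi).
have schurE : schur R Psi P = \tr (map_mx (pcst (RE_rels R)) (GC *m rho R P) *m
    \prod_(i < k) upcopy (Rleg R (pcst (RE_rels R)) k) (Rinv R (pcst (RE_rels R)) k)
      (leg_at k 0 (generator_mx R)) i).
  rewrite /schur /trRall map_mxM -mulmxA; congr (\tr (_ *m (_ *m _))).
  by apply: eq_bigr => i _; rewrite (barcopyE q0 hR).
rewrite schurE; have := action_trace q0 hR hPsi (GC *m rho R P).
(* Next to the idempotent, the R-trace of the inverse Jucys-Murphy element is the number [chi], so
   the action multiplies G by it. *)
rewrite -[GC *m _ *m _]mulmxA (idempotent_ptC_jminv hq hG hPsi hP) -scalemxAr => h.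
refine (eq_ind _ (is_action _ _) h _ _); exact: tr_scale_pcst.
Qed.

End Casimir.

Theorem corollary6 (K : realType) (N : nat) (q : K[i])
    (R Psi : tensOp K[i] N 2)
    (k : nat) (lam : seq nat) (T T' : 'I_k -> nat * nat) (P : heckeAlg q k) :
  generic q ->
  GL_type q R N ->
  skew_inverse R Psi ->
  is_partition_of k lam ->
  standard_tableau lam T ->
  young_idempotent T P ->
  standard_tableau lam T' ->
  REaction (trR (pcst (RE_rels R)) Psi (generator_mx R)) (schur R Psi P)
    = chi q N T' *: schur R Psi P.
Proof. move=> hq hG hPsi _; exact: schur_eigenvector. Qed.
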